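(* Fix $n$. For a strong composition $\gamma$ with at most $n$ parts, define \[ G_\gamma(x_1,\dots,x_n;q,t)=\sum_{\alpha:\ \alpha^+=\gamma}F_\alpha(x_1,\dots,x_n;q,t),\qquad F_\alpha=E^{\beta(\alpha)}_{\mathrm{inc}(\alpha)}, \] the sum over weak compositions $\alpha$ of length $n$ with $\alpha^+=\gamma$. Then: (A) for every partition $\lambda$ with at most $n$ parts, $P_\lambda(x_1,\dots,x_n;q,t)=\sum_\gamma G_\gamma(x_1,\dots,x_n;q,t)$, the sum over all strong compositions $\gamma$ whose parts are a rearrangement of the parts of $\lambda$; (B) $G_\gamma(x_1,\dots,x_n;q,t)$ is a quasisymmetric polynomial in $x_1,\dots,x_n$ (with coefficients in $\mathbb{Q}(q,t)$), i.e. for $i_1<\dots<i_k$ the coefficient of $x_{i_1}^{a_1}\cdots x_{i_k}^{a_k}$ equals the coefficient of $x_1^{a_1}\cdots x_k^{a_k}$; (C') for every weak composition $\alpha$ of length $n$, $F_\alpha(x_1,\dots,x_n;0,t)=E^{\mathrm{id}}_\alpha(x_1,\dots,x_n;0,t)$; (C) consequently $G_\gamma(x_1,\dots,x_n;0,0)=\mathrm{QS}_\gamma(x_1,\dots,x_n)$.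
   Context: $P_\lambda$ is the symmetric Macdonald polynomial. Weak composition: $\alpha=(\alpha_1,\dots,\alpha_n)\in\mathbb{Z}_{\ge0}^n$; $\alpha^+$ is the strong composition obtained by deleting zeros; $\mathrm{inc}(\alpha)$ is the weakly increasing rearrangement; $\beta(\alpha)\in S_n$ is the permutation of maximal length with $\alpha_{\beta(i)}=\mathrm{inc}(\alpha)_i$ for all $i$ (e.g. $\alpha=(0,2,0,2,1,3)$ gives $\beta(\alpha)=(3,1,5,4,2,6)$ in one-line notation). Permuted-basement nonsymmetric Macdonald polynomial $E^\beta_\alpha$ for $\beta\in S_n$: $\mathrm{dg}^\beta(\alpha)$ consists of cells $(i,r)$, $1\le r\le\alpha_i$ (columns from the left, rows from the bottom) together with a basement row $0$ whose cell $(i,0)$ contains $\beta(i)$, for all $1\le i\le n$. $\mathrm{leg}(i,r)=\alpha_i-r$; $\mathrm{arm}(i,r)$ is the set (and number) of cells $(j,r)$ with $j>i$, $\alpha_j\le\alpha_i$, together with cells $(j,r-1)$ (basement cells included when $r=1$) with $j<i$, $\alpha_j<\alpha_i$. A filling assigns entries of $\{1,\dots,n\}$ to the non-basement cells. Two cells attack if in the same row, or in adjacent rows and different columns with the rightmost one in the upper row; the filling is nonattacking if no two attacking cells (basement included) have equal entries. Reading order: rows read left to right from the top row down to the basement; among equal entries the one read first is smaller. Type A triple: $(v,r),(u,r),(u,r-1)$, $u<v$, $(v,r)$ in arm of $(u,r)$, $a=\sigma(v,r)$; type B triple: $(v,r-1),(u,r),(u,r-1)$, $v<u$, $(v,r-1)$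 in arm of $(u,r)$, $a=\sigma(v,r-1)$; in both $r\ge1$ (the top cells lie above the basement), $b=\sigma(u,r)$, $c=\sigma(u,r-1)$, and it is a coinversion triple if $a\le c<b$ or $c<b\le a$ or $b\le a\le c$ (with the reading-order tie-break). $\mathrm{coinv}$ counts coinversion triples. $\mathrm{South}(s)$ is the cell directly below $s$ (possibly a basement cell); a descent is a non-basement cell $s$ with $\sigma(s)>\sigma(\mathrm{South}(s))$; $\mathrm{maj}=\sum_{\text{descents}}(\mathrm{leg}+1)$. Then $E^\beta_\alpha(x_1,\dots,x_n;q,t)=\sum_\sigma x^\sigma q^{\mathrm{maj}(\sigma)}t^{\mathrm{coinv}(\sigma)}\prod_{s:\ \sigma(s)\ne\sigma(\mathrm{South}(s))}\frac{1-t}{1-q^{\mathrm{leg}(s)+1}t^{\mathrm{arm}(s)+1}}$, the sum over nonattacking fillings, the product over non-basement cells $s$, and $x^\sigma=\prod_{s\text{ non-basement}}x_{\sigma(s)}$. $\mathrm{id}$ is the identity permutation. The quasisymmetric Schur polynomial is $\mathrm{QS}_\gamma(x_1,\dots,x_n)=\sum_{\alpha:\ \alpha^+=\gamma}E^{\mathrm{id}}_\alpha(x_1,\dots,x_n;0,0)$ (sum over weak compositions of length $n$). *)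

(* Defs.v *)
From HB Require Import structures.
From mathcomp Require Import all_boot all_order all_algebra all_fingroup.
From mathcomp Require Import fraction.
From mathcomp Require Import mpoly.

Set Implicit Arguments.
Unset Strict Implicit.
Unset Printing Implicit Defensive.

Import GRing.Theory.
Local Open Scope ring_scope.

(* Conventions.  Columns are indexed 0..n-1 (paper: 1..n), rows from  *)
(* the bottom, row 0 = basement.  A weak composition is a [seq nat],  *)
(* alpha_i = nth 0 alpha i.  Entries of fillings (and of the basement)*)
(* lie in 'I_n, i.e. are shifted by one w.r.t. the paper's {1..n};    *)
(* variable x_{k+1} of the paper is 'X_k here.                        *)

Section Diagram.
Variables (n : nat) (alpha : seq nat) (beta : 'S_n).

Definition acol (i : nat) : nat := nth 0%N alpha i.

Definition cell_pred (c : 'I_n * 'I_(sumn alpha).+1) : bool :=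
  (0 < c.2)%N && (c.2 <= acol c.1)%N.
Definition cellT := {c : 'I_n * 'I_(sumn alpha).+1 | cell_pred c}.

Definition filling := {ffun cellT -> 'I_n}.

Definition cells : seq (nat * nat) :=
  [seq (i, r) | i <- iota 0 n, r <- iota 1 (acol i)].
Definition dgcells : seq (nat * nat) :=
  [seq (i, r) | i <- iota 0 n, r <- iota 0 (acol i).+1].

Definition ent (s : filling) (c : nat * nat) : nat :=
  match (insub c.1 : option 'I_n) with
  | Some i =>
      if c.2 == 0%N then val (beta i) else
      match (insub c.2 : option 'I_(sumn alpha).+1) with
      | Some r =>
          match (insub (i, r) : option cellT) with
          | Some x => val (s x)
          | None => 0%N
          end
      | None => 0%N
      end
  | None => 0%N
  end.

Definition south (c : nat * nat) : nat * nat := (c.1, c.2.-1).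

Definition leg (c : nat * nat) : nat := (acol c.1 - c.2)%N.

(* arm(i, r): cells (j, r), j > i, alpha_j <= alpha_i, together with  *)
(* cells (j, r-1), j < i, alpha_j < alpha_i (basement when r = 1)     *)
Definition arm (c : nat * nat) : nat :=
  let: (i, r) := c in
  (\sum_(0 <= j < n)
     ([&& (i < j)%N, (acol j <= acol i)%N & (r <= acol j)%N] : nat)
   + \sum_(0 <= j < n)
     ([&& (j < i)%N, (acol j < acol i)%N & (r.-1 <= acol j)%N] : nat))%N.

Definition attack (c d : nat * nat) : bool :=
  let: (i, r) := c in let: (j, s) := d in
  [|| (r == s) && (i != j),
      (r == s.+1) && (j < i)%N
    | (s == r.+1) && (i < j)%N].

Definition nonattacking (s : filling) : bool :=
  all (fun c => all (fun d => attack c d ==> (ent s c != ent s d)) dgcells)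
      dgcells.

Definition readbefore (c d : nat * nat) : bool :=
  (d.2 < c.2)%N || ((c.2 == d.2) && (c.1 < d.1)%N).

Definition ltc (s : filling) (c d : nat * nat) : bool :=
  (ent s c < ent s d)%N || ((ent s c == ent s d) && readbefore c d).
Definition lec (s : filling) (c d : nat * nat) : bool :=
  (c == d) || ltc s c d.

(* coinversion condition for a triple with entries a, b, c at positions *)
(* pa, pb (top of the column u) and pc (below pb) *)
Definition coinv_triple (s : filling) (pa pb pc : nat * nat) : bool :=
  [|| lec s pa pc && ltc s pc pb,
      ltc s pc pb && lec s pb pa
    | lec s pb pa && lec s pa pc].

Definition coinv (s : filling) : nat :=
  (\sum_(0 <= u < n) \sum_(0 <= v < n) \sum_(1 <= r < (acol u).+1)
     (([&& (u < v)%N, (acol v <= acol u)%N, (r <= acol v)%N &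
           coinv_triple s (v, r) (u, r) (u, r.-1)] : nat)
    + ([&& (v < u)%N, (acol v < acol u)%N, (r.-1 <= acol v)%N &
           coinv_triple s (v, r.-1) (u, r) (u, r.-1)] : nat)))%N.

Definition maj (s : filling) : nat :=
  (\sum_(c <- cells) ((ent s (south c) < ent s c)%N : nat) * (leg c).+1)%N.

Variables (K : fieldType) (q t : K).

Definition cell_weight (s : filling) (c : nat * nat) : K :=
  if ent s c != ent s (south c)
  then (1 - t) / (1 - q ^+ (leg c).+1 * t ^+ (arm c).+1)
  else 1.

Definition Emac : {mpoly K[n]} :=
  \sum_(s : filling | nonattacking s)
    (q ^+ maj s * t ^+ coinv s * \prod_(c <- cells) cell_weight s c)
      *: \prod_(x : cellT) 'X_(s x).

End Diagram.

Definition inc (alpha : seq nat) : seq nat := sort leq alpha.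

Definition perm_length n (s : 'S_n) : nat :=
  #|[set p : 'I_n * 'I_n | (p.1 < p.2)%N && (s p.2 < s p.1)%N]|.

Definition beta_cond n (alpha : seq nat) (s : 'S_n) : bool :=
  [forall i : 'I_n, nth 0%N alpha (s i) == nth 0%N (inc alpha) i].

(* beta(alpha): the permutation of maximal length with                *)
(* alpha_{beta(i)} = inc(alpha)_i  (it is unique)                      *)
Definition is_beta_of n (alpha : seq nat) (s : 'S_n) : bool :=
  beta_cond alpha s &&
  [forall s' : 'S_n, beta_cond alpha s' ==> (perm_length s' <= perm_length s)%N].

Definition beta_of n (alpha : seq nat) : 'S_n :=
  odflt 1%g [pick s : 'S_n | is_beta_of alpha s].

Definition Fmac n (K : fieldType) (q t : K) (alpha : seq nat) : {mpoly K[n]} :=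
  Emac (inc alpha) (beta_of n alpha) q t.

Definition strongpart (alpha : seq nat) : seq nat := [seq x <- alpha | x != 0%N].

Definition strong_composition (g : seq nat) : bool := all (fun x => 0 < x)%N g.

(* sum of f(alpha) over weak compositions alpha of length n with       *)
(* alpha^+ = gamma (entries of such alpha are <= sumn gamma)          *)
Definition sum_over_weak n (K : fieldType) (gamma : seq nat)
    (f : seq nat -> {mpoly K[n]}) : {mpoly K[n]} :=
  \sum_(a : {ffun 'I_n -> 'I_(sumn gamma).+1}
          | strongpart [seq val (a i) | i <- enum 'I_n] == gamma)
     f [seq val (a i) | i <- enum 'I_n].

Definition Gmac n (K : fieldType) (q t : K) (gamma : seq nat) : {mpoly K[n]} :=
  sum_over_weak gamma (fun alpha => Fmac n q t alpha).

Definition QS n (gamma : seq nat) : {mpoly rat[n]} :=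
  sum_over_weak gamma (fun alpha => Emac alpha (1%g : 'S_n) (0 : rat) 0).

(* for m = x_{i_1}^{a_1} ... x_{i_k}^{a_k} (i_1 < ... < i_k, a_j > 0), *)
(* packm m = x_1^{a_1} ... x_k^{a_k}                                  *)
Definition packm n (m : 'X_{1..n}) : 'X_{1..n} :=
  [multinom nth 0%N (strongpart (m : seq nat)) i | i < n].

Definition quasisymmetric n (K : comRingType) (p : {mpoly K[n]}) : Prop :=
  forall m : 'X_{1..n}, p@_m = p@_(packm m).

(* Symmetric Macdonald polynomials P_lambda(x_1..x_n; q, t)            *)
(* (Macdonald, Symmetric functions and Hall polynomials, VI.3-4):     *)
(* P_lambda is the symmetric polynomial with                          *)
(*   P_lambda = m_lambda + sum_{mu < lambda (dominance)} u m_mu       *)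
(* and D^1_n P_lambda = (sum_i q^{lambda_i} t^{n-i}) P_lambda, where  *)
(*   D^1_n = sum_i a_delta^{-1} (T_{t,x_i} a_delta) T_{q,x_i}.         *)
(* The eigen-equation is stated multiplied through by a_delta.        *)

Definition is_partition (lam : seq nat) : bool :=
  sorted geq lam && all (fun x => 0 < x)%N lam.

(* T_{c, x_i} : x_i |-> c x_i *)
Definition Tshift n (K : comRingType) (c : K) (i : 'I_n) (p : {mpoly K[n]})
    : {mpoly K[n]} :=
  \sum_(m <- msupp p) (p@_m * c ^+ (m i)) *: 'X_[m].

Definition adelta n (K : comRingType) : {mpoly K[n]} :=
  \sum_(w : 'S_n) (-1) ^+ odd_perm w *: \prod_(i < n) 'X_(w i) ^+ (n.-1 - i).

(* a_delta * D^1_n p *)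
Definition aD1 n (K : comRingType) (q t : K) (p : {mpoly K[n]}) : {mpoly K[n]} :=
  \sum_(i < n) Tshift t i (adelta n K) * Tshift q i p.

Definition dominated (mu lam : seq nat) : bool :=
  (sumn mu == sumn lam) &&
  all (fun k => sumn (take k mu) <= sumn (take k lam))%N (iota 0 (size lam).+1).

Definition is_macdonaldP n (K : fieldType) (q t : K) (lam : seq nat)
    (P : {mpoly K[n]}) : Prop :=
  let lamn := lam ++ nseq (n - size lam) 0%N in
  [/\ P \is symmetric,
      P@_([multinom nth 0%N lam i | i < n]) = 1,
      (forall m : 'X_{1..n}, P@_m != 0 -> dominated (sort geq (m : seq nat)) lamn)
    & aD1 q t P
      = (\sum_(i < n) q ^+ (nth 0%N lam i) * t ^+ (n.-1 - i)) *: (adelta n K * P)].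

Definition Qqt : fieldType := {fraction {poly {poly rat}}}.
Definition qQ : Qqt := tofrac (('X : {poly rat})%:P).
Definition tQ : Qqt := tofrac ('X : {poly {poly rat}}).

Definition Qt : fieldType := {fraction {poly rat}}.
Definition tT : Qt := tofrac ('X : {poly rat}).

(* Main.v *)
(* Peeling off rows writes E^beta_alpha as Z_0(beta), where Z_r(w), for a row w of labels, is the sum over
   the possible next rows w' of K_r(w, w') x^(w') Z_(r+1)(w').  A local identity for the positions of two
   labels j, j+1 in consecutive rows shows, by induction on the rows, that the Demazure-Lusztig operator
   T_j exchanges these labels in the basement.  Hence F_(s_j alpha) = T_j F_alpha if
   alpha_j > alpha_(j+1), and F_alpha is s_j-invariant if alpha_j = alpha_(j+1).

   (B) F_alpha + F_(s_j alpha) is s_j-invariant.  As the columns of inc(alpha) increase in height, row 1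
   repeats the basement, so x_i divides F_alpha whenever alpha_i > 0; this gives quasisymmetry.

   (C') At q = 0 a column whose lowest label is the smallest one is constant and can be moved past the
   next one; the operators T_j reduce all exchanges of columns to this case.  (C) follows, because at
   q = 0 the coefficients are polynomials in t.

   (A) The orbit sum P of the F_alpha is symmetric; comparing a row with the row below it yields
   dominance and the leading coefficient.  For the eigenvalue equation, rotating the variables gives
   T_(q,x_n) P = sum_alpha q^(alpha_n) F_alpha.  The functional J(g) = sum_w sgn(w) w(g C), with
   C = prod_(i<j) (t x_j - x_i), satisfies J(T_j g) = t J(g), so J(F_alpha) is a power of t times
   J(F_lambda) and J(T_(q,x_n) P) is an explicit multiple of J(P) = P J(1).  For g symmetric in the first
   n - 1 variables, the partial antisymmetrization of C is a multiple of the Vandermonde product, which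
   turns J(T_(q,x_n) P) into a multiple of a_delta D^1 P. *)

Require Import Defs.
From HB Require Import structures.
From mathcomp Require Import all_boot all_order all_algebra all_fingroup.
From mathcomp Require Import fraction.
From mathcomp Require Import mpoly.
From mathcomp Require Import ring zify.
From Stdlib Require Import FunctionalExtensionality.

Set Implicit Arguments.
Unset Strict Implicit.
Unset Printing Implicit Defensive.

Import GRing.Theory.
Local Open Scope ring_scope.

(** * Demazure-Lusztig relations *)

(** [T_j] divides by [x_j - x_(j+1)], so it is never applied as a map: [Trel g h] states [h = T_j g]
    with the denominator cleared, and is shown to be functional and, for [t != 0], injective. The
    main obstacle is that the weight of two consecutive rows does not split into a part seeing the
    labels [j], [j+1] and a rest, because a coinversion is a condition on three entries. Multiplying
    by [t] to the sum of all arms repairs this: in a nonattacking filling, one plus the indicator of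
    a coinversion is a sum of three pairwise comparisons, and comparisons with a third label do not
    distinguish [j] from [j+1]. The relations hold for an upper row taken together with its
    exchange, not for single upper rows; summing over such pairs counts every row twice, hence the
    assumption [2 != 0]. The link with [F_alpha] is that any permutation sorting [alpha] may serve
    as basement, since columns of equal height can be exchanged; an exchange of parts then becomes
    an exchange of labels. For the eigenvalue, sums over an orbit are lifted to the whole symmetric
    group, with weights that turn the powers of [t] into inversion numbers. *)

Lemma msymXU n (R : nzRingType) (s : 'S_n) (i : 'I_n) :
  msym s ('X_i : {mpoly R[n]}) = 'X_(s i).
Proof.
rewrite msymX; congr 'X_[_]; apply/mnmP => k.
by rewrite !mnmE; congr (nat_of_bool _); apply/eqP/eqP => [->|<-]; rewrite ?permKV ?permK.
Qed.

Section HeckeRelation.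
Variables (n : nat) (K : fieldType) (t : K) (i j : 'I_n).
Hypothesis neq_ij : i != j.
Implicit Types f g h : {mpoly K[n]}.

(* [h = T g], for the Demazure-Lusztig operator
   [T g = t g - (t x_i - x_j) (g - s g) / (x_i - x_j)]. *)
Definition Trel g h : Prop :=
  (t *: g - h) * ('X_i - 'X_j) = (t *: 'X_i - 'X_j) * (g - msym (tperm i j) g).

Lemma msym_tperm_l : msym (tperm i j) ('X_i : {mpoly K[n]}) = 'X_j.
Proof. by rewrite msymXU tpermL. Qed.

Lemma msym_tperm_r : msym (tperm i j) ('X_j : {mpoly K[n]}) = 'X_i.
Proof. by rewrite msymXU tpermR. Qed.

Lemma subX_neq0 : ('X_i - 'X_j : {mpoly K[n]}) != 0.
Proof.
rewrite subr_eq0; apply/eqP => /(congr1 (fun p => p@_(U_(i)))) /eqP.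
by rewrite !mcoeffXU eqxx [j == i]eq_sym (negbTE neq_ij) oner_eq0.
Qed.

Lemma TrelD g1 h1 g2 h2 : Trel g1 h1 -> Trel g2 h2 -> Trel (g1 + g2) (h1 + h2).
Proof.
rewrite /Trel !msymD -!mul_mpolyC => E1 E2.
transitivity ((t%:MP * g1 - h1) * ('X_i - 'X_j) + (t%:MP * g2 - h2) * ('X_i - 'X_j)).
  ring.
rewrite E1 E2; ring.
Qed.

Lemma TrelZ c g h : Trel g h -> Trel (c *: g) (c *: h).
Proof.
rewrite /Trel msymZ -!mul_mpolyC => E.
transitivity (c%:MP * ((t%:MP * g - h) * ('X_i - 'X_j))); first by ring.
rewrite E; ring.
Qed.

Lemma Trel0 : Trel 0 0.
Proof. by rewrite /Trel msym0 scaler0 !subr0 mul0r mulr0. Qed.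

Lemma Trel_sum (I : Type) (r : seq I) (P : pred I) (G H : I -> {mpoly K[n]}) :
  (forall k, P k -> Trel (G k) (H k)) ->
  Trel (\sum_(k <- r | P k) G k) (\sum_(k <- r | P k) H k).
Proof.
move=> GH; elim/big_rec2: _ => [|k h g Pk IH]; first exact: Trel0.
by apply: TrelD => //; exact: GH.
Qed.

Lemma Trel_fun g h1 h2 : Trel g h1 -> Trel g h2 -> h1 = h2.
Proof.
rewrite /Trel => E1; rewrite -{}E1 => /(mulIf subX_neq0) /addrI /oppr_inj.
by move=> ->.
Qed.

(* [Trel g h] says that [g + h] and [t x_j g + x_i h] are both symmetric. *)
Lemma Trel_sumP g h : Trel g h -> msym (tperm i j) (g + h) = g + h.
Proof.
rewrite /Trel => E.
have E' := congr1 (msym (tperm i j)) E; move: E'.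
rewrite !(msymM, msymD, msymN, msymZ) msym_tperm_l msym_tperm_r -msymMm tperm2 msym1m.
move: E; rewrite -!mul_mpolyC; set g' := msym _ g; set h' := msym _ h => E E'.
apply: (mulIf subX_neq0); apply/eqP; rewrite -subr_eq0; apply/eqP.
transitivity (((t%:MP * g' - h') * ('X_j - 'X_i) - (t%:MP * 'X_j - 'X_i) * (g' - g))
  + ((t%:MP * g - h) * ('X_i - 'X_j) - (t%:MP * 'X_i - 'X_j) * (g - g'))); first by ring.
by rewrite E E' !subrr addr0.
Qed.

(** The quadratic relation [(T - t)(T + 1) = 0]. As [g + h] is symmetric, the reflection of [h] can
    be eliminated, and the claim becomes the relation for [g] up to sign. *)
Lemma Trel_quad g h : Trel g h -> Trel h ((t - 1) *: h + t *: g).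
Proof.
move=> E; move: (Trel_sumP E) (E); rewrite msymD /Trel.
rewrite -!mul_mpolyC !mpolyCB mpolyC1; set g' := msym _ g; set h' := msym _ h => S {}E.
have -> : h' = g + h - g' by rewrite -S; ring.
apply/eqP; rewrite -subr_eq0; apply/eqP.
transitivity (- ((t%:MP * g - h) * ('X_i - 'X_j) - (t%:MP * 'X_i - 'X_j) * (g - g'))).
  ring.
by rewrite E subrr oppr0.
Qed.

Lemma Trel_sym g : msym (tperm i j) g = g -> Trel g (t *: g).
Proof. by rewrite /Trel => ->; rewrite !subrr mul0r mulr0. Qed.

Lemma Trel_msym f g h : msym (tperm i j) f = f -> Trel g h -> Trel (f * g) (f * h).
Proof.
rewrite /Trel msymM => -> E; rewrite -!mul_mpolyC in E *.
transitivity (f * ((t%:MP * g - h) * ('X_i - 'X_j))); first by ring.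
rewrite E; ring.
Qed.

(* On multiplication operators, [T x_i = x_j (T + 1 - t)]. *)
Lemma TrelX g h : Trel g ((t - 1) *: g + h) -> Trel ('X_i * g) ('X_j * h).
Proof.
rewrite /Trel msymM msym_tperm_l -!mul_mpolyC mpolyCB mpolyC1.
set g' := msym _ g => E.
have E' : (t%:MP * g - ((t%:MP - 1) * g + h)) * ('X_i - 'X_j)
   - (t%:MP * 'X_i - 'X_j) * (g - g') = 0 by rewrite E subrr.
apply/eqP; rewrite -subr_eq0; apply/eqP; rewrite -[RHS](mulr0 'X_j) -E'; ring.
Qed.

Lemma Trel_symE g : Trel g (t *: g) -> t != -1 -> msym (tperm i j) g = g.
Proof.
move=> /Trel_sumP; rewrite -{1 3}[g]scale1r -!scalerDl msymZ => E t1.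
have c0 : 1 + t != 0 by rewrite addrC -[1]opprK subr_eq0.
by rewrite -[LHS](scalerK c0) E scalerA mulVf // scale1r.
Qed.

(** The quadratic relation recovers [g] from [h] and its image, once [t] is invertible. *)
Lemma Trel_inj g1 g2 h : t != 0 -> Trel g1 h -> Trel g2 h -> g1 = g2.
Proof.
move=> t0 /Trel_quad E1 /Trel_quad /(Trel_fun E1) /addrI.
exact: (can_inj (scalerK t0)).
Qed.

End HeckeRelation.

(** Here [r] is the lower of two consecutive rows, and [armA], [armB] are the two halves of the arm
    of the cell of column [u] in row [r + 1]: cells of the same row on the right, cells of row [r]
    on the left. *)
Definition armA n (h : 'I_n -> nat) (r : nat) (u v : 'I_n) : bool :=
  [&& (u < v)%N, (h v <= h u)%N & (r < h v)%N].

Definition armB n (h : 'I_n -> nat) (r : nat) (u v : 'I_n) : bool :=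
  [&& (v < u)%N, (h v < h u)%N & (r <= h v)%N].

(** * Local identities for two labels in consecutive rows *)

Section Local.
Variables (n : nat) (K : fieldType) (t : K) (h : 'I_n -> nat) (r : nat).
Variable y : 'I_n -> K.
Hypothesis t0 : t != 0.
Hypothesis y1 : forall u, (r < h u)%N -> 1 - t * y u != 0.

Definition olt (o1 o2 : option 'I_n) : bool :=
  if o1 is Some u then if o2 is Some v then (u < v)%N else false else false.
Definition orel (R : 'I_n -> 'I_n -> bool) (o1 o2 : option 'I_n) : bool :=
  if o1 is Some u then if o2 is Some v then R u v else false else false.
Definition oeq (o1 o2 : option 'I_n) (c : 'I_n -> K) : K :=
  if o1 is Some u then if o2 is Some v then if (u == v :> nat) then c u else 1 else 1 else 1.

(* The factor of the weight of two consecutive rows that depends on which of the labels [j], [j+1] is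
   which: [m1], [m2] are the columns of [j], [j+1] in the lower row, [n1], [n2] those in the upper row. *)
Definition loc (m1 m2 n1 n2 : option 'I_n) : K :=
  (if olt m1 n1 || olt m2 n2 then 0 else 1)
  * (t ^+ orel (armA h r) m2 n1 * t ^+ orel (armA h r) n1 n2
     * t ^+ orel (armB h r) m2 m1 * t ^+ orel (armB h r) n1 m2)
  * oeq n1 m2 (fun u => (1 - t) / (1 - t * y u))
  * oeq n2 m1 (fun u => (1 - t) / (1 - t * y u) * y u).

Ltac ord_cmp a b :=
  try (case: (ltngtP (nat_of_ord a) (nat_of_ord b));
  [move=> ? | move=> ? | move=> /val_inj ?; subst; rewrite ?eqxx ?ltnn ?leqnn];
  try (exfalso; lia)).
Ltac h_atoms :=
  repeat match goal with
  | |- context [(h ?x <= h ?y)%N] => case: (leqP (h x) (h y)) => ? /=; try (exfalso; lia)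
  | |- context [(h ?x < h ?y)%N] => case: (leqP (h y) (h x)) => ? /=; try (exfalso; lia)
  | |- context [(nat_of_ord ?x < nat_of_ord ?y)%N] =>
     case: (leqP y x) => ? /=; try (exfalso; lia)
  end.

Ltac fin :=
  rewrite /= ?(mul0r, mulr0, mul1r, mulr1, expr0, expr1, addr0, add0r);
  h_atoms; rewrite ?(mul0r, mulr0, mul1r, mulr1, expr0, expr1, addr0, add0r);
  try done; try (by field; rewrite ?t0 ?y1 //; lia).

Let E (p1 p2 : 'I_n) : bool := (h p2 <= h p1)%N.

(** In the names the first letter refers to the lower row, the second to the upper one: [N] for
    neither label present, [S] for one, [D] for both. The identities match the coefficients that
    arise when [T] acts on an upper row and its exchange; each is a finite check over the order and
    the heights of the columns. *)
Lemma loc_S_N a : (r <= h a)%N ->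
  loc None (Some a) None None = loc (Some a) None None None.
Proof. by rewrite /loc /=. Qed.

Lemma loc_D_N (a b : 'I_n) : (a < b)%N -> (r <= h a)%N -> (r <= h b)%N ->
  t * loc (Some b) (Some a) None None = t ^+ E a b * loc (Some a) (Some b) None None.
Proof.
move=> ab ra rb; rewrite /loc /E /armB /= ?ra ?rb /= ?andbT.
try ord_cmp a b; rewrite ?andbT; fin.
Qed.

Lemma loc_N_S c : (r < h c)%N ->
  loc None None None (Some c) = loc None None (Some c) None.
Proof. by rewrite /loc /=. Qed.

Lemma loc_N_D (c d : 'I_n) : (c < d)%N -> (r < h c)%N -> (r < h d)%N ->
  loc None None (Some c) (Some d) = t ^+ E c d * loc None None (Some d) (Some c).
Proof.
move=> cd rc rd; rewrite /loc /E /armA /= ?rc ?rd /= ?andbT.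
try ord_cmp c d; rewrite ?andbT; fin.
Qed.

Lemma loc_S_S a c : (r <= h a)%N -> (r < h c)%N ->
  t * loc (Some a) None None (Some c)
    = (t - 1) * loc (Some a) None (Some c) None + loc None (Some a) (Some c) None
  /\ loc None (Some a) None (Some c) = loc (Some a) None (Some c) None.
Proof.
move=> ra rc; rewrite /loc /armA /armB /= ?ra ?rc /= ?andbT.
try ord_cmp a c; split; fin.
Qed.

Lemma loc_S_D (a c d : 'I_n) : (r <= h a)%N -> (c < d)%N -> (r < h c)%N -> (r < h d)%N ->
  t ^+ (~~ E c d) * loc (Some a) None (Some c) (Some d)
    = (t - 1) * loc (Some a) None (Some d) (Some c) + loc None (Some a) (Some d) (Some c)
  /\ loc None (Some a) (Some c) (Some d) = t ^+ E c d * loc (Some a) None (Some d) (Some c).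
Proof.
move=> ra cd rc rd; rewrite /loc /armA /armB /E /= ?ra ?rc ?rd /= ?andbT.
try ord_cmp a c; try ord_cmp a d; try ord_cmp c d; split; fin.
Qed.

Lemma loc_D_S (a b c : 'I_n) : (r <= h a)%N -> (r <= h b)%N -> (a < b)%N -> (r < h c)%N ->
  t * loc (Some b) (Some a) None (Some c)
    = t ^+ E a b * loc (Some a) (Some b) (Some c) None
  /\ loc (Some b) (Some a) (Some c) None + (t - 1) * loc (Some b) (Some a) None (Some c)
    = t ^+ E a b * loc (Some a) (Some b) None (Some c).
Proof.
move=> ra rb ab rc; rewrite /loc /armA /armB /E /= ?ra ?rb ?rc /= ?andbT.
try ord_cmp a c; try ord_cmp b c; try ord_cmp a b; split; fin.
Qed.

Lemma loc_D_D (a b c d : 'I_n) : (r <= h a)%N -> (r <= h b)%N -> (a < b)%N ->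
  (r < h c)%N -> (r < h d)%N -> (c < d)%N ->
  t ^+ (~~ E c d) * loc (Some b) (Some a) (Some c) (Some d)
    = t ^+ E a b * loc (Some a) (Some b) (Some d) (Some c)
  /\ t ^+ E c d * loc (Some b) (Some a) (Some d) (Some c)
     + (t - 1) * loc (Some b) (Some a) (Some c) (Some d)
    = t ^+ E a b * loc (Some a) (Some b) (Some c) (Some d).
Proof.
move=> ra rb ab rc rd cd; rewrite /loc /armA /armB /E /= ?ra ?rb ?rc ?rd /= ?andbT.
try ord_cmp a c; try ord_cmp b c; try ord_cmp a d; try ord_cmp b d; try ord_cmp a b; try ord_cmp c d.
all: split; fin.
Qed.

End Local.

(** * Rows of a filling *)

(* Coinversion triples of a nonattacking filling: the only possible tie is [b = c], and then the reading
   order rules out all three cases. *)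
Definition cyc (a b c : nat) : bool :=
  [|| (a < c < b)%N, (c < b < a)%N | (b < a < c)%N].

Definition lbl n (i : 'I_n) : 'I_n.+1 := widen_ord (leqnSn n) i.

(* The label [ord_max] marks the columns that do not reach the row. *)
Definition rowt n := {ffun 'I_n -> 'I_n.+1}.

Section Rows.
Variables (n : nat) (h : 'I_n -> nat) (r : nat).
Implicit Types (w : rowt n) (u v : 'I_n).

Definition rowok (r : nat) w : bool :=
  [forall u : 'I_n, (w u == ord_max) == (h u < r)%N] &&
  [forall u : 'I_n, forall v : 'I_n, (u != v) && (w u == w v) ==> (h u < r)%N].

Definition compat w w' : bool :=
  [forall u : 'I_n, forall v : 'I_n, (u < v)%N && (r < h v)%N ==> (w' v != w u)].

Definition armn u : nat := (\sum_v (armA h r u v + armB h r u v))%N.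

Definition coinvr w w' : nat :=
  (\sum_u \sum_v ((armA h r u v && cyc (w' v) (w' u) (w u))
                + (armB h r u v && cyc (w v) (w' u) (w u))))%N.

Definition cellw (K : fieldType) (q t : K) w w' u : K :=
  if w' u == w u then 1 else
  (1 - t) / (1 - q ^+ (h u - r) * t ^+ (armn u).+1)
  * q ^+ ((w u < w' u) * (h u - r)).

Definition Kr (K : fieldType) (q t : K) w w' : K :=
  (compat w w')%:R * (\prod_(u | (r < h u)%N) cellw q t w w' u) * t ^+ coinvr w w'.

Definition pos w (a : 'I_n.+1) : option 'I_n := [pick u | w u == a].

Lemma rowok_abs k w u : rowok k w -> (w u == ord_max) = (h u < k)%N.
Proof. by case/andP => /forallP /(_ u) /eqP. Qed.

Lemma rowok_inj k w u v : rowok k w -> w u = w v -> w u != ord_max -> u = v.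
Proof.
move=> wk e; rewrite (rowok_abs _ wk); case/andP: wk => _ /forallP /(_ u) /forallP /(_ v).
rewrite e eqxx andbT; case: eqVneq => //= _ ->; by [].
Qed.

Lemma posE k w a u : rowok k w -> a != ord_max -> (w u == a) = (pos w a == Some u).
Proof.
move=> wk a0; rewrite /pos; case: pickP => [v /eqP wv|/(_ u) //].
apply/eqP/eqP => [wu|[<-] //]; congr Some.
by apply: (rowok_inj wk); rewrite wv.
Qed.

Lemma pos_act k w a u : rowok k w -> a != ord_max -> pos w a = Some u -> (k <= h u)%N.
Proof.
move=> wk a0 /eqP; rewrite -(posE _ wk) // => /eqP wu.
by rewrite leqNgt -(rowok_abs _ wk) wu.
Qed.

End Rows.

Lemma sum_orel n (R : 'I_n -> 'I_n -> bool) (o1 o2 : option 'I_n) :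
  (\sum_u \sum_v (R u v && ((o1 == Some u) && (o2 == Some v))))%N = orel R o1 o2.
Proof.
case: o1 => [a|] /=; last by rewrite big1 // => u _; rewrite big1 // => v _; rewrite andbF.
rewrite (bigD1 a) //= [X in (_ + X)%N]big1 => [|u ua]; last first.
  rewrite big1 // => v _; case: eqP => [[e]|]; last by rewrite andbF.
  by rewrite e eqxx in ua.
rewrite addn0 eqxx /=; case: o2 => [b|] /=; last by rewrite big1 // => v _; rewrite andbF.
rewrite (bigD1 b) //= [X in (_ + X)%N]big1 => [|u ub]; last first.
  case: eqP => [[e]|]; last by rewrite andbF.
  by rewrite e eqxx in ub.
by rewrite eqxx andbT addn0.
Qed.

Lemma prod_oeq n (K : fieldType) (P : pred 'I_n) (o1 o2 : option 'I_n) (c : 'I_n -> K) :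
  (forall u, o1 = Some u -> P u) ->
  \prod_(u | P u) (if (o1 == Some u) && (o2 == Some u) then c u else 1) = oeq o1 o2 c.
Proof.
case: o1 => [a|] P1 /=; last by rewrite big1.
rewrite (bigD1 a) ?P1 //= [X in _ * X]big1 => [|u /andP [_ ua]]; last first.
  case: eqP => // -[e]; by rewrite e eqxx in ua.
rewrite eqxx mulr1 /=; case: o2 => [b|//] /=.
by rewrite [Some b == _]eq_sym.
Qed.

Ltac gen_bools :=
  repeat match goal with |- context [nat_of_bool ?b] => move: (nat_of_bool b) => ? end.

(** * Separating the two labels from the weight of two rows *)

Section Factor.
Variables (n : nat) (K : fieldType) (q t : K) (h : 'I_n -> nat) (r : nat).
Variables (j j' : 'I_n).
Hypothesis jj' : j' = j.+1 :> nat.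
Implicit Types (w : rowt n) (u v : 'I_n).

(* Merges the labels [j] and [j'], so that what depends only on [mg] is invariant under their exchange. *)
Definition mg (a : nat) : nat := if a == j' :> nat then j : nat else a.

Definition swp w : rowt n := [ffun u => tperm (lbl j) (lbl j') (w u)].

Lemma swpK : involutive swp.
Proof. by move=> w; apply/ffunP => u; rewrite !ffunE tpermK. Qed.

Lemma lbl_max (i : 'I_n) : lbl i != ord_max.
Proof. by rewrite -val_eqE /= ltn_eqF. Qed.

Lemma lblE (i : 'I_n) : nat_of_ord (lbl i) = i. Proof. by []. Qed.

Lemma mg_tperm (a : 'I_n.+1) : mg (tperm (lbl j) (lbl j') a) = mg a.
Proof.
by rewrite /mg; case: tpermP => [->|->|] //=; rewrite ?eqxx ?if_same.
Qed.

Lemma swp_max w u : (swp w u == ord_max) = (w u == ord_max).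
Proof.
rewrite ffunE; apply/eqP/eqP => [|->]; last first.
  by rewrite tpermD // lbl_max.
by move/(canRL (tpermK _ _)) => ->; rewrite tpermD // lbl_max.
Qed.

Lemma rowok_swp k w : rowok h k (swp w) = rowok h k w.
Proof.
rewrite /rowok; congr (_ && _); apply: eq_forallb => u; first by rewrite swp_max.
apply: eq_forallb => v; congr (_ && _ ==> _).
by rewrite !ffunE (inj_eq perm_inj).
Qed.

Lemma pos_swp_l w : pos (swp w) (lbl j) = pos w (lbl j').
Proof.
rewrite /pos; apply: eq_pick => u /=.
by rewrite ffunE -(inj_eq (@perm_inj _ (tperm (lbl j) (lbl j')))) tpermK tpermL.
Qed.

Lemma pos_swp_r w : pos (swp w) (lbl j') = pos w (lbl j).
Proof.
rewrite /pos; apply: eq_pick => u /=.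
by rewrite ffunE -(inj_eq (@perm_inj _ (tperm (lbl j) (lbl j')))) tpermK tpermR.
Qed.

(** The part of the nonattacking condition that sees only merged labels; coincidences at the merged
    label are left to [loc]. *)
Definition compat_inv w w' : bool :=
  [forall u : 'I_n, forall v : 'I_n, (u < v)%N && (r < h v)%N ==>
     (mg (w' v) != mg (w u)) || (mg (w' v) == j)].

Definition base_inv w w' : nat :=
  (\sum_u \sum_v (armA h r u v *
      ((mg (w' v) < mg (w u)) + (mg (w u) < mg (w' u)) + (mg (w' u) < mg (w' v)))
    + armB h r u v *
      ((mg (w v) < mg (w u)) + (mg (w u) < mg (w' u)) + (mg (w' u) < mg (w v)))))%N.

Definition cell_inv w w' u : K :=
  if mg (w' u) == mg (w u) then 1 else
  (1 - t) / (1 - q ^+ (h u - r) * t ^+ (armn h r u).+1)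
  * q ^+ ((mg (w u) < mg (w' u)) * (h u - r)).

Definition Kinv w w' : K :=
  (compat_inv w w')%:R * (\prod_(u | (r < h u)%N) cell_inv w w' u) * t ^+ base_inv w w'.

Lemma Kinv_swp_l w w' : Kinv (swp w) w' = Kinv w w'.
Proof.
rewrite /Kinv; congr ((nat_of_bool _)%:R * _ * t ^+ _).
- by do 2![apply: eq_forallb => ?]; rewrite !ffunE mg_tperm.
- by apply: eq_bigr => u _; rewrite /cell_inv !ffunE mg_tperm.
- by do 2![apply: eq_bigr => ? _]; rewrite !ffunE !mg_tperm.
Qed.

Lemma Kinv_swp_r w w' : Kinv w (swp w') = Kinv w w'.
Proof.
rewrite /Kinv; congr ((nat_of_bool _)%:R * _ * t ^+ _).
- by do 2![apply: eq_forallb => ?]; rewrite !ffunE mg_tperm.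
- by apply: eq_bigr => u _; rewrite /cell_inv !ffunE mg_tperm.
- by do 2![apply: eq_bigr => ? _]; rewrite !ffunE !mg_tperm.
Qed.

Definition yy u : K := q ^+ (h u - r) * t ^+ (armn h r u).

Section Pair.
Variables w w' : rowt n.
Hypothesis (wok : rowok h r w) (wok' : rowok h r.+1 w').

Let m1 := pos w (lbl j).
Let m2 := pos w (lbl j').
Let n1 := pos w' (lbl j).
Let n2 := pos w' (lbl j').

Let m1E u : (w u == j :> nat) = (m1 == Some u).
Proof. by rewrite -(posE _ wok) ?lbl_max // -val_eqE. Qed.
Let m2E u : (w u == j' :> nat) = (m2 == Some u).
Proof. by rewrite -(posE _ wok) ?lbl_max // -val_eqE. Qed.
Let n1E u : (w' u == j :> nat) = (n1 == Some u).
Proof. by rewrite -(posE _ wok') ?lbl_max // -val_eqE. Qed.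
Let n2E u : (w' u == j' :> nat) = (n2 == Some u).
Proof. by rewrite -(posE _ wok') ?lbl_max // -val_eqE. Qed.

Lemma compatE : compat h r w w' = compat_inv w w' && ~~ (olt m1 n1 || olt m2 n2).
Proof.
apply/idP/andP => [/forallP H|[/forallP H1 H2]].
  split.
    apply/forallP => u; apply/forallP => v; apply/implyP => uv.
    move/forallP: (H u) => /(_ v); rewrite uv /= -val_eqE /mg /=.
    by case: ifP; case: ifP; lia.
  apply/norP; split; apply/negP.
    case e1: m1 => [u|//]; case e2: n1 => [v|//] /= uv.
    move/forallP: (H u) => /(_ v); rewrite uv (pos_act wok' (lbl_max _) e2) /=.
    rewrite -val_eqE /=; move/eqP: e1 e2; rewrite -m1E => /eqP -> /eqP.
    by rewrite -n1E => /eqP ->; rewrite eqxx.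
  case e1: m2 => [u|//]; case e2: n2 => [v|//] /= uv.
  move/forallP: (H u) => /(_ v); rewrite uv (pos_act wok' (lbl_max _) e2) /=.
  rewrite -val_eqE /=; move/eqP: e1 e2; rewrite -m2E => /eqP -> /eqP.
  by rewrite -n2E => /eqP ->; rewrite eqxx.
apply/forallP => u; apply/forallP => v; apply/implyP => uv.
move/forallP: (H1 u) => /(_ v); rewrite uv /=; case/andP: uv => uv hv.
apply: contraTneq => e; rewrite e eqxx /=; apply: contra H2 => /eqP.
rewrite /mg; case: ifP => [/eqP e1 _|_ e1].
  have := m2E u; have := n2E v; rewrite e e1 eqxx => /esym /eqP -> /esym /eqP ->.
  by rewrite /= uv orbT.
have := m1E u; have := n1E v; rewrite e e1 eqxx => /esym /eqP -> /esym /eqP ->.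
by rewrite /= uv.
Qed.

Lemma row_ne u v : u != v -> (r < h u)%N -> w' u != w' v :> nat.
Proof.
move=> uv hu; apply: contraNneq uv => /val_inj e; apply/eqP.
by apply: (rowok_inj wok' e); rewrite (rowok_abs _ wok') -leqNgt.
Qed.

Lemma low_ne u v : u != v -> (r <= h u)%N -> w u != w v :> nat.
Proof.
move=> uv hu; apply: contraNneq uv => /val_inj e; apply/eqP.
by apply: (rowok_inj wok e); rewrite (rowok_abs _ wok) -leqNgt.
Qed.

(** Only a cell with [j] and [j'] one above the other has a weight that merging destroys: its merged
    factor is 1, and the true one is restored separately, with the power of [q] if [j'] is on top,
    which is a descent. *)
Lemma cellwE u : cellw h r q t w w' u = cell_inv w w' u
  * (if (n1 == Some u) && (m2 == Some u) then (1 - t) / (1 - t * yy u) else 1)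
  * (if (n2 == Some u) && (m1 == Some u)
     then (1 - t) / (1 - t * yy u) * q ^+ (h u - r) else 1).
Proof.
rewrite /cellw /cell_inv -m1E -m2E -n1E -n2E -[w' u == w u]val_eqE /= /mg /yy.
have -> : t * (q ^+ (h u - r) * t ^+ armn h r u) = q ^+ (h u - r) * t ^+ (armn h r u).+1.
  by rewrite exprS mulrCA.
move: (nat_of_ord (w u)) (nat_of_ord (w' u)) (_ / _) => c b F.
have [e1 e2 e3 e4] : [/\ (nat_of_ord j == j') = false, (nat_of_ord j' == j) = false,
  (j' < j)%N = false & (j < j')%N] by split; lia.
case: (boolP ((b == j) && (c == j'))) => [/andP [/eqP -> /eqP ->]|N1].
  by rewrite !eqxx ?e1 ?e2 ?e3 /= ?eqxx mul0n expr0 !mulr1 mul1r.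
case: (boolP ((b == j') && (c == j))) => [/andP [/eqP -> /eqP ->]|N2].
  by rewrite !eqxx ?e1 ?e2 ?e4 /= ?eqxx mul1n /= !mul1r.
rewrite !mulr1; have -> : (if b == j' then j : nat else b) == (if c == j' then j : nat else c) = (b == c).
  by move: N1 N2; case: ifP; case: ifP; lia.
have -> // : ((if c == j' then j : nat else c) < (if b == j' then j : nat else b))%N = (c < b)%N.
by move: N1 N2; case: ifP; case: ifP; lia.
Qed.

Hypothesis cww' : compat h r w w'.

Lemma cross_ne u v : (u < v)%N -> (r < h v)%N -> w' v != w u :> nat.
Proof. by move=> uv hv; move/forallP: cww' => /(_ u) /forallP /(_ v); rewrite uv hv. Qed.

(** Of the three comparisons around the cycle one or two hold, and two exactly for a coinversion.
    Merging loses only comparisons of [j] with [j'], which the last three terms put back. *)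
Lemma cycE (a b c : nat) : a != b -> a != c ->
  (cyc a b c).+1 = ((mg a < mg c) + (mg c < mg b) + (mg b < mg a)
   + ((a == j) && (c == j')) + ((c == j) && (b == j')) + ((b == j) && (a == j')))%N.
Proof. by rewrite /cyc /mg; case: ifP; case: ifP; case: ifP; lia. Qed.

(** Summing [cycE] over all triples, the added ones total the arms. If [j'] stands directly above
    [j] in column [u], every triple of that column gains a comparison, whence the last sum. *)
Lemma coinvE : (coinvr h r w w' + \sum_u armn h r u
  = base_inv w w' + (orel (armA h r) m2 n1 + orel (armA h r) n1 n2
     + orel (armB h r) m2 m1 + orel (armB h r) n1 m2
     + \sum_u (m1 == Some u) * (n2 == Some u) * armn h r u))%N.
Proof.
rewrite -!sum_orel /coinvr /base_inv -!big_split /=; apply: eq_bigr => u _.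
rewrite /armn big_distrr -!big_split /=; apply: eq_bigr => v _.
rewrite -!m1E -!m2E -!n1E -!n2E.
case: (boolP (armA h r u v)) => [/and3P [uv hvu rv]|_].
  have -> : armB h r u v = false by rewrite /armB ltnNge (ltnW uv).
  have uv' : v != u by rewrite neq_ltn uv orbT.
  have := cycE (row_ne uv' rv) (cross_ne uv rv).
  rewrite /= mulnb [(w u == _ :> nat) && (w' v == _ :> nat)]andbC; gen_bools; lia.
case: (boolP (armB h r u v)) => [uvB|_]; last by rewrite /= !mul0n !muln0.
case/and3P: (uvB) => uv hvu rv; have uv' : v != u by rewrite neq_ltn uv.
have ru := leq_ltn_trans rv hvu.
have ne : w v != w' u :> nat by rewrite eq_sym cross_ne.
have := cycE ne (low_ne uv' rv).
rewrite /= mulnb [(w u == _ :> nat) && (w v == _ :> nat)]andbC; gen_bools; lia.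
Qed.

Lemma sum_mulSome (o1 o2 : option 'I_n) (F : 'I_n -> nat) :
  t ^+ (\sum_u (o1 == Some u) * (o2 == Some u) * F u) = oeq o1 o2 (fun u => t ^+ F u).
Proof.
case: o1 => [a|] /=; last by rewrite big1 ?expr0.
rewrite (bigD1 a) //= big1 => [|u ua]; last by rewrite (inj_eq (@Some_inj _)) eq_sym (negbTE ua).
rewrite eqxx mul1n addn0; case: o2 => [b|]; last by rewrite mul0n expr0.
rewrite (inj_eq (@Some_inj _)) [b == a]eq_sym -val_eqE.
by case: (_ == _); rewrite ?mul1n ?mul0n ?expr0.
Qed.

End Pair.

(** [Kinv] is invariant under the exchange of labels in either row, so [loc] carries all dependence
    on their order. The power [t ^+ armn h r u] from the comparison count merges with
    [q ^+ (h u - r)] into the factor [y u] of [loc]. *)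
Lemma KrE w w' : rowok h r w -> rowok h r.+1 w' ->
  Kr h r q t w w' * t ^+ (\sum_u armn h r u)
  = Kinv w w' * loc t h r yy (pos w (lbl j)) (pos w (lbl j')) (pos w' (lbl j)) (pos w' (lbl j')).
Proof.
move=> wok wok'; rewrite /Kr /Kinv compatE // /loc.
case: (boolP (olt _ _ || olt _ _)) => C; first by rewrite andbF !mul0r !mulr0.
rewrite andbT mul1r; case: (boolP (compat_inv w w')) => CI; last by rewrite !mul0r.
rewrite !mul1r -mulrA -exprD coinvE ?compatE ?CI //.
rewrite (eq_bigr _ (fun u _ => cellwE wok wok' u)).
rewrite !big_split /= !exprD sum_mulSome.
rewrite !prod_oeq => [||]; last 2 first.
- by move=> u /(pos_act wok' (lbl_max _)).
- by move=> u /(pos_act wok' (lbl_max _)).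
have -> : oeq (pos w' (lbl j')) (pos w (lbl j)) (fun u => (1 - t) / (1 - t * yy u) * yy u)
  = oeq (pos w' (lbl j')) (pos w (lbl j)) (fun u => (1 - t) / (1 - t * yy u) * q ^+ (h u - r))
  * oeq (pos w (lbl j)) (pos w' (lbl j')) (fun u => t ^+ armn h r u).
  rewrite /oeq; case: (pos w' _) => [a|]; case: (pos w _) => [b|]; rewrite ?mulr1 //.
  rewrite [b == a :> nat]eq_sym; case: eqP => [/val_inj ->|]; rewrite ?mulr1 //.
  by rewrite {2}/yy mulrA.
ring.
Qed.

End Factor.

Definition Xl n (K : fieldType) (a : 'I_n.+1) : {mpoly K[n]} :=
  oapp (fun i : 'I_n => 'X_i) 1 (insub (a : nat)).

Definition xw n (K : fieldType) (w : rowt n) : {mpoly K[n]} := \prod_u Xl K (w u).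

Lemma Xl_lbl n (K : fieldType) (i : 'I_n) : Xl K (lbl i) = 'X_i.
Proof. by rewrite /Xl lblE valK. Qed.

Lemma Xl_max n (K : fieldType) : Xl K (@ord_max n) = 1.
Proof. by rewrite /Xl insubF //= ltnn. Qed.

Lemma lblP n (a : 'I_n.+1) : a != ord_max -> exists i : 'I_n, a = lbl i.
Proof.
move=> am; have an : (a < n)%N.
  by rewrite ltn_neqAle -[(_ <= _)%N]ltnS ltn_ord andbT.
by exists (Ordinal an); apply: val_inj.
Qed.

Fixpoint Zrow n (h : 'I_n -> nat) (K : fieldType) (q t : K) (k r : nat) (w : rowt n)
    : {mpoly K[n]} :=
  if k is k'.+1 then
    \sum_(w' : rowt n | rowok h r.+1 w')
       Kr h r q t w w' *: (xw K w' * Zrow h q t k' r.+1 w')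
  else 1.

(** * The Hecke action on the labels of a row *)

Section HeckeRows.
Variables (n : nat) (K : fieldType) (q t : K) (h : 'I_n -> nat).
Variables (j j' : 'I_n).
Hypothesis jj' : j' = j.+1 :> nat.
Hypothesis t0 : t != 0.
Hypothesis two0 : (2%:R : K) != 0.
Hypothesis den0 : forall a b : nat, 1 - q ^+ a.+1 * t ^+ b.+1 != 0.
Implicit Types (w : rowt n) (u v : 'I_n) (F G : {mpoly K[n]}).

Local Notation TR := (Trel t j j').
Opaque Trel.
Local Notation sw := (swp j j').

Let neq_jj' : j != j'.
Proof. by rewrite -val_eqE /= jj' neq_ltn leqnn. Qed.

(* [F] and [G] belong to two rows that differ by the exchange of the labels [j] and [j'], which the first
   of them has in the columns [o1] and [o2]. *)
Definition hrel (o1 o2 : option 'I_n) F G : Prop :=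
  match o1, o2 with
  | None, None => F = G /\ TR F (t *: F)
  | Some _, None => TR F G
  | None, Some _ => TR G F
  | Some b, Some a =>
      if (a < b)%N then TR F (t ^+ (h b <= h a)%N *: G)
      else TR G (t ^+ (h a <= h b)%N *: F)
  end.

Definition odiff (o1 o2 : option 'I_n) : bool :=
  if o1 is Some a then o2 != Some a else true.

Lemma hrel_sym o1 o2 F G : odiff o1 o2 -> hrel o1 o2 F G -> hrel o2 o1 G F.
Proof.
case: o1 o2 => [b|] [a|] /= ab.
- have {ab} : (a != b :> nat) by apply: contraNneq ab => /val_inj ->.
  by case: (ltngtP (nat_of_ord a) (nat_of_ord b)) => [_ _|_ _|_ ne]; [exact: id|exact: id|discriminate ne].
- exact: id.
- exact: id.
- by case=> e H; rewrite -e; split; [reflexivity | exact: H].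
Qed.

Lemma hrel_sum (I : Type) (s : seq I) (P : pred I) o1 o2 (F G : I -> {mpoly K[n]}) :
  (forall i, P i -> hrel o1 o2 (F i) (G i)) ->
  hrel o1 o2 (\sum_(i <- s | P i) F i) (\sum_(i <- s | P i) G i).
Proof.
case: o1 o2 => [b|] [a|] /= H; last first.
- split; first by apply: eq_bigr => i /H [].
  by rewrite scaler_sumr; apply: Trel_sum => i /H [].
- exact: Trel_sum.
- exact: Trel_sum.
- case: (a < b)%N H => H; rewrite scaler_sumr; exact: Trel_sum.
Qed.

Lemma hrelZ c o1 o2 F G : hrel o1 o2 F G -> hrel o1 o2 (c *: F) (c *: G).
Proof.
case: o1 o2 => [b|] [a|] /=.
- case: (a < b)%N => H; rewrite scalerA mulrC -scalerA; apply: (TrelZ _ H).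
- exact: TrelZ.
- exact: TrelZ.
- case=> -> H; rewrite scalerA mulrC -scalerA; split; [reflexivity|exact: TrelZ].
Qed.

Lemma hrelM f o1 o2 F G : msym (tperm j j') f = f ->
  hrel o1 o2 F G -> hrel o1 o2 (f * F) (f * G).
Proof.
move=> sf; case: o1 o2 => [b|] [a|] /=.
- case: (a < b)%N => H; rewrite scalerAr; apply: (Trel_msym sf H).
- exact: Trel_msym.
- exact: Trel_msym.
- case=> -> H; rewrite scalerAr; split; [reflexivity|exact: Trel_msym].
Qed.

(** The quadratic relation gives the image of [G] from that of [F], so [T] acts on combinations of
    the two by a 2 by 2 matrix. *)
Lemma Trel_vec (e : bool) c1 c2 d1 d2 F G : TR F (t ^+ e *: G) ->
  d1 = t ^+ (~~ e) * c2 -> d2 = t ^+ e * c1 + (t - 1) * c2 ->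
  TR (c1 *: F + c2 *: G) (d1 *: F + d2 *: G).
Proof.
move=> FG -> ->.
have te : t ^+ e != 0 by rewrite expf_neq0.
have GF : TR G ((t - 1) *: G + t ^+ (~~ e) *: F).
  have := TrelZ (t ^+ e)^-1 (Trel_quad neq_jj' FG).
  rewrite (scalerK te) scalerDr !scalerA mulrCA (mulVf te) mulr1.
  suff -> : (t ^+ e)^-1 * t = t ^+ (~~ e) by [].
  by case: e te {FG} => /= te; rewrite ?expr0 ?expr1 ?invr1 ?mul1r ?mulVf.
have := TrelD (TrelZ c1 FG) (TrelZ c2 GF).
rewrite !scalerDr !scalerA !scalerDl; congr (TR _ _).
rewrite ![c2 * _]mulrC ![c1 * _]mulrC addrA addrC; by rewrite addrA.
Qed.

Lemma TrelZt c d F : TR F (t *: F) -> d = t * c -> TR (c *: F) (d *: F).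
Proof. by move=> FF ->; rewrite mulrC -scalerA; apply: (TrelZ _ FF). Qed.

Definition mx (o1 o2 : option 'I_n) : {mpoly K[n]} :=
  (if o1 then 'X_j else 1) * (if o2 then 'X_j' else 1).

Lemma mx_sym : msym (tperm j j') ('X_j * 'X_j' : {mpoly K[n]}) = 'X_j * 'X_j'.
Proof. by rewrite msymM msym_tperm_l msym_tperm_r mulrC. Qed.

Section Step.
Variable r : nat.
Local Notation lc := (loc t h r (yy q t h r)).

Let y1 u : (r < h u)%N -> 1 - t * yy q t h r u != 0.
Proof.
rewrite -subn_gt0 /yy mulrCA -exprS; case: (h u - r)%N => // a _; exact: den0.
Qed.

Definition lowok (o : option 'I_n) := if o is Some a then (r <= h a)%N else true.
Definition upok (o : option 'I_n) := if o is Some a then (r < h a)%N else true.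

Definition stepG m1 m2 n1 n2 F G :=
  mx m1 m2 * (lc m1 m2 n1 n2 *: F + lc m1 m2 n2 n1 *: G).

(** The orientation in which [hrel] describes the image of [F] rather than that of [G]; the other
    one follows by [hrel_sym]. *)
Definition canon (o1 o2 : option 'I_n) :=
  match o1, o2 with Some b, Some a => (a < b)%N | None, Some _ => false | _, _ => true end.

Lemma odiff_canon o1 o2 : odiff o1 o2 -> canon o1 o2 || canon o2 o1.
Proof.
case: o1 o2 => [a|] [b|] //= ab.
have {ab} : (b != a :> nat) by apply: contraNneq ab => /val_inj ->.
by case: ltngtP.
Qed.

(** One case per identity of [loc]. If the lower row has only one of the labels, the exchange also
    replaces [x_j] by [x_(j+1)], which [TrelX] absorbs; otherwise the monomial is symmetric. *)
Lemma step_canon m1 m2 n1 n2 F G :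
  lowok m1 -> lowok m2 -> upok n1 -> upok n2 -> canon m1 m2 -> canon n1 n2 ->
  hrel n1 n2 F G ->
  hrel m1 m2 (stepG m1 m2 n1 n2 F G) (stepG m2 m1 n1 n2 F G).
Proof.
rewrite /stepG; case: m1 m2 => [m1|] [m2|] l1 l2; case: n1 n2 => [n1|] [n2|] u1 u2 cm cn;
  try discriminate cm; try discriminate cn; rewrite /hrel; rewrite /= in l1 l2 u1 u2 cm cn;
  rewrite ?cm ?cn => FG.
- have [e1 e2] := loc_D_D t0 y1 l2 l1 cm u2 u1 cn.
  rewrite scalerAr scalerDr !scalerA -{1}e1 -{1}e2; apply: Trel_msym; first exact: mx_sym.
  exact: Trel_vec FG _ _.
- have [e1 e2] := loc_D_S t0 y1 l2 l1 cm u1.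
  rewrite scalerAr scalerDr !scalerA; apply: Trel_msym; first exact: mx_sym.
  apply: (@Trel_vec false); rewrite ?expr0 ?expr1 ?scale1r ?mul1r //.
- have [<- ES] := FG; have e1 := loc_D_N (yy q t h r) t0 cm l2 l1.
  rewrite scalerAr scalerDr !scalerA; apply: Trel_msym; first exact: mx_sym.
  rewrite -e1 -!scalerDl; apply: (TrelZt ES); ring.
- have [e1 e2] := loc_S_D t0 y1 l1 cn u2 u1.
  rewrite /mx mulr1 mul1r; apply: TrelX.
  rewrite scalerDr !scalerA addrACA -!scalerDl; apply: Trel_vec FG _ _.
    by rewrite e1.
  by rewrite e2 addrC.
- have [e1 e2] := loc_S_S y1 l1 u1.
  rewrite /mx mulr1 mul1r; apply: TrelX.
  rewrite scalerDr !scalerA addrACA -!scalerDl.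
  apply: (@Trel_vec false); rewrite ?expr0 ?expr1 ?scale1r ?mul1r //.
  by rewrite e2 addrC.
- have [<- ES] := FG; have e1 := loc_S_N t (yy q t h r) l1.
  rewrite /mx mulr1 mul1r; apply: TrelX; rewrite e1 -!scalerDl.
  rewrite scalerA -scalerDl; apply: (TrelZt ES); ring.
- have e1 := loc_N_D (yy q t h r) t0 cn u2 u1.
  split; [reflexivity|]; rewrite /mx !mul1r scalerDr !scalerA.
  apply: Trel_vec FG _ _; rewrite e1.
    by case: leqP => _; rewrite /= ?expr0 ?expr1 ?mul1r.
  rewrite mulrBl mul1r; ring.
- have e1 := loc_N_S t (yy q t h r) u1.
  split; [reflexivity|]; rewrite /mx !mul1r scalerDr !scalerA e1.
  apply: (@Trel_vec false); rewrite ?expr0 ?expr1 ?scale1r ?mul1r //; ring.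
- have [<- ES] := FG; split; [reflexivity|]; rewrite /mx !mul1r -!scalerDl scalerA.
  by apply: (TrelZt ES).
Qed.

Lemma hrel_step m1 m2 n1 n2 F G :
  lowok m1 -> lowok m2 -> upok n1 -> upok n2 -> odiff m1 m2 -> odiff n1 n2 ->
  hrel n1 n2 F G ->
  hrel m1 m2 (stepG m1 m2 n1 n2 F G) (stepG m2 m1 n1 n2 F G).
Proof.
have odC o1 o2 : odiff o1 o2 -> odiff o2 o1.
  by case: o1 o2 => [a|] [b|] //=; apply: contraNneq => -[->].
have H a1 a2 b1 b2 A B : lowok a1 -> lowok a2 -> upok b1 -> upok b2 ->
    canon a1 a2 -> odiff b1 b2 -> hrel b1 b2 A B ->
    hrel a1 a2 (stepG a1 a2 b1 b2 A B) (stepG a2 a1 b1 b2 A B).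
  move=> l1 l2 u1 u2 ca db AB; case/orP: (odiff_canon db) => cb.
    exact: step_canon.
  have := step_canon l1 l2 u2 u1 ca cb (hrel_sym db AB).
  by rewrite /stepG [X in mx a1 a2 * X]addrC [X in mx a2 a1 * X]addrC.
move=> l1 l2 u1 u2 dm dn FG; case/orP: (odiff_canon dm) => cm; first exact: H.
by apply: hrel_sym; [exact: odC | exact: H].
Qed.

End Step.

Definition xo w : {mpoly K[n]} :=
  \prod_u (if (w u == lbl j) || (w u == lbl j') then 1 else Xl K (w u)).

Lemma xo_msym w : msym (tperm j j') (xo w) = xo w.
Proof.
rewrite /xo rmorph_prod /=; apply: eq_bigr => u _; case: ifP => [_|]; first by rewrite msym1.
move/negbT/norP => [n1 n2]; case: (eqVneq (w u) ord_max) => [->|/lblP [i ei]].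
  by rewrite Xl_max msym1.
move: n1 n2; rewrite ei Xl_lbl /= msymXU => n1 n2; congr 'X_ _.
rewrite tpermD // eq_sym; first by apply: contraNneq n1 => ->.
by apply: contraNneq n2 => ->.
Qed.

Lemma xo_swp w : xo (sw w) = xo w.
Proof.
apply: eq_bigr => u _; rewrite ffunE.
by case: tpermP => [->|->|/eqP /negbTE -> /eqP /negbTE ->] //; rewrite !eqxx ?orbT.
Qed.

Lemma prod_pos k w a : rowok h k w -> a != ord_max ->
  \prod_u (if w u == a then Xl K a else 1) = (if pos w a then Xl K a else 1).
Proof.
move=> wok am; under eq_bigr do rewrite (posE _ wok am).
case: (pos w a) => [v|]; last by rewrite big1.
rewrite (bigD1 v) //= eqxx big1 ?mulr1 // => u uv.
by case: eqP => // -[e]; rewrite e eqxx in uv.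
Qed.

Lemma xwE k w : rowok h k w -> xw K w = xo w * mx (pos w (lbl j)) (pos w (lbl j')).
Proof.
move=> wok; rewrite /mx -!Xl_lbl -!(prod_pos wok) ?lbl_max // -!big_split /=.
apply: eq_bigr => u _.
case: (eqVneq (w u) (lbl j)) => [->|_] /=.
  have -> : (lbl j == lbl j') = false by rewrite -val_eqE /= jj' -[RHS](ltnn j); lia.
  by rewrite mul1r mulr1.
by case: eqVneq => [->|_]; rewrite ?mul1r ?mulr1.
Qed.

Lemma odiff_pos k w : rowok h k w -> odiff (pos w (lbl j)) (pos w (lbl j')).
Proof.
move=> wok; case e: pos => [a|] //=; apply/eqP => e'.
move/eqP: e; rewrite -(posE _ wok (lbl_max _)) => /eqP wa.
move/eqP: e'; rewrite -(posE _ wok (lbl_max _)) wa => /eqP /(congr1 val) /=.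
by rewrite jj' => /eqP; rewrite -[_ == _]negbK neq_ltn ltnSn.
Qed.

Lemma pos_ok k w a (P : pred nat) : rowok h k w -> a != ord_max ->
  (forall m, (k <= m)%N -> P m) -> if pos w a is Some u then P (h u) else true.
Proof. by move=> wok am H; case e: (pos w a) => [u|//]; apply/H/(pos_act wok am e). Qed.

Definition frow k r w : {mpoly K[n]} := xw K w * Zrow h q t k r w.

(** With the monomial of the row itself included, the case of a single label has the plain form
    [h = T g]; for [Zrow] alone, [TrelX] would bring in a term [(t - 1) g]. *)
Theorem hrel_frow k r w : rowok h r w -> (forall u, h u <= r + k)%N ->
  hrel (pos w (lbl j)) (pos w (lbl j')) (frow k r w) (frow k r (sw w)).
Proof.
elim: k r w => [|k IH] r w wok hr.
  have swok : rowok h r (sw w) by rewrite rowok_swp.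
  rewrite /frow /= !mulr1 (xwE wok) (xwE swok) xo_swp pos_swp_l pos_swp_r.
  apply: hrelM; first exact: xo_msym.
  have T1 : TR 1 ((t - 1) *: 1 + 1).
    by rewrite -{3}[1]scale1r -scalerDl subrK; apply: Trel_sym; rewrite msym1.
  case e1: (pos w (lbl j)) => [b|]; case e2: (pos w (lbl j')) => [a|] /=;
    rewrite /mx ?mulr1 ?mul1r.
  (* No rows remain above, so a column reaching row [r] has height [r], and the exponent of [t] is 1
     in either order. *)
  - have hE u l : pos w (lbl l) = Some u -> h u = r.
      move=> /(pos_act wok (lbl_max _)) ru; apply/eqP; rewrite eqn_leq ru andbT.
      by have := hr u; rewrite addn0.
    rewrite (hE _ _ e1) (hE _ _ e2) leqnn if_same; apply: Trel_sym; exact: mx_sym.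
  - by rewrite -['X_j]mulr1 -['X_j']mulr1; exact: TrelX.
  - by rewrite -['X_j]mulr1 -['X_j']mulr1; exact: TrelX.
  - by split=> //; apply: Trel_sym; rewrite msym1.
set N := (\sum_u armn h r u)%N.
have cN : 2%:R * t ^+ N != 0 by rewrite mulf_neq0 // expf_neq0.
(* Pairing each upper row with its exchange counts it twice; this and the normalization of the
   coinversions give the invertible factor [2 t ^ N]. *)
have key (v : rowt n) : rowok h r v -> (2%:R * t ^+ N) *: frow k.+1 r v =
    \sum_(w' | rowok h r.+1 w') Kinv q t h r j j' v w' *: (xo v *
       stepG r (pos v (lbl j)) (pos v (lbl j')) (pos w' (lbl j)) (pos w' (lbl j'))
             (frow k r.+1 w') (frow k r.+1 (sw w'))).
  move=> vok; rewrite /frow /= -/frow (xwE vok).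
  pose T w' := (Kr h r q t v w' * t ^+ N) *: frow k r.+1 w'.
  have e1 : t ^+ N *: (\sum_(w' | rowok h r.+1 w')
        Kr h r q t v w' *: (xw K w' * Zrow h q t k r.+1 w')) =
      \sum_(w' | rowok h r.+1 w') T w'.
    by rewrite scaler_sumr; apply: eq_bigr => w' _; rewrite scalerA mulrC.
  have e2 : \sum_(w' | rowok h r.+1 w') T w' = \sum_(w' | rowok h r.+1 w') T (sw w').
    rewrite (reindex_inj (inv_inj (swpK j j'))) /=.
    by apply: eq_bigl => w'; rewrite rowok_swp.
  rewrite -scalerA scalerAr e1 scaler_nat mulr2n -mulrDr {2}e2 -big_split mulr_sumr /=.
  apply: eq_bigr => w' w'ok; rewrite /stepG /T.
  have sw'ok : rowok h r.+1 (sw w') by rewrite rowok_swp.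
  rewrite (KrE q t jj' vok w'ok) (KrE q t jj' vok sw'ok) Kinv_swp_r pos_swp_l pos_swp_r.
  move: (Kinv q t h r j j' v w') (loc t h r _ _ _ _ _) => A B.
  move: (loc t h r _ _ _ _ _) => C.
  by rewrite -!scalerA -scalerDr -scalerAr -mulrA.
suff H : hrel (pos w (lbl j)) (pos w (lbl j')) ((2%:R * t ^+ N) *: frow k.+1 r w)
    ((2%:R * t ^+ N) *: frow k.+1 r (sw w)).
  by have := hrelZ (2%:R * t ^+ N)^-1 H; rewrite !scalerK.
rewrite !key ?rowok_swp // pos_swp_l pos_swp_r; apply: hrel_sum => w' w'ok.
rewrite Kinv_swp_l // xo_swp; apply/hrelZ/hrelM; first exact: xo_msym.
apply: hrel_step.
- exact: (pos_ok wok (lbl_max _)).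
- exact: (pos_ok wok (lbl_max _)).
- exact: (pos_ok (P := fun m => r < m)%N w'ok (lbl_max _)).
- exact: (pos_ok (P := fun m => r < m)%N w'ok (lbl_max _)).
- exact: odiff_pos wok.
- exact: odiff_pos w'ok.
- by apply: IH => // u; rewrite addSnnS.
Qed.

End HeckeRows.

(** * Fillings as tables of rows *)

Lemma insub_ord m i (im : (i < m)%N) : insub i = Some (Ordinal im) :> option 'I_m.
Proof. exact: (insubT (fun i => i < m)%N). Qed.

Definition rowat n D (w : rowt n) (F : {ffun 'I_D -> rowt n}) (i : nat) : rowt n :=
  if i is i'.+1 then oapp F w (insub i') else w.

Lemma rowatS n D (w : rowt n) (F : {ffun 'I_D -> rowt n}) (i : 'I_D) :
  rowat w F i.+1 = F i.
Proof. by rewrite /rowat valK. Qed.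

Section Tables.
Variables (n : nat) (h : 'I_n -> nat) (K : fieldType) (q t : K).

Definition tabpoly k r (w : rowt n) (F : {ffun 'I_k -> rowt n}) : {mpoly K[n]} :=
  \prod_(i < k) (Kr h (r + i) q t (rowat w F i) (F i) *: xw K (F i)).

Definition tabok k r (F : {ffun 'I_k -> rowt n}) : bool :=
  [forall i : 'I_k, rowok h (r + i).+1 (F i)].

Definition tcons k (p : rowt n * {ffun 'I_k -> rowt n}) : {ffun 'I_k.+1 -> rowt n} :=
  [ffun i => if unlift ord0 i is Some i' then p.2 i' else p.1].

Definition tuncons k (F : {ffun 'I_k.+1 -> rowt n}) : rowt n * {ffun 'I_k -> rowt n} :=
  (F ord0, [ffun i => F (lift ord0 i)]).

Lemma tconsK k : cancel (@tcons k) (@tuncons k).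
Proof.
case=> w F; rewrite /tuncons /tcons /=; congr pair; first by rewrite ffunE unlift_none.
by apply/ffunP => i; rewrite !ffunE liftK.
Qed.

Lemma tunconsK k : cancel (@tuncons k) (@tcons k).
Proof.
move=> F; apply/ffunP => i; rewrite !ffunE.
by case: unliftP => [i' ->|->] //=; rewrite ffunE.
Qed.

Lemma rowat_cons k w w' (F : {ffun 'I_k -> rowt n}) i : (i <= k)%N ->
  rowat w (tcons (w', F)) i.+1 = rowat w' F i.
Proof.
case: i => [|i] Hi; rewrite /rowat.
  by rewrite insubT //= ffunE; case: unliftP => // i' /(congr1 val).
rewrite (insub_ord (Hi : i.+1 < k.+1)%N) (insub_ord Hi) /= ffunE.
case: unliftP => [i' /(congr1 val) /= e|/(congr1 val) //].
by congr (F _); apply: val_inj; move: e; rewrite /= /bump leq0n add1n => -[].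
Qed.

Lemma Zrow_tab k r w :
  Zrow h q t k r w = \sum_(F : {ffun 'I_k -> rowt n} | tabok r F) tabpoly r w F.
Proof.
elim: k r w => [|k IH] r w /=.
  rewrite (big_pred1 [ffun i : 'I_0 => w]) => [|F]; first by rewrite /tabpoly big_ord0.
  have -> : tabok r F by apply/forallP => -[].
  by apply/esym/eqP/ffunP => -[].
under eq_bigr do rewrite IH mulr_sumr scaler_sumr.
rewrite pair_big_dep /=.
have bij : bijective (@tcons k).
  by exists (@tuncons k); [exact: tconsK | exact: tunconsK].
rewrite [RHS](reindex (@tcons k)) /=; last exact: onW_bij.
apply: eq_big => [[w' F]|[w' F] _] /=.
  rewrite /tabok; apply/andP/forallP => [[w'ok /forallP Fok] i|H].
    rewrite ffunE; case: unliftP => [i' ->|->] /=; last by rewrite addn0.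
    by have := Fok i'; rewrite /bump leq0n add1n addnS addSn.
  split; first by have := H ord0; rewrite ffunE unlift_none addn0.
  apply/forallP => i; have := H (lift ord0 i); rewrite ffunE liftK /= /bump leq0n add1n.
  by rewrite addnS addSn.
rewrite /tabpoly big_ord_recl /= ffunE unlift_none addn0 -scalerAl; congr (_ *: (_ * _)).
apply: eq_bigr => i _; rewrite ffunE liftK -(rowat_cons w) ?(ltnW (ltn_ord i)) //=.
by rewrite /bump leq0n add1n addSnnS.
Qed.

End Tables.

Lemma acol_le (alpha : seq nat) i : (acol alpha i <= sumn alpha)%N.
Proof.
rewrite /acol; elim: alpha i => [|a l IH] [|i] //=; first exact: leq_addr.
exact: leq_trans (IH i) (leq_addl _ _).
Qed.

Definition brow n (beta : 'S_n) : rowt n := [ffun u => lbl (beta u)].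

Lemma rowok_brow n (h : 'I_n -> nat) (beta : 'S_n) : rowok h 0 (brow beta).
Proof.
apply/andP; split; first by apply/forallP => u; rewrite ffunE (negbTE (lbl_max _)).
apply/forallP => u; apply/forallP => v; apply/implyP => /andP [uv].
rewrite !ffunE => /eqP /(congr1 val) /= /val_inj /perm_inj e.
by rewrite e eqxx in uv.
Qed.

Section Link.
Variables (n : nat) (alpha : seq nat) (beta : 'S_n) (K : fieldType) (q t : K).

Let D := sumn alpha.
Let h (u : 'I_n) : nat := acol alpha u.
Let hD u : (h u <= D)%N := acol_le alpha u.
Implicit Types (s : filling n alpha) (F : {ffun 'I_D -> rowt n}) (u v : 'I_n).

Definition tabof s : {ffun 'I_(sumn alpha) -> rowt n} :=
  [ffun i => [ffun u : 'I_n =>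
     if (insub (u, lift ord0 i) : option (cellT n alpha)) is Some x
     then lbl (s x) else ord_max]].

Definition rowno (x : cellT n alpha) : option 'I_(sumn alpha) := unlift ord0 (val x).2.

(** The column index is a default entry; in a table with admissible rows every cell of the diagram
    has a genuine label. *)
Definition filof F : filling n alpha :=
  [ffun x => odflt (val x).1 (oapp (fun r => insub (F r (val x).1 : nat)) None (rowno x))].

Lemma rownoP (x : cellT n alpha) : exists2 r, (val x).2 = lift ord0 r & rowno x = Some r.
Proof.
rewrite /rowno; case: unliftP => [r e|e]; first by exists r.
by have := valP x; rewrite /cell_pred e.
Qed.

Lemma tabofE s (i : 'I_D) u :
  tabof s i u = if (insub (u, lift ord0 i) : option (cellT n alpha)) is Some x
     then lbl (s x) else ord_max.
Proof. by rewrite !ffunE. Qed.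

Lemma cell_predE u (i : 'I_D) : cell_pred (u, lift ord0 i) = (i < h u)%N.
Proof. by []. Qed.

Lemma tabof_max s (i : 'I_D) u : (tabof s i u == ord_max) = (h u < i.+1)%N.
Proof.
rewrite tabofE ltnNge; case: insubP => [x|]; rewrite cell_predE.
  by move=> -> _; rewrite (negbTE (lbl_max _)).
by rewrite eqxx => ->.
Qed.

Notation row s i := (rowat (brow beta) (tabof s) i).

Lemma entE s u r : (r <= h u)%N -> ent beta s (nat_of_ord u, r) = row s r u.
Proof.
move=> ru; rewrite /ent /= valK; case: r ru => [|r] ru /=; first by rewrite ffunE.
have rD : (r < D)%N := leq_trans ru (hD u).
have r1 : (r.+1 < D.+1)%N by [].
rewrite (insub_ord r1) (insub_ord rD) /= tabofE.
suff -> : (u, Ordinal r1) = (u, lift ord0 (Ordinal rD)) by case: insubP => [x _ _|] //; rewrite cell_predE ru.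
by congr pair; apply: val_inj.
Qed.

Lemma mem_dgcells u r : ((nat_of_ord u, r) \in dgcells n alpha) = (r <= h u)%N.
Proof.
apply/allpairsPdep/idP => [[i [k [_ kin e]]]|ru].
  by case: e kin => <- <-; rewrite mem_iota /= add0n ltnS.
by exists (nat_of_ord u), r; rewrite !mem_iota /= !add0n ltn_ord ltnS ru.
Qed.

Lemma dgcellsP c : c \in dgcells n alpha ->
  exists u r, c = (nat_of_ord u, r) /\ (r <= h u)%N.
Proof.
case/allpairsPdep => i [k []]; rewrite !mem_iota /= !add0n ltnS => il kl ->.
by exists (Ordinal il), k.
Qed.

Definition taball F : bool :=
  [forall i : 'I_D, rowok h i.+1 (F i) && compat h i (rowat (brow beta) F i) (F i)].

Lemma nonattackingE s : nonattacking beta s = taball (tabof s).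
Proof.
apply/idP/forallP => [/allP N i|H].
  have {}N u r v r' : (r <= h u)%N -> (r' <= h v)%N ->
      attack (nat_of_ord u, r) (nat_of_ord v, r') -> row s r u != row s r' v :> nat.
    move=> ru rv A; have := N (nat_of_ord u, r); rewrite mem_dgcells => /(_ ru) /allP.
    move=> /(_ (nat_of_ord v, r')); rewrite mem_dgcells => /(_ rv) /implyP /(_ A).
    by rewrite !entE.
  apply/andP; split.
    apply/andP; split; first by apply/forallP => u; rewrite tabof_max.
    apply/forallP => u; apply/forallP => v; apply/implyP => /andP [uv] /eqP e.
    rewrite -(tabof_max s); apply: contraT => nm.
    have nu : (i.+1 <= h u)%N by rewrite leqNgt -(tabof_max s).
    have nv : (i.+1 <= h v)%N by rewrite leqNgt -(tabof_max s) -e.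
    have := N u i.+1 v i.+1 nu nv; rewrite /attack eqxx val_eqE uv /= => /(_ isT).
    by rewrite valK /= e eqxx.
  apply/forallP => u; apply/forallP => v; apply/implyP => /andP [uv iv].
  have [iu|] := leqP i (h u).
    have := N v i.+1 u i iv iu; rewrite /attack eqxx uv /= orbT => /(_ isT).
    by rewrite valK.
  (* A column [u] ending below the lower row carries the absence mark there, which differs from the
     entry of any cell of the upper row. *)
  case: i iv => -[//|i] Hi /= iv iu; have iD : (i < D)%N by exact: ltnW.
  rewrite (insub_ord iD) /=.
  have := tabof_max s (Ordinal iD) u; rewrite iu => /eqP ->.
  by rewrite tabof_max /= -leqNgt.
have rok r : (r <= D)%N -> rowok h r (row s r).
  case: r => [|r] rD; first exact: rowok_brow.
  by have /andP [] := H (Ordinal rD); rewrite /= (insub_ord rD).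
have cok r : (r < D)%N -> compat h r (row s r) (row s r.+1).
  by move=> rD; have /andP [_] := H (Ordinal rD); rewrite /= (insub_ord rD).
have cne u v r : (r <= h u)%N -> (r < h v)%N -> (u < v)%N -> row s r.+1 v != row s r u :> nat.
  move=> ru rv uv; have rD : (r < D)%N := leq_trans rv (hD v).
  by move/forallP: (cok r rD) => /(_ u) /forallP /(_ v); rewrite uv rv.
apply/allP => c /dgcellsP [u [r [-> ru]]]; apply/allP => d /dgcellsP [v [r' [-> rv]]].
apply/implyP; rewrite !entE // => /or3P [/andP [/eqP e uv]|/andP [/eqP e uv]|/andP [/eqP e uv]].
- subst r'; rewrite val_eqE in uv; apply: contraNneq uv => /val_inj e.
  have rr := rok r (leq_trans ru (hD u)).
  by apply/eqP/(rowok_inj rr e); rewrite (rowok_abs _ rr) -leqNgt.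
- by subst r; rewrite cne.
- by subst r'; rewrite eq_sym cne.
Qed.

Lemma tabofK s : filof (tabof s) = s.
Proof.
apply/ffunP => x; rewrite ffunE; have [r e ->] := rownoP x; rewrite /= tabofE.
have -> : ((val x).1, lift ord0 r) = val x by rewrite -e; case: (val x).
by rewrite valK /= valK.
Qed.

Lemma filofK F : taball F -> tabof (filof F) = F.
Proof.
move/forallP => H; apply/ffunP => i; apply/ffunP => u; rewrite tabofE.
have /andP [rk _] := H i; case: insubP => [x Px ex|].
  rewrite cell_predE in Px; apply: val_inj; rewrite /= ffunE /rowno ex liftK /=.
  by rewrite insubT //=; have := rowok_abs u rk; rewrite ltnNge Px /= => /negbT /lblP [l ->] /=.
by rewrite cell_predE -leqNgt => Px; apply/esym/eqP; rewrite (rowok_abs _ rk).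
Qed.

Lemma big_cells (R : Type) (idx : R) (op : Monoid.com_law idx) (G : nat * nat -> R) :
  \big[op/idx]_(c <- cells n alpha) G c
  = \big[op/idx]_(r < D) \big[op/idx]_(u < n | (r < h u)%N) G (nat_of_ord u, r.+1).
Proof.
have -> : cells n alpha =
    [seq (i, r) | i <- index_iota 0 n, r <- index_iota 1 (acol alpha i).+1].
  by rewrite /cells /index_iota subn0; congr flatten; apply: eq_map => i; rewrite subn1.
rewrite big_allpairs_dep /= big_mkord.
rewrite (exchange_big_dep xpredT) //=; apply: eq_bigr => u _.
rewrite big_add1 /= big_mkord.
by rewrite (big_ord_widen D (fun r => G (nat_of_ord u, r.+1))) // acol_le.
Qed.

Lemma armE u r : arm n alpha (nat_of_ord u, r.+1) = armn h r u.
Proof.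
rewrite /arm /armn !big_mkord -big_split /=; apply: eq_bigr => v _.
by rewrite /armA /armB /h.
Qed.

Lemma coinv_tripleE s pa pb pc : pc.2 = pb.2.-1 -> (0 < pb.2)%N ->
  ent beta s pa != ent beta s pb -> ent beta s pa != ent beta s pc ->
  coinv_triple beta s pa pb pc = cyc (ent beta s pa) (ent beta s pb) (ent beta s pc).
Proof.
move=> e b0 ab ac.
have pac : pa == pc = false by apply: contraNF ac => /eqP ->.
have pcb : pb == pa = false by apply: contraNF ab => /eqP ->.
have r1 : readbefore pc pb = false.
  rewrite /readbefore e; case: pb.2 b0 => [//|m] _ /=.
  by rewrite ltnNge leqnSn /= eqn_leq ltnn andbF.
have r2 : readbefore pb pc by rewrite /readbefore e prednK ?leqnn.
have ba : ent beta s pb == ent beta s pa = false by rewrite eq_sym (negbTE ab).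
by rewrite /coinv_triple /lec /ltc pac pcb r1 (negbTE ac) ba /= ?andbF ?orbF /cyc.
Qed.

Lemma coinv_rows s : taball (tabof s) ->
  coinv beta s = (\sum_(r < D) coinvr h r (row s r) (row s r.+1))%N.
Proof.
move=> H; have /allP N : nonattacking beta s by rewrite nonattackingE.
have {}N u r v r' : (r <= h u)%N -> (r' <= h v)%N ->
      attack (nat_of_ord u, r) (nat_of_ord v, r') ->
      ent beta s (nat_of_ord u, r) != ent beta s (nat_of_ord v, r').
    move=> ru rv A; have := N (nat_of_ord u, r); rewrite mem_dgcells => /(_ ru) /allP.
    by move=> /(_ (nat_of_ord v, r')); rewrite mem_dgcells => /(_ rv) /implyP /(_ A).
rewrite /coinv /coinvr big_mkord [RHS]exchange_big; apply: eq_bigr => u _.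
rewrite big_mkord [RHS]exchange_big; apply: eq_bigr => v _.
rewrite big_add1 /= big_mkord.
rewrite (big_ord_widen D (fun r => (([&& (u < v)%N, (acol alpha v <= acol alpha u)%N,
   (r.+1 <= acol alpha v)%N &
           coinv_triple beta s (nat_of_ord v, r.+1) (nat_of_ord u, r.+1) (nat_of_ord u, r)] : nat)
    + ([&& (v < u)%N, (acol alpha v < acol alpha u)%N, (r <= acol alpha v)%N &
           coinv_triple beta s (nat_of_ord v, r) (nat_of_ord u, r.+1) (nat_of_ord u, r)] : nat))%N))
  ?acol_le //.
rewrite big_mkcond /=; apply: eq_bigr => r _.
rewrite -[acol alpha u]/(h u) -[acol alpha v]/(h v).
case: ltnP => ru; last first.
  have -> : armA h r u v = false.
    by apply/negP => /and3P [_ vu] /leq_trans /(_ (leq_trans vu ru)); rewrite ltnn.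
  have -> : armB h r u v = false.
    by apply/negP => /and3P [_ vu rv]; have := leq_trans vu (leq_trans ru rv); rewrite ltnn.
  by [].
congr (_ + _)%N; congr nat_of_bool; rewrite /armA /armB.
  rewrite -!andbA; case: (boolP (u < v)%N) => //= uv.
  case: (boolP (h v <= h u)%N) => //= hvu; case: (boolP (r < h v)%N) => //= rv.
  have A1 : attack (nat_of_ord v, r.+1) (nat_of_ord u, r.+1).
    by rewrite /attack eqxx neq_ltn uv orbT.
  have A2 : attack (nat_of_ord v, r.+1) (nat_of_ord u, nat_of_ord r).
    by rewrite /attack eqxx uv orbT.
  rewrite coinv_tripleE ?(N _ _ _ _ rv ru A1) ?(N _ _ _ _ rv (ltnW ru) A2) //.
  by rewrite (entE s rv) (entE s ru) (entE s (ltnW ru)).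
rewrite -!andbA; case: (boolP (v < u)%N) => //= uv.
case: (boolP (h v < h u)%N) => //= hvu; case: (boolP (r <= h v)%N) => //= rv.
have A1 : attack (nat_of_ord v, nat_of_ord r) (nat_of_ord u, r.+1).
  by rewrite /attack eqxx uv !orbT.
have A2 : attack (nat_of_ord v, nat_of_ord r) (nat_of_ord u, nat_of_ord r).
  by rewrite /attack eqxx neq_ltn uv.
rewrite coinv_tripleE ?(N _ _ _ _ rv ru A1) ?(N _ _ _ _ rv (ltnW ru) A2) //.
by rewrite (entE s rv) (entE s ru) (entE s (ltnW ru)).
Qed.

Lemma weight_rows s : taball (tabof s) ->
  q ^+ maj beta s * t ^+ coinv beta s * \prod_(c <- cells n alpha) cell_weight beta q t s c
  = \prod_(r < D) Kr h r q t (row s r) (row s r.+1).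
Proof.
move=> H; rewrite coinv_rows // (big_morph (fun x => t ^+ x) (exprD t) (expr0 t)).
rewrite mulrAC /maj (big_morph (fun x => q ^+ x) (exprD q) (expr0 q)) -big_split /=.
rewrite big_cells -big_split /=; apply: eq_bigr => r _.
have /andP [_ c] : rowok h r.+1 (row s r.+1) && compat h r (row s r) (row s r.+1).
  by move/forallP: H => /(_ r); rewrite [row s r.+1]rowatS.
rewrite /Kr c mul1r; congr (_ * _); apply: eq_bigr => u ru.
rewrite /cellw /cell_weight /south /leg !entE ?(ltnW ru) // armE.
rewrite -[acol alpha u]/(h u) /= subnSK //.
case: (eqVneq (row s r.+1 u) (row s r u)) => [->|ne]; first by rewrite eqxx ltnn mul0n mulr1.
by rewrite ifT ?ne // mulrC.
Qed.

Lemma monomial_rows s :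
  \prod_(x : cellT n alpha) 'X_(s x) = \prod_(r < D) xw K (tabof s r).
Proof.
transitivity (\prod_(p : 'I_n * 'I_D.+1) oapp (fun x : cellT n alpha => 'X_(s x)) (1 : {mpoly K[n]}) (insub p)).
  rewrite [RHS](bigID (@cell_pred n alpha)) /= [X in _ * X]big1 ?mulr1; last first.
    by move=> p np; rewrite insubN.
  rewrite [RHS](reindex_omap (val : cellT n alpha -> _) insub); last first.
    by move=> p pp; rewrite insubT.
  apply: eq_big => x /=; first by rewrite valK eqxx andbT (valP x).
  by rewrite valK.
transitivity (\prod_(u < n) \prod_(r < D.+1)
    oapp (fun x : cellT n alpha => 'X_(s x)) (1 : {mpoly K[n]}) (insub (u, r))).
  by rewrite pair_bigA; apply: eq_bigr => -[u r].
rewrite exchange_big /= big_ord_recl /= [X in X * _]big1 ?mul1r; last first.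
  by move=> u _; rewrite insubN.
apply: eq_bigr => r _; apply: eq_bigr => u _; rewrite tabofE.
by case: insub => [x|] /=; rewrite ?Xl_lbl ?Xl_max.
Qed.

(** A table violating [compat] has a vanishing factor [Kr], so only nonattacking fillings survive in
    the sum over all tables of admissible rows. *)
Theorem Emac_rows : Emac alpha beta q t = Zrow h q t D 0 (brow beta).
Proof.
rewrite Zrow_tab (bigID (fun F => taball F)) /= [X in _ + X]big1 ?addr0; last first.
  move=> F /andP [/forallP Fok /forallPn [i]]; rewrite -[X in rowok h X]add0n Fok /= => nc.
  by rewrite /tabpoly (bigD1 i) //= /Kr add0n (negbTE nc) !mul0r scale0r mul0r.
rewrite (eq_bigl (fun F => taball F)); last first.
  move=> F; rewrite andb_idl // => /forallP H; apply/forallP => i.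
  by have /andP [] := H i.
rewrite (reindex_onto tabof filof) /=; last exact: filofK.
rewrite /Emac; apply: eq_big => [s|s]; first by rewrite nonattackingE tabofK eqxx andbT.
rewrite nonattackingE => H; rewrite weight_rows // monomial_rows /tabpoly.
rewrite scaler_prod; congr (_ *: _).
by apply: eq_bigr => r _; rewrite [row s r.+1]rowatS.
Qed.

End Link.

(** * Exchanging columns and basement entries *)

Section AdjacentColumns.
Variables (n : nat) (p p' : 'I_n).
Hypothesis pp' : p' = p.+1 :> nat.
Implicit Types u v : 'I_n.
Local Notation tau := (tperm p p').

Lemma lt_tau_l u v : v != p -> v != p' -> (tau u < v)%N = (u < v)%N.
Proof.
move=> v1 v2; case: tpermP => [->|->|//]; move: v1 v2; rewrite -!val_eqE /=; lia.
Qed.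

Lemma lt_tau_r u v : u != p -> u != p' -> (u < tau v)%N = (u < v)%N.
Proof.
move=> v1 v2; case: tpermP => [->|->|//]; move: v1 v2; rewrite -!val_eqE /=; lia.
Qed.

End AdjacentColumns.

Section ColumnSwap.
Variables (n : nat) (K : fieldType) (q t : K) (h : 'I_n -> nat).
Variables (p p' : 'I_n).
Hypothesis pp' : p' = p.+1 :> nat.
Hypothesis hpp' : h p = h p'.
Hypothesis t0 : t != 0.
Hypothesis two0 : (2%:R : K) != 0.
Hypothesis den0 : forall a b : nat, 1 - q ^+ a.+1 * t ^+ b.+1 != 0.
Implicit Types (w : rowt n) (u v : 'I_n).

Local Notation tau := (tperm p p').

Definition colswap w : rowt n := [ffun u => w (tau u)].

Lemma colswapK : involutive colswap.
Proof. by move=> w; apply/ffunP => u; rewrite !ffunE tpermK. Qed.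

Lemma h_tau u : h (tau u) = h u.
Proof. by case: tpermP => [->|->|]. Qed.

Lemma neq_pp' : p != p'.
Proof. by rewrite -val_eqE /= pp' neq_ltn leqnn. Qed.

Section Step.
Variable r : nat.

(** For columns of equal height, [(p, p')] is the only pair for which the exchange alters arms and
    attacks: [armB] compares heights strictly and never contains it, and [A0], [C0] leave it out. *)
Definition ppair u v := (u == p) && (v == p').
Definition A0 u v := armA h r u v && ~~ ppair u v.
Definition C0 u v := [&& (u < v)%N, (r < h v)%N & ~~ ppair u v].

Lemma C0_l u v : C0 (tau u) v = C0 u v.
Proof.
rewrite /C0 /ppair; case: (eqVneq v p) => [->|v1].
  rewrite (negbTE neq_pp') andbF /=; case: tpermP => [->|->|//]; move: pp'; lia.
case: (eqVneq v p') => [->|v2]; last by rewrite !andbF (lt_tau_l pp').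
by case: tpermP => [->|->|//]; rewrite ?eqxx ?ltnn /= ?andbF.
Qed.

Lemma C0_r u v : C0 u (tau v) = C0 u v.
Proof.
rewrite /C0 /ppair h_tau; case: (eqVneq u p) => [->|v1]; last first.
  case: (eqVneq u p') => [->|v2]; last by rewrite (lt_tau_r pp').
  have e : (p' < p)%N = false by lia.
  by case: tpermP => [->|->|//]; rewrite ltnn e.
by case: tpermP => [->|->|//]; rewrite ?eqxx ?ltnn /= ?andbF.
Qed.

Lemma A0E u v : A0 u v = C0 u v && (h v <= h u)%N.
Proof.
by rewrite /A0 /C0 /armA; case: (u < v)%N; case: (h v <= h u)%N; case: (r < h v)%N; case: (ppair u v).
Qed.

Lemma A0_l u v : A0 (tau u) v = A0 u v.
Proof. by rewrite !A0E C0_l h_tau. Qed.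

Lemma A0_r u v : A0 u (tau v) = A0 u v.
Proof. by rewrite !A0E C0_r h_tau. Qed.

Lemma armB_l u v : armB h r (tau u) v = armB h r u v.
Proof.
rewrite /armB h_tau; case: (eqVneq v p) => [->|v1].
  by case: tpermP => [->|->|//]; rewrite ?hpp' ?ltnn /= ?andbF.
case: (eqVneq v p') => [->|v2]; last by rewrite (lt_tau_r pp').
by case: tpermP => [->|->|//]; rewrite ?hpp' ?ltnn /= ?andbF.
Qed.

Lemma armB_r u v : armB h r u (tau v) = armB h r u v.
Proof.
rewrite /armB h_tau; case: (eqVneq u p) => [->|v1].
  by case: tpermP => [->|->|//]; rewrite ?hpp' ?ltnn /= ?andbF.
case: (eqVneq u p') => [->|v2]; last by rewrite (lt_tau_l pp').
by case: tpermP => [->|->|//]; rewrite ?hpp' ?ltnn /= ?andbF.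
Qed.

Lemma armA_A0 u v : (armA h r u v : nat) = (A0 u v + (r < h p) * (ppair u v))%N.
Proof.
rewrite /A0; case: (boolP (ppair u v)) => [/andP [/eqP -> /eqP ->]|_] /=.
  rewrite andbF /armA hpp' leqnn pp' leqnn /=.
  by case: (r < h p')%N.
by case: (armA h r u v); case: (r < h p)%N.
Qed.

Lemma sum_ppair (F : 'I_n -> 'I_n -> nat) :
  (\sum_u \sum_v ppair u v * F u v)%N = F p p'.
Proof.
rewrite (bigD1 p) //= [X in (_ + X)%N]big1 => [|u up]; last first.
  by rewrite big1 // => v _; rewrite /ppair (negbTE up).
rewrite (bigD1 p') //= [X in (_ + X + _)%N]big1 => [|v vp]; last by rewrite /ppair (negbTE vp) andbF.
by rewrite /ppair !eqxx mul1n !addn0.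
Qed.

Definition arm0 u : nat := (\sum_v (A0 u v + armB h r u v))%N.

Lemma arm0_tau u : arm0 (tau u) = arm0 u.
Proof. by apply: eq_bigr => v _; rewrite A0_l armB_l. Qed.

Lemma armn_arm0 u : armn h r u = (arm0 u + (r < h p) * (u == p))%N.
Proof.
rewrite /armn /arm0.
rewrite (eq_bigr (fun v => A0 u v + armB h r u v + (r < h p) * ppair u v)%N); last first.
  by move=> v _; rewrite armA_A0 addnAC.
rewrite big_split /= -big_distrr /=; congr (_ + _ * _)%N.
rewrite (bigD1 p') //= /ppair eqxx andbT big1 ?addn0 // => v /negbTE ->.
by rewrite andbF.
Qed.

(** The comparison count without the pair [(p, p')] and without the descents of these two columns.
    With the other cells it forms [S0], invariant under exchanging the columns in either row. *)
Definition Q0 w w' : nat :=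
  (\sum_u \sum_v (A0 u v * ((w' v < w u) + (w' u < w' v))
    + armB h r u v * ((w v < w u) + (w' u < w v)))
   + \sum_(u | (u != p) && (u != p')) armn h r u * (w u < w' u))%N.

Definition S0 w w' : K :=
  [forall u, forall v, C0 u v ==> (w' v != w u)]%:R
  * (\prod_(u | (r < h u)%N && ((u != p) && (u != p'))) cellw h r q t w w' u) * t ^+ Q0 w w'.

Lemma tau_id u : (u != p) && (u != p') -> tau u = u.
Proof. by case/andP => u1 u2; rewrite tpermD // eq_sym. Qed.

Lemma reindex_tau (R : Type) (idx : R) (op : Monoid.com_law idx) (P : pred 'I_n) (F : 'I_n -> R) :
  \big[op/idx]_(u | P u) F u = \big[op/idx]_(u | P (tau u)) F (tau u).
Proof. exact: (reindex_inj (@perm_inj _ tau)). Qed.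

Lemma S0_l w w' : S0 (colswap w) w' = S0 w w'.
Proof.
rewrite /S0; congr ((nat_of_bool _)%:R * _ * t ^+ _).
- apply/forallP/forallP => H u; apply/forallP => v.
    by have /forallP /(_ v) := H (tau u); rewrite C0_l ffunE tpermK.
  by have /forallP /(_ v) := H (tau u); rewrite C0_l ffunE.
- by apply: eq_bigr => u /andP [_ /tau_id e]; rewrite /cellw ffunE e.
- rewrite /Q0; congr (_ + _)%N; last first.
    by apply: eq_bigr => u /tau_id e; rewrite ffunE e.
  under eq_bigr => u _ do under eq_bigr => v _ do rewrite !ffunE !mulnDr -!addnA.
  under [RHS]eq_bigr => u _ do under eq_bigr => v _ do rewrite !mulnDr -!addnA.
  under eq_bigr => u _ do rewrite !big_split /=.
  under [RHS]eq_bigr => u _ do rewrite !big_split /=.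
  rewrite !big_split /=; congr (_ + (_ + (_ + _)))%N.
  + rewrite [LHS]reindex_tau /=; apply: eq_bigr => u _; apply: eq_bigr => v _.
    by rewrite A0_l tpermK.
  + rewrite [LHS]reindex_tau /=; apply: eq_bigr => u _.
    rewrite [LHS]reindex_tau /=; apply: eq_bigr => v _.
    by rewrite armB_l armB_r !tpermK.
  + apply: eq_bigr => u _.
    rewrite [LHS]reindex_tau /=; apply: eq_bigr => v _.
    by rewrite armB_r !tpermK.
Qed.

Lemma S0_r w w' : S0 w (colswap w') = S0 w w'.
Proof.
rewrite /S0; congr ((nat_of_bool _)%:R * _ * t ^+ _).
- apply/forallP/forallP => H u; apply/forallP => v.
    by have /forallP /(_ (tau v)) := H u; rewrite C0_r ffunE tpermK.
  by have /forallP /(_ (tau v)) := H u; rewrite C0_r ffunE.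
- by apply: eq_bigr => u /andP [_ /tau_id e]; rewrite /cellw ffunE e.
- rewrite /Q0; congr (_ + _)%N; last first.
    by apply: eq_bigr => u /tau_id e; rewrite ffunE e.
  under eq_bigr => u _ do under eq_bigr => v _ do rewrite !ffunE !mulnDr -!addnA.
  under [RHS]eq_bigr => u _ do under eq_bigr => v _ do rewrite !mulnDr -!addnA.
  under eq_bigr => u _ do rewrite !big_split /=.
  under [RHS]eq_bigr => u _ do rewrite !big_split /=.
  rewrite !big_split /=; congr (_ + (_ + (_ + _)))%N.
  + apply: eq_bigr => u _; rewrite [LHS]reindex_tau /=; apply: eq_bigr => v _.
    by rewrite A0_r tpermK.
  + rewrite [LHS]reindex_tau /=; apply: eq_bigr => u _.
    rewrite [LHS]reindex_tau /=; apply: eq_bigr => v _.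
    by rewrite A0_l A0_r !tpermK.
  + rewrite [LHS]reindex_tau /=; apply: eq_bigr => u _; apply: eq_bigr => v _.
    by rewrite armB_l !tpermK.
Qed.

(** The factor [t ^+ a] at a descent collects the comparisons [c < b], one for each triple of the
    column. *)
Definition g0 (a c b : nat) : K :=
  if b == c then 1 else
  (1 - t) / (1 - q ^+ (h p - r) * t ^+ a.+1) * (q ^+ (h p - r) * t ^+ a) ^+ (c < b)%N.

Definition L0 (c c' b b' : nat) : K :=
  (b' != c)%:R * g0 (arm0 p).+1 c b * g0 (arm0 p) c' b' * t ^+ ((b' < c) + (b < b'))%N.

(** The arms of the two columns differ by one, as [p'] lies in the arm of [p]. Only the relative
    order of the four entries matters, so finitely many rational identities remain. *)
Lemma L0_swap c c' b b' : (r < h p)%N -> c != c' -> b != b' ->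
  L0 c c' b b' + L0 c c' b' b = L0 c' c b b' + L0 c' c b' b.
Proof.
move=> rh cc bb; rewrite /L0 /g0.
have d1 : 1 - q ^+ (h p - r) * t ^+ (arm0 p).+1 != 0.
  by move: rh; rewrite -subn_gt0; case: (h p - r)%N => // a _; apply: den0.
have d2 : 1 - q ^+ (h p - r) * t ^+ (arm0 p).+2 != 0.
  by move: rh; rewrite -subn_gt0; case: (h p - r)%N => // a _; apply: den0.
move: d1 d2; rewrite !exprS !(mulrCA (q ^+ _)).
move: (q ^+ (h p - r)) (t ^+ arm0 p) => x y d1 d2.
have ebb : (b' == b) = false by rewrite eq_sym (negbTE bb).
have ecc : (c' == c) = false by rewrite eq_sym (negbTE cc).
case: (ltngtP b b') bb => // bb _; case: (ltngtP c c') cc => // cc _.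
all: case: (ltngtP b c) => ?; case: (ltngtP b c') => ?; try (exfalso; lia).
all: case: (ltngtP b' c) => ?; case: (ltngtP b' c') => ?; try (exfalso; lia).
all: subst; rewrite ?eqxx ?ltnn /= ?expr0 ?expr1 ?mulr1 ?mul1r ?mul0r ?addr0 ?add0r; try done.
all: try (by field; rewrite ?d1 ?d2).
Qed.

Lemma cyc_count (a b c : nat) : a != b -> a != c ->
  (cyc a b c).+1 = ((a < c) + (c < b) + (b < a))%N.
Proof. by rewrite /cyc; lia. Qed.

Lemma coinvr_swap w w' : rowok h r w -> rowok h r.+1 w' -> compat h r w w' ->
  (coinvr h r w w' + \sum_u armn h r u =
   Q0 w w' + ((r < h p) * ((w' p' < w p) + (w' p < w' p'))
     + (armn h r p * (w p < w' p) + armn h r p' * (w p' < w' p'))))%N.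
Proof.
move=> wok wok' cww.
have -> : (coinvr h r w w' + \sum_u armn h r u =
  \sum_u \sum_v (A0 u v * ((w' v < w u) + (w' u < w' v))
    + armB h r u v * ((w v < w u) + (w' u < w v)))
  + (r < h p) * (\sum_u \sum_v ppair u v * ((w' v < w u) + (w' u < w' v)))
  + \sum_u armn h r u * (w u < w' u))%N.
  rewrite big_distrr /= /coinvr -!big_split /=; apply: eq_bigr => u _.
  rewrite big_distrr /= /armn big_distrl -!big_split /=; apply: eq_bigr => v _.
  have -> : (A0 u v * ((w' v < w u) + (w' u < w' v)) +
     armB h r u v * ((w v < w u) + (w' u < w v)) +
     (r < h p) * (ppair u v * ((w' v < w u) + (w' u < w' v))) =
     armA h r u v * ((w' v < w u) + (w' u < w' v)) +
     armB h r u v * ((w v < w u) + (w' u < w v)))%N.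
    by rewrite armA_A0 mulnDl !mulnA addnAC.
  case: (boolP (armA h r u v)) => [/and3P [uv hvu rv]|_].
    have -> : armB h r u v = false by rewrite /armB ltnNge (ltnW uv).
    have uv' : v != u by rewrite neq_ltn uv orbT.
    have := cyc_count (row_ne wok' uv' rv) (cross_ne cww uv rv).
    by rewrite /= !mul1n !mul0n; gen_bools; lia.
  case: (boolP (armB h r u v)) => [uvB|_]; last by rewrite /= !mul0n.
  case/and3P: (uvB) => uv hvu rv; have uv' : v != u by rewrite neq_ltn uv.
  have ru := leq_ltn_trans rv hvu.
  have ne : w v != w' u :> nat by rewrite eq_sym (cross_ne cww).
  have := cyc_count ne (low_ne wok uv' rv).
  by rewrite /= !mul1n !mul0n; gen_bools; lia.
rewrite sum_ppair /Q0 -!addnA; congr (_ + _)%N.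
rewrite [X in (_ + X = _)%N](bigID (fun u => (u != p) && (u != p'))) /=.
rewrite addnCA; congr (_ + (_ + _))%N.
rewrite (bigD1 p) /= ?eqxx // (bigD1 p') /=; last by rewrite eqxx andbF eq_sym neq_pp'.
rewrite big1 ?addn0 // => u /andP [/andP []].
by rewrite negb_and !negbK => /orP [/eqP ->|/eqP ->]; rewrite eqxx.
Qed.

Lemma compat_swap w w' : compat h r w w' =
  [forall u, forall v, C0 u v ==> (w' v != w u)] && ((r < h p)%N ==> (w' p' != w p)).
Proof.
apply/idP/andP => [/forallP H|[/forallP H1 /implyP H2]].
  split; last first.
    have /forallP /(_ p') := H p; by rewrite -hpp' pp' leqnn.
  apply/forallP => u; apply/forallP => v; have /forallP /(_ v) := H u.
  by rewrite /C0; case: (_ < _)%N => //=; case: (_ < _)%N => //= ->; rewrite implybT.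
apply/forallP => u; apply/forallP => v; apply/implyP => /andP [uv hv].
have /forallP /(_ v) := H1 u; rewrite /C0 uv hv /=.
case: (boolP (ppair u v)) => //= /andP [/eqP -> /eqP e] _.
by rewrite e in hv *; apply: H2; rewrite hpp'.
Qed.

Lemma Kr_swap w w' : rowok h r w -> rowok h r.+1 w' -> (r < h p)%N ->
  Kr h r q t w w' * t ^+ (\sum_u armn h r u) =
  S0 w w' * L0 (w p) (w p') (w' p) (w' p').
Proof.
move=> wok wok' rh; rewrite /Kr.
case: (boolP (compat h r w w')) => [cww|]; last first.
  rewrite compat_swap rh /= negb_and /S0 /L0 => /orP [/negbTE ->|]; first by rewrite !mul0r.
  by rewrite negbK => /eqP ->; rewrite eqxx !mul0r mulr0.
rewrite mul1r -mulrA -exprD (coinvr_swap wok wok' cww) rh mul1n !exprD.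
move: cww; rewrite compat_swap rh /= /S0 => /andP [-> ne]; rewrite mul1r /L0.
have -> : (nat_of_ord (w' p') != nat_of_ord (w p)) by [].
rewrite mul1r (bigD1 p) //= (bigD1 p') /=; last by rewrite -hpp' rh eq_sym neq_pp'.
have arm_p : armn h r p = (arm0 p).+1 by rewrite armn_arm0 rh eqxx addn1.
have arm_p' : armn h r p' = arm0 p.
  by rewrite armn_arm0 eq_sym (negbTE neq_pp') muln0 addn0 -(arm0_tau p') tpermR.
have cell_p : cellw h r q t w w' p * t ^+ (armn h r p * (w p < w' p))
   = g0 (arm0 p).+1 (w p) (w' p).
  rewrite /cellw /g0 -val_eqE /= arm_p; case: eqP => [->|_].
    by rewrite ltnn muln0 mulr1.
  by case: (_ < _)%N; rewrite /= ?mul1n ?mul0n ?muln1 ?muln0 ?expr0 ?expr1 ?mulr1 ?mulrA.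
have cell_p' : cellw h r q t w w' p' * t ^+ (armn h r p' * (w p' < w' p'))
   = g0 (arm0 p) (w p') (w' p').
  rewrite /cellw /g0 -val_eqE /= arm_p' -hpp'; case: eqP => [->|_].
    by rewrite ltnn muln0 mulr1.
  by case: (_ < _)%N; rewrite /= ?mul1n ?mul0n ?muln1 ?muln0 ?expr0 ?expr1 ?mulr1 ?mulrA.
rewrite -cell_p -cell_p' exprD.
rewrite (eq_bigl (fun u => (r < h u)%N && ((u != p) && (u != p')))); last first.
  by move=> u; rewrite andbA.
rewrite /Q0 exprD; ring.
Qed.

Lemma colswap_ok k w : rowok h k (colswap w) = rowok h k w.
Proof.
rewrite /rowok; congr (_ && _).
  by apply/forallP/forallP => H u; have := H (tau u); rewrite !ffunE ?tpermK h_tau.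
by apply/forallP/forallP => H u; apply/forallP => v;
  have /forallP /(_ (tau v)) := H (tau u); rewrite !ffunE ?tpermK h_tau (inj_eq perm_inj).
Qed.

Lemma Kr_swap_sum w w' : rowok h r w -> rowok h r.+1 w' ->
  Kr h r q t w w' + Kr h r q t w (colswap w') =
  Kr h r q t (colswap w) w' + Kr h r q t (colswap w) (colswap w').
Proof.
move=> wok wok'.
have [rh|hr] := ltnP r (h p).
  have N0 : t ^+ (\sum_u armn h r u) != 0 by rewrite expf_neq0.
  have sok : rowok h r (colswap w) by rewrite colswap_ok.
  have sok' : rowok h r.+1 (colswap w') by rewrite colswap_ok.
  apply: (mulIf N0); rewrite mulrDl [RHS]mulrDl.
  rewrite (Kr_swap wok wok' rh) (Kr_swap wok sok' rh) (Kr_swap sok wok' rh) (Kr_swap sok sok' rh).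
  rewrite !S0_l !S0_r -[LHS]mulrDr -[RHS]mulrDr; congr (_ * _); rewrite !ffunE !tpermL !tpermR; apply: L0_swap => //.
    by apply: (low_ne wok); rewrite ?neq_pp' // ltnW.
  by apply: (row_ne wok'); rewrite ?neq_pp'.
(* Both columns now end at or below row [r]: the exchange fixes the upper row, and the two columns
   have no arms. *)
have abs v : (v == p) || (v == p') -> w' v = ord_max.
  by move=> /orP [] /eqP ->; apply/eqP; rewrite (rowok_abs _ wok') ltnS -?hpp'.
have -> : colswap w' = w'.
  apply/ffunP => u; rewrite ffunE; case: tpermP => [->|->|//].
    by rewrite !abs ?eqxx ?orbT.
  by rewrite !abs ?eqxx ?orbT.
suff -> : Kr h r q t w w' = Kr h r q t (colswap w) w' by [].
have N0 : t ^+ (\sum_u armn h r u) != 0 by rewrite expf_neq0.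
have noarm u : (u == p) || (u == p') -> armn h r u = 0%N.
  move=> up; have hu : (h u <= r)%N by case/orP: up => /eqP ->; rewrite -?hpp'.
  rewrite /armn big1 // => v _; rewrite /armA /armB.
  have -> : (h v <= h u)%N && (r < h v)%N = false.
    by apply/negbTE/negP => /andP [a b]; have := leq_trans b (leq_trans a hu); rewrite ltnn.
  have -> : (h v < h u)%N && (r <= h v)%N = false.
    by apply/negbTE/negP => /andP [a b]; have := leq_trans a (leq_trans hu b); rewrite ltnn.
  by rewrite !andbF.
have KS x : rowok h r x -> Kr h r q t x w' * t ^+ (\sum_u armn h r u) = S0 x w'.
  move=> xok; rewrite /Kr /S0.
  have e := compat_swap x w'; rewrite ltnNge hr /= andbT in e; rewrite -e.
  case: (boolP (compat h r x w')) => cx; last by rewrite !mul0r.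
  rewrite !mul1r -mulrA -exprD (coinvr_swap xok wok' cx) !noarm ?eqxx ?orbT //.
  rewrite ltnNge hr !mul0n !addn0; congr (_ * _); apply: eq_bigl => u.
  have [ru|] := boolP (r < h u)%N => //=; apply/esym/andP; split.
    by apply: contraTneq ru => ->; rewrite ltnNge hr.
  by apply: contraTneq ru => ->; rewrite -hpp' ltnNge hr.
by apply: (mulIf N0); rewrite (KS _ wok) KS ?S0_l ?colswap_ok.
Qed.

Lemma xw_swap w : xw K (colswap w) = xw K w.
Proof. by rewrite /xw [RHS]reindex_tau /=; apply: eq_bigr => u _; rewrite ffunE. Qed.

End Step.

(** [Kr] itself is not invariant under the exchange, but its sum over an upper row and the exchange
    of that row is; hence both sides are doubled. *)
Theorem Zrow_colswap k r w : rowok h r w ->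
  Zrow h q t k r (colswap w) = Zrow h q t k r w.
Proof.
elim: k r w => [//|k IH] r w wok /=.
apply: (scalerI two0); rewrite !scaler_nat !mulr2n.
have dbl x : \sum_(w' | rowok h r.+1 w') Kr h r q t x w' *: (xw K w' * Zrow h q t k r.+1 w')
    = \sum_(w' | rowok h r.+1 w')
        Kr h r q t x (colswap w') *: (xw K w' * Zrow h q t k r.+1 w').
  rewrite (reindex_inj (inv_inj colswapK)) /=.
  apply: eq_big => w'; first by rewrite colswap_ok.
  by rewrite colswap_ok => w'ok; rewrite xw_swap IH.
rewrite {2}dbl [X in _ = _ + X]dbl -!big_split /=; apply: eq_bigr => w' w'ok.
by rewrite -!scalerDl -(Kr_swap_sum wok w'ok).
Qed.

End ColumnSwap.

Lemma Trel_cancel n (K : fieldType) (t : K) (j j' : 'I_n) (f g h : {mpoly K[n]}) :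
  f != 0 -> msym (tperm j j') f = f -> Trel t j j' (f * g) (f * h) -> Trel t j j' g h.
Proof.
move=> f0 sf; rewrite /Trel msymM sf -!mul_mpolyC => E; apply: (mulfI f0).
transitivity ((t%:MP * (f * g) - f * h) * ('X_j - 'X_j')); first by ring.
rewrite E; ring.
Qed.

Section Basement.
Variables (n : nat) (K : fieldType) (q t : K).
Hypothesis t0 : t != 0.
Hypothesis two0 : (2%:R : K) != 0.
Hypothesis den0 : forall a b : nat, 1 - q ^+ a.+1 * t ^+ b.+1 != 0.
Implicit Types (h : 'I_n -> nat) (beta : 'S_n).

Lemma pos_brow beta j : pos (brow beta) (lbl j) = Some ((beta^-1)%g j).
Proof.
apply/eqP; rewrite -(posE _ (rowok_brow (fun => 0%N) beta) (lbl_max _)).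
by rewrite ffunE permKV.
Qed.

Lemma swp_brow beta (j j' : 'I_n) :
  swp j j' (brow beta) = brow (beta * tperm j j')%g.
Proof.
apply/ffunP => u; rewrite !ffunE permM.
have lblI : injective (@lbl n) by move=> a b /(congr1 val) /= /val_inj.
by case: (tpermP j j') => [->|->|/eqP n1 /eqP n2]; rewrite ?tpermL ?tpermR //
  tpermD // eq_sym (inj_eq lblI).
Qed.

Lemma xw_brow beta : xw K (brow beta) = \prod_(i < n) 'X_i.
Proof.
rewrite [RHS](reindex_inj (@perm_inj _ beta)) /=; apply: eq_bigr => u _.
by rewrite ffunE Xl_lbl.
Qed.

Lemma prodX_neq0 : \prod_(i < n) ('X_i : {mpoly K[n]}) != 0.
Proof.
rewrite prodf_seq_neq0; apply/allP => i _; apply/implyP => _.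
apply/eqP => /(congr1 (fun p => p@_(U_(i)))) /eqP.
by rewrite mcoeffXU eqxx mcoeff0 oner_eq0.
Qed.

Lemma msym_prodX s : msym s (\prod_(i < n) ('X_i : {mpoly K[n]})) = \prod_(i < n) 'X_i.
Proof.
rewrite rmorph_prod /= [RHS](reindex_inj (@perm_inj _ s)) /=.
by apply: eq_bigr => i _; rewrite msymXU.
Qed.

(** In the basement both labels are present, and the row monomial included in [hrel_frow] is the
    product of all variables, a symmetric factor that can be cancelled. *)
Theorem basement_hecke h k beta (j j' : 'I_n) :
  (forall u, h u <= k)%N -> j' = j.+1 :> nat ->
  ((beta^-1)%g j' < (beta^-1)%g j)%N ->
  Trel t j j' (Zrow h q t k 0 (brow beta))
    (t ^+ (h ((beta^-1)%g j) <= h ((beta^-1)%g j'))%N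
      *: Zrow h q t k 0 (brow (beta * tperm j j')%g)).
Proof.
move=> hk jj' ab.
have := hrel_frow jj' t0 two0 den0 (rowok_brow h beta) (k := k) hk.
rewrite !pos_brow /hrel ab swp_brow /frow !xw_brow scalerAr.
apply: Trel_cancel; [exact: prodX_neq0 | exact: msym_prodX].
Qed.

Theorem basement_swap h k beta (p p' : 'I_n) : p' = p.+1 :> nat -> h p = h p' ->
  Zrow h q t k 0 (brow (tperm p p' * beta)%g) = Zrow h q t k 0 (brow beta).
Proof.
move=> pp' hh; rewrite -(Zrow_colswap pp' hh t0 two0 den0 k (rowok_brow h beta)).
by congr (Zrow _ _ _ _ _ _); apply/ffunP => u; rewrite !ffunE permM.
Qed.

End Basement.

(** * Exchange of column heights at [q = 0] *)

Section ShapeSwap.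
Variables (n : nat) (K : fieldType) (t : K) (h : 'I_n -> nat) (p p' : 'I_n).
Hypothesis pp' : p' = p.+1 :> nat.
Hypothesis hpp' : (h p' < h p)%N.
Implicit Types (w : rowt n) (u v : 'I_n).

Local Notation tau := (tperm p p').
Local Notation ht := (h \o tau).
Local Notation cs := (colswap p p').

Lemma rowok_shape k w : rowok ht k (cs w) = rowok h k w.
Proof.
rewrite /rowok; congr (_ && _).
  by apply/forallP/forallP => H u; have := H (tau u); rewrite /= !ffunE ?tpermK.
by apply/forallP/forallP => H u; apply/forallP => v;
  have /forallP /(_ (tau v)) := H (tau u); rewrite /= !ffunE ?tpermK (inj_eq perm_inj).
Qed.

Lemma tau_lt u v : ~~ ((u == p) && (v == p')) -> ~~ ((u == p') && (v == p)) ->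
  (tau u < tau v)%N = (u < v)%N.
Proof.
have npp := neq_pp' pp'.
case: (boolP ((v == p) || (v == p'))) => [vp|]; last first.
  rewrite negb_or => /andP [v1 v2] _ _; rewrite [tau v]tpermD 1?eq_sym //.
  exact: (lt_tau_l pp').
case: (eqVneq u v) => [->|uv]; first by rewrite !ltnn.
case: (boolP ((u == p) || (u == p'))) => [up|].
  case/orP: vp uv => /eqP ->; case/orP: up => /eqP ->; rewrite ?eqxx //=.
rewrite negb_or => /andP [v1 v2] _ _; rewrite [tau u]tpermD 1?eq_sym //.
exact: (lt_tau_r pp').
Qed.

Section Step.
Variable r : nat.
Variables w w' : rowt n.
Hypothesis (wok : rowok h r w) (wok' : rowok h r.+1 w').
Hypothesis w0 : (r <= h p)%N -> w p = 0%N :> nat.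
Hypothesis w'0 : (r < h p)%N -> w' p = 0%N :> nat.

(** Only the columns [p] and [p'] change their order. Column [p] holds the label 0 in each of the
    two rows it reaches, and no other column does, so these two columns cannot violate the condition
    on either side. *)
Lemma compat_shape : compat ht r (cs w) (cs w') = compat h r w w'.
Proof.
have E u v : ((tau u < tau v)%N && (r < h v)%N ==> (w' v != w u))
  = ((u < v)%N && (r < h v)%N ==> (w' v != w u)).
  case: (boolP ((u == p) && (v == p'))) => [/andP [/eqP -> /eqP ->]|n1].
    rewrite tpermL tpermR pp' leqnn ltnNge leqnSn /=; apply/esym/implyP => rh.
    have rp := ltn_trans rh hpp'; rewrite -val_eqE /= w0 ?(ltnW rp) // -(w'0 rp).
    by apply: (row_ne wok') => //; rewrite eq_sym neq_pp'.
  case: (boolP ((u == p') && (v == p))) => [/andP [/eqP -> /eqP ->]|n2].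
    rewrite tpermL tpermR pp' leqnn [(p.+1 < p)%N]ltnNge leqnSn /=; apply/implyP => rp.
    rewrite -val_eqE /= w'0 // -(w0 (ltnW rp)).
    by apply: (low_ne wok); rewrite ?neq_pp' ?(ltnW rp).
  by rewrite tau_lt.
apply/forallP/forallP => H u; apply/forallP => v; last first.
  have /forallP /(_ (tau v)) := H (tau u); rewrite -E !tpermK !ffunE /=.
  by [].
have /forallP /(_ (tau v)) := H (tau u); rewrite !ffunE !tpermK /= tpermK -E.
by [].
Qed.

Lemma cyc00 a : cyc a 0 0 = false. Proof. by case: a. Qed.

(** The triples formed by the two columns change their type, but two of their entries, one above the
    other in the taller column, are both 0, so they are never coinversions. *)
Lemma coinvr_shape : coinvr ht r (cs w) (cs w') = coinvr h r w w'.
Proof.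
rewrite /coinvr [LHS](reindex_inj (@perm_inj _ tau)) /=; apply: eq_bigr => u _.
rewrite [LHS](reindex_inj (@perm_inj _ tau)) /=; apply: eq_bigr => v _.
rewrite !ffunE !tpermK /armA /armB /= !tpermK.
case: (boolP ((u == p) && (v == p'))) => [/andP [/eqP -> /eqP ->]|n1].
  rewrite tpermL tpermR pp' leqnn [(p.+1 < p)%N]ltnNge leqnSn /= hpp' /= addn0.
  case: (leqP r (h p')) => rh /=; last first.
    by rewrite [(r < h p')%N]ltnNge (ltnW rh) andbF.
  by rewrite w0 ?w'0 ?cyc00 ?andbF // ?(leq_ltn_trans rh) // ltnW // (leq_ltn_trans rh).
case: (boolP ((u == p') && (v == p))) => [/andP [/eqP -> /eqP ->]|n2].
  rewrite tpermL tpermR pp' leqnn [(p.+1 < p)%N]ltnNge leqnSn /=.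
  by rewrite leqNgt hpp' /= [(h p < h p')%N]ltnNge (ltnW hpp').
rewrite tau_lt // tau_lt //; by rewrite andbC.
Qed.

(** The arms may change, but at [q = 0] they drop out of the denominators. *)
Lemma Kr_shape : Kr ht r 0 t (cs w) (cs w') = Kr h r 0 t w w'.
Proof.
rewrite /Kr compat_shape coinvr_shape; congr (_ * _ * _).
rewrite [LHS](reindex_inj (@perm_inj _ tau)) /=.
apply: eq_big => u; rewrite tpermK // => ru.
rewrite /cellw !ffunE /= !tpermK.
have e : (0 : K) ^+ (h u - r) = 0 by rewrite expr0n subn_eq0 leqNgt ru.
by rewrite e !mul0r.
Qed.

End Step.

Lemma Zrow_shape k r w : rowok h r w -> ((r <= h p)%N -> w p = 0%N :> nat) ->
  Zrow ht 0 t k r (cs w) = Zrow h 0 t k r w.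
Proof.
elim: k r w => [//|k IH] r w wok w0 /=.
rewrite (reindex_inj (inv_inj (colswapK p p'))) /=; apply: eq_big => w'.
  exact: rowok_shape.
rewrite rowok_shape => wok'.
case: (boolP ((r < h p)%N && (w' p != 0%N :> nat))) => [/andP [rp w'p]|]; last first.
  rewrite negb_and negbK => H.
  have w'0 : (r < h p)%N -> w' p = 0%N :> nat by move=> rp; apply/eqP; rewrite rp in H.
  by rewrite Kr_shape // xw_swap IH.
(* Another label above the label 0 is a descent and contributes a positive power of [q = 0]; both
   sides vanish. *)
have K0 (hh : 'I_n -> nat) (x x' : rowt n) u : (r < hh u)%N -> x u = 0%N :> nat ->
    x' u != 0%N :> nat -> Kr hh r 0 t x x' = 0.
  move=> ru xu x'u; rewrite /Kr (bigD1 u) //= /cellw -val_eqE /= xu (negbTE x'u).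
  rewrite lt0n x'u mul1n.
  have -> : (0 : K) ^+ (hh u - r) = 0 by rewrite expr0n subn_eq0 leqNgt ru.
  by rewrite !(mulr0, mul0r).
rewrite (K0 h w w' p) ?w0 ?(ltnW rp) // (K0 ht _ _ p') ?scale0r //= ?ffunE tpermR //.
exact: w0 (ltnW rp).
Qed.

End ShapeSwap.

Lemma perm_ge_id n (s : 'S_n) : (forall p : 'I_n, (p <= s p)%N) -> s = 1%g.
Proof.
move=> H; apply/permP => p; rewrite perm1; apply: val_inj; apply/eqP.
rewrite eqn_leq H andbT -subn_eq0; apply/eqP.
have : (\sum_(u < n) (s u - u))%N == 0%N.
  by rewrite sumnB // [X in (_ - X)%N](reindex_inj (@perm_inj _ s)) /= subnn.
by rewrite sum_nat_eq0 => /forallP /(_ p) /= /eqP.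
Qed.

Lemma perm_nodesc n (s : 'S_n) :
  (forall p p' : 'I_n, p' = p.+1 :> nat -> (s p < s p')%N) -> s = 1%g.
Proof.
move=> H; apply: perm_ge_id => -[m mn]; elim: m mn => [//|m IH] mn.
exact: leq_ltn_trans (IH (ltnW mn)) (H (Ordinal (ltnW mn)) (Ordinal mn) erefl).
Qed.

(* Sorting out a descent increases [\sum_u u * s u]. *)
Lemma perm_desc_ind n (P : 'S_n -> Prop) : P 1%g ->
  (forall (s : 'S_n) (p p' : 'I_n), p' = p.+1 :> nat -> (s p' < s p)%N ->
     P (tperm p p' * s)%g -> P s) ->
  forall s, P s.
Proof.
move=> P1 PS s.
pose M (x : 'S_n) := (\sum_(u < n) u * x u)%N.
have MB x : (M x <= \sum_(u < n) n * n)%N.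
  by apply: leq_sum => u _; apply: leq_mul; exact: ltnW.
have [m] := ubnP (\sum_(u < n) n * n - M s)%N.
elim: m s => // m IH s; rewrite ltnS => sm.
case: (boolP [exists p : 'I_n, exists p' : 'I_n, (p' == p.+1 :> nat) && (s p' < s p)%N]).
  case/existsP => p /existsP [p' /andP [/eqP pp' d]]; apply: (PS _ p p') => //; apply: IH.
  have npp : p' != p by rewrite -val_eqE /= pp' neq_ltn ltnSn orbT.
  have lt : (M s < M (tperm p p' * s)%g)%N.
    rewrite /M (bigD1 p) //= (bigD1 p') //= [X in (_ < X)%N](bigD1 p) //=.
    rewrite [X in (_ < _ + X)%N](bigD1 p') //= !permM tpermL tpermR.
    rewrite [X in (_ < _ + (_ + X))%N](eq_bigr (fun u : 'I_n => u * s u)%N); last first.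
      by move=> u /andP [u1 u2]; rewrite permM tpermD // eq_sym.
    by rewrite !addnA ltn_add2r pp'; nia.
  exact: leq_trans (ltn_sub2l (leq_trans lt (MB _)) lt) sm.
rewrite negb_exists => /forallP ND; suff -> : s = 1%g by [].
apply: perm_nodesc => p p' pp'; have := ND p; rewrite negb_exists => /forallP /(_ p').
rewrite pp' eqxx /= -leqNgt leq_eqVlt => /orP [/eqP /val_inj /perm_inj e|//].
by move: pp'; rewrite e => /n_Sn.
Qed.

Definition nondec n (h : 'I_n -> nat) := forall i i' : 'I_n, (i <= i')%N -> (h i <= h i')%N.

Section Stabilizer.
Variables (n : nat) (K : fieldType) (q t : K).
Hypothesis t0 : t != 0.
Hypothesis two0 : (2%:R : K) != 0.
Hypothesis den0 : forall a b : nat, 1 - q ^+ a.+1 * t ^+ b.+1 != 0.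
Implicit Types (h : 'I_n -> nat) (beta s : 'S_n).

(** At a descent of a permutation preserving nondecreasing heights, both inequalities between the
    two heights hold. So it can be sorted out by exchanging adjacent columns of equal height. *)
Lemma basement_stab h k s beta : nondec h -> (forall u, h (s u) = h u) ->
  Zrow h q t k 0 (brow (s * beta)%g) = Zrow h q t k 0 (brow beta).
Proof.
move=> hs; elim/perm_desc_ind: s => [|s p p' pp' d IH] hst; first by rewrite mul1g.
have hpp : h p = h p'.
  apply/eqP; rewrite eqn_leq hs ?pp' //=.
  by rewrite -(hst p') -(hst p) hs // ltnW.
have -> : (s * beta = tperm p p' * (tperm p p' * s * beta))%g.
  by rewrite !mulgA tperm2 mul1g.
rewrite (basement_swap t0 two0 den0 k _ pp' hpp) IH // => u; rewrite permM hst.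
by case: tpermP => [->|->|].
Qed.

(** An equality between two shapes can be carried across an exchange of labels when both labels have
    the same heights and the same order in the two shapes: one direction uses that [T] is a
    function, the other that it is injective. *)
Lemma basement_transport h h' k beta beta' (j j' : 'I_n) :
  (forall u, h u <= k)%N -> (forall u, h' u <= k)%N -> j' = j.+1 :> nat ->
  ((beta'^-1)%g j < (beta'^-1)%g j')%N = ((beta^-1)%g j < (beta^-1)%g j')%N ->
  h' ((beta'^-1)%g j) = h ((beta^-1)%g j) -> h' ((beta'^-1)%g j') = h ((beta^-1)%g j') ->
  Zrow h q t k 0 (brow (beta * tperm j j')%g) = Zrow h' q t k 0 (brow (beta' * tperm j j')%g) ->
  Zrow h q t k 0 (brow beta) = Zrow h' q t k 0 (brow beta').
Proof.
move=> hk hk' jj' ord e1 e2 EE; have jneq : j != j' by rewrite neq_pp'.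
have inv (x : 'S_n) i : ((x * tperm j j')^-1)%g i = (x^-1)%g (tperm j j' i).
  by rewrite invMg permM tpermV.
have ss (x : 'S_n) : (x * tperm j j' * tperm j j')%g = x by rewrite -mulgA tperm2 mulg1.
have [lt|ge] := ltnP ((beta^-1)%g j) ((beta^-1)%g j'); rewrite ?lt in ord.
  have := @basement_hecke _ _ _ _ t0 two0 den0 h k (beta * tperm j j')%g _ _ hk jj'.
  have := @basement_hecke _ _ _ _ t0 two0 den0 h' k (beta' * tperm j j')%g _ _ hk' jj'.
  rewrite !inv tpermL tpermR !ss e1 e2 EE => /(_ ord) T2 /(_ lt) /(Trel_fun jneq T2) /esym.
  by apply: scalerI; rewrite expf_neq0.
have lt (x : 'S_n) : ((x^-1)%g j < (x^-1)%g j')%N = false -> ((x^-1)%g j' < (x^-1)%g j)%N.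
  move=> /negbT; rewrite -leqNgt leq_eqVlt => /orP [/eqP /val_inj /perm_inj e|//].
  by rewrite e eqxx in jneq.
have lt1 := lt beta (negbTE (_ : ~~ _)); rewrite -leqNgt in lt1.
have T1 := basement_hecke t0 two0 den0 hk jj' (lt1 ge).
have ord' : ((beta'^-1)%g j < (beta'^-1)%g j')%N = false by rewrite ord ltnNge ge.
have T2 := basement_hecke t0 two0 den0 hk' jj' (lt beta' ord').
by rewrite e1 e2 -EE in T2; exact: Trel_inj jneq _ _ _ t0 T1 T2.
Qed.

End Stabilizer.

Section QZero.
Variables (n : nat) (K : fieldType) (t : K).
Hypothesis t0 : t != 0.
Hypothesis two0 : (2%:R : K) != 0.
Implicit Types (h : 'I_n -> nat) (beta s : 'S_n).

Lemma den_q0 (a b : nat) : 1 - (0 : K) ^+ a.+1 * t ^+ b.+1 != 0.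
Proof. by rewrite exprS !mul0r subr0 oner_neq0. Qed.

Local Notation E h k beta := (Zrow h 0 t k 0 (brow beta)).

(* Base case of the induction on the label [beta p]: when it is the smallest one, a column whose
   entries cannot increase upwards is constant, so that the columns can be exchanged. *)
Lemma basement_shape h k beta (p p' : 'I_n) : (forall u, h u <= k)%N ->
  p' = p.+1 :> nat -> (h p' < h p)%N -> (beta p < beta p')%N ->
  E h k beta = E (h \o tperm p p') k (tperm p p' * beta)%g.
Proof.
move=> hk pp' hpp; have [m] := ubnP (beta p); elim: m beta => // m IH beta.
rewrite ltnS => bm bpp; case: (posnP (beta p)) => [b0|bpos].
  rewrite -(Zrow_shape t pp' hpp k (rowok_brow h beta)); last by rewrite ffunE.
  by congr (Zrow _ _ _ _ _ _); apply/ffunP => u; rewrite !ffunE permM.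
(* Exchanging the label of column [p] with its predecessor lowers [beta p]. The predecessor sits
   neither in [p] nor, as [beta p < beta p'], in [p'], so moving the columns does not alter the
   order of the two labels. *)
set j' := beta p; have jn : (j'.-1 < n)%N by rewrite prednK // ltnW.
pose j := Ordinal jn; have jj' : j' = j.+1 :> nat by rewrite /= prednK.
pose a := (beta^-1)%g j; have ba : beta a = j by rewrite permKV.
have bp : (beta^-1)%g j' = p by rewrite permK.
have ap : a != p.
  by apply: contra_eq_neq ba => ->; rewrite -val_eqE /= -/j' jj' neq_ltn ltnSn orbT.
have ap' : a != p'.
  apply: contraTneq bpp => e; rewrite -e ba -leqNgt -/j' jj'; exact: leqnSn.
have jlt : (j < beta p')%N by apply: leq_ltn_trans bpp; rewrite -/j' jj' leqnSn.
have inv1 (x : 'S_n) i : ((tperm p p' * x)^-1)%g i = tperm p p' ((x^-1)%g i).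
  by rewrite invMg permM tpermV.
apply: (basement_transport t0 two0 den_q0 (j := j) (j' := j') hk _ jj') => [u||||].
- exact: hk.
- by rewrite !inv1 -/a bp tau_lt // ?(negbTE ap) ?(negbTE ap').
- by rewrite inv1 /= tpermK.
- by rewrite inv1 /= tpermK.
rewrite -mulgA; apply: IH; rewrite !permM -/j' tpermR.
  by rewrite -ltnS /= prednK.
by rewrite tpermD // -val_eqE /= neq_ltn ?jlt ?bpp.
Qed.

End QZero.

(** * The polynomials F_alpha *)

(** The hypothesis on the inversions of [beta] is weaker than monotonicity of [h \o beta], which
    would be lost when a descent of [beta] is sorted out. *)
Theorem basement_sort0 n (K : fieldType) (t : K) (h : 'I_n -> nat) k (beta : 'S_n) :
  t != 0 -> (2%:R : K) != 0 -> (forall u, h u <= k)%N ->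
  (forall i i' : 'I_n, (i < i')%N -> (beta i' < beta i)%N -> (h (beta i) <= h (beta i'))%N) ->
  Zrow (h \o beta) 0 t k 0 (brow beta) = Zrow h 0 t k 0 (brow (1%g : 'S_n)).
Proof.
move=> t0 two0 hk; elim/perm_desc_ind: beta => [_|s p p' pp' d IH H].
  have -> // : h \o (1%g : 'S_n) = h by apply: functional_extensionality => u /=; rewrite perm1.
have hpp := H p p' _ d; rewrite pp' ltnSn in hpp; move: {hpp}(hpp isT) => hpp.
have H' (i i' : 'I_n) : (i < i')%N -> ((tperm p p' * s)%g i' < (tperm p p' * s)%g i)%N ->
    (h ((tperm p p' * s)%g i) <= h ((tperm p p' * s)%g i'))%N.
  move=> ii'; rewrite !permM.
  case: (boolP ((i == p) && (i' == p'))) => [/andP [/eqP -> /eqP ->]|n1].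
    by rewrite tpermL tpermR ltnNge (ltnW d).
  case: (boolP ((i == p') && (i' == p))) => [/andP [/eqP e /eqP e']|n2].
    by move: ii'; rewrite e e' pp' ltnNge leqnSn.
  by apply: H; rewrite tau_lt.
rewrite -(IH H'); move: hpp; rewrite leq_eqVlt => /orP [/eqP hpp|hpp].
  have hE : (h \o (tperm p p' * s)%g) p = (h \o (tperm p p' * s)%g) p'.
    by rewrite /= !permM tpermL tpermR.
  rewrite (basement_swap t0 two0 (den_q0 t) k s pp' hE).
  have -> // : h \o s = h \o (tperm p p' * s)%g.
  apply: functional_extensionality => u /=; rewrite permM.
  by case: (tpermP p p' u) => [->|->|//].
have hk' u : ((h \o (tperm p p' * s)%g) u <= k)%N by exact: hk.
have hpp' : ((h \o (tperm p p' * s)%g) p' < (h \o (tperm p p' * s)%g) p)%N.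
  by rewrite /= !permM tpermL tpermR.
have d' : ((tperm p p' * s)%g p < (tperm p p' * s)%g p')%N by rewrite !permM tpermL tpermR.
rewrite (basement_shape t0 two0 hk' pp' hpp' d').
rewrite mulgA tperm2 mul1g.
have -> // : (h \o (tperm p p' * s)%g) \o tperm p p' = h \o s.
by apply: functional_extensionality => u /=; rewrite permM tpermK.
Qed.

Definition sq n (f : 'I_n -> nat) : seq nat := [seq f i | i <- enum 'I_n].

Lemma size_sq n (f : 'I_n -> nat) : size (sq f) = n.
Proof. by rewrite size_map size_enum_ord. Qed.

Lemma nth_sq n (f : 'I_n -> nat) (i : 'I_n) : nth 0%N (sq f) i = f i.
Proof. by rewrite (nth_map i) ?size_enum_ord // nth_ord_enum. Qed.

Lemma sq_nth n (alpha : seq nat) : size alpha = n ->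
  alpha = sq (fun i : 'I_n => nth 0%N alpha i).
Proof.
move=> sa; apply: (@eq_from_nth _ 0%N) => [|i ia]; first by rewrite size_sq.
by rewrite sa in ia; rewrite (nth_sq _ (Ordinal ia)).
Qed.

Lemma perm_sq n (f : 'I_n -> nat) (s : 'S_n) : perm_eq (sq (f \o s)) (sq f).
Proof.
have -> : sq (f \o s) = [seq f i | i <- [seq s i | i <- enum 'I_n]] by rewrite -map_comp.
apply: perm_map; apply: uniq_perm; rewrite ?enum_uniq //.
  by rewrite map_inj_uniq ?enum_uniq //; exact: perm_inj.
move=> i; rewrite mem_enum; apply/mapP; exists ((s^-1)%g i); rewrite ?permKV ?mem_enum //.
Qed.

Lemma beta_condE n (f : 'I_n -> nat) (s : 'S_n) :
  beta_cond (sq f) s = [forall i : 'I_n, f (s i) == acol (inc (sq f)) i].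
Proof. by apply: eq_forallb => i; rewrite nth_sq. Qed.

Lemma beta_of_cond n (f : 'I_n -> nat) : beta_cond (sq f) (beta_of n (sq f)).
Proof.
have [s0 s0P] : exists s : 'S_n, beta_cond (sq f) s.
  have sz : size (inc (sq f)) == n by rewrite size_sort size_sq.
  have sz' : size (sq f) == n by rewrite size_sq.
  have : perm_eq (Tuple sz) (Tuple sz') by rewrite /= perm_sort.
  case/tuple_permP => s es; exists s; apply/forallP => i; apply/eqP.
  have := congr1 (fun x : seq nat => nth 0%N x i) es.
  by rewrite /= => ->; rewrite -[RHS]/(nth 0%N [tuple _ | _ < n] i) nth_mktuple (tnth_nth 0%N).
case: (arg_maxnP (perm_length (n := n)) s0P) => s sP smax.
rewrite /beta_of; case: pickP => [s' /andP [] //|/(_ s)].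
rewrite /is_beta_of sP /= => /negbT /forallP [] s'; apply/implyP; exact: smax.
Qed.

Definition hinc n (f : 'I_n -> nat) (u : 'I_n) : nat := acol (inc (sq f)) u.

Lemma hinc_nondec n (f : 'I_n -> nat) : nondec (hinc f).
Proof.
move=> i i' ii'; rewrite /hinc /acol.
apply: (sorted_leq_nth leq_trans leqnn) => //; first exact: sort_sorted leq_total _.
- by rewrite inE size_sort size_sq.
- by rewrite inE size_sort size_sq.
Qed.

Lemma hinc_le n (f : 'I_n -> nat) u : (hinc f u <= sumn (sq f))%N.
Proof.
have -> : sumn (sq f) = sumn (inc (sq f)).
  by apply: esym; apply: perm_sumn; rewrite perm_sort.
exact: acol_le.
Qed.

Lemma inc_perm n (f : 'I_n -> nat) (s : 'S_n) : inc (sq (f \o s)) = inc (sq f).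
Proof. by apply/perm_sortP; [exact: leq_total|exact: leq_trans|exact: anti_leq|exact: perm_sq]. Qed.

Lemma hinc_perm n (f : 'I_n -> nat) (s : 'S_n) : hinc (f \o s) = hinc f.
Proof. by rewrite /hinc inc_perm. Qed.

Lemma sumn_perm n (f : 'I_n -> nat) (s : 'S_n) : sumn (sq (f \o s)) = sumn (sq f).
Proof. exact: perm_sumn (perm_sq f s). Qed.

Section FmacBasement.
Variables (n : nat) (K : fieldType) (q t : K).
Hypothesis t0 : t != 0.
Hypothesis two0 : (2%:R : K) != 0.
Hypothesis den0 : forall a b : nat, 1 - q ^+ a.+1 * t ^+ b.+1 != 0.
Implicit Types (f : 'I_n -> nat) (beta s : 'S_n).

(** Two permutations sorting [f] differ by a permutation of columns of equal height, which
    [basement_stab] absorbs. Proofs below can thus choose the sorting permutation that suits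
    them. *)
Theorem Fmac_basement f beta : (forall i, f (beta i) = hinc f i) ->
  Fmac n q t (sq f) = Zrow (hinc f) q t (sumn (sq f)) 0 (brow beta).
Proof.
move=> H; set b0 := beta_of n (sq f).
have H0 i : f (b0 i) = hinc f i.
  by have := beta_of_cond f; rewrite beta_condE => /forallP /(_ i) /eqP.
have sinc : sumn (inc (sq f)) = sumn (sq f) by apply: perm_sumn; rewrite perm_sort.
rewrite /Fmac Emac_rows sinc -/b0.
have -> : b0 = (b0 * beta^-1 * beta)%g by rewrite mulgKV.
apply: basement_stab => //; first exact: hinc_nondec.
by move=> u; rewrite -[LHS]/(hinc f _) -[RHS]/(hinc f _) -H permM permKV H0.
Qed.

Lemma basement_exists f : exists beta : 'S_n, forall i, f (beta i) = hinc f i.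
Proof.
exists (beta_of n (sq f)) => i.
by have := beta_of_cond f; rewrite beta_condE => /forallP /(_ i) /eqP.
Qed.

Theorem Fmac_hecke f (j j' : 'I_n) : j' = j.+1 :> nat -> (f j' < f j)%N ->
  Trel t j j' (Fmac n q t (sq f)) (Fmac n q t (sq (f \o tperm j j'))).
Proof.
move=> jj' ff; have [beta H] := basement_exists f.
have H' i : (f \o tperm j j') ((beta * tperm j j')%g i) = hinc (f \o tperm j j') i.
  by rewrite hinc_perm /= permM tpermK H.
rewrite (Fmac_basement H) (Fmac_basement H') hinc_perm sumn_perm.
have lt : (hinc f ((beta^-1)%g j') < hinc f ((beta^-1)%g j))%N by rewrite -!H !permKV.
have lt' : ((beta^-1)%g j' < (beta^-1)%g j)%N.
  by rewrite ltnNge; apply: contraL lt => /(hinc_nondec f); rewrite -leqNgt.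
have := basement_hecke t0 two0 den0 (hinc_le f) jj' lt'.
by rewrite leqNgt lt expr0 scale1r.
Qed.

Theorem Fmac_sym f (j j' : 'I_n) : t != -1 -> j' = j.+1 :> nat -> f j' = f j ->
  msym (tperm j j') (Fmac n q t (sq f)) = Fmac n q t (sq f).
Proof.
move=> t1 jj' ff; have [beta H] := basement_exists f.
have jneq : j != j' by rewrite neq_pp'.
have fs i : f (tperm j j' i) = f i by case: tpermP => [->|->|].
have H' i : f ((beta * tperm j j')%g i) = hinc f i by rewrite permM fs H.
(* [basement_hecke] asks for [j'] to the left of [j]. The parts being equal, [b] and its exchange
   both sort [f], so the relation reads [T F = t F]. *)
suff [b Hb lt] : exists2 b : 'S_n, forall i, f (b i) = hinc f i & ((b^-1)%g j' < (b^-1)%g j)%N.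
  have Hb' i : f ((b * tperm j j')%g i) = hinc f i by rewrite permM fs Hb.
  apply: (Trel_symE (t := t) jneq) => //.
  have := basement_hecke t0 two0 den0 (hinc_le f) jj' lt.
  by rewrite -(Fmac_basement Hb) -(Fmac_basement Hb') -!Hb !permKV ff leqnn expr1.
case: (ltngtP ((beta^-1)%g j') ((beta^-1)%g j)) => [lt|gt|/val_inj /perm_inj e].
- by exists beta.
- by exists (beta * tperm j j')%g => //; rewrite invMg !permM tpermV tpermL tpermR.
- by rewrite e eqxx in jneq.
Qed.

End FmacBasement.

Theorem Fmac_q0 n (K : fieldType) (t : K) (alpha : seq nat) : t != 0 -> (2%:R : K) != 0 ->
  size alpha = n -> Fmac n 0 t alpha = Emac alpha (1%g : 'S_n) 0 t.
Proof.
move=> t0 two0 /sq_nth ->; set f := (fun i => _).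
have [beta H] := basement_exists f.
rewrite (Fmac_basement t0 two0 (den_q0 t) H) Emac_rows.
have -> : (fun u : 'I_n => acol (sq f) u) = f.
  by apply: functional_extensionality => u; rewrite /acol nth_sq.
have -> : hinc f = f \o beta by apply: functional_extensionality => u; rewrite -H.
apply: basement_sort0 => // [u|i i' ii' _].
  by rewrite -(nth_sq f); exact: acol_le.
by rewrite !H; apply: hinc_nondec; exact: ltnW.
Qed.

(* At q = 0 all coefficients are polynomials in t, so that [t] may be specialised. *)
Definition Emac0 n (alpha : seq nat) (beta : 'S_n) (R : comNzRingType) (t : R) : {mpoly R[n]} :=
  \sum_(s : filling n alpha | nonattacking beta s)
    ((maj beta s == 0)%:R * t ^+ coinv beta s
      * \prod_(c <- cells n alpha)
          (if ent beta s c != ent beta s (south c) then 1 - t else 1))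
      *: \prod_(x : cellT n alpha) 'X_(s x).

Lemma Emac_q0E n (alpha : seq nat) (beta : 'S_n) (K : fieldType) (t : K) :
  Emac alpha beta 0 t = Emac0 alpha beta t.
Proof.
apply: eq_bigr => s _; congr (_ *: _); rewrite expr0n; congr (_ * _ * _).
apply: eq_bigr => c _; rewrite /cell_weight.
by case: ifP => // _; rewrite exprS !mul0r subr0 divr1.
Qed.

Lemma map_Emac0 n (alpha : seq nat) (beta : 'S_n) (R S : comNzRingType)
    (f : {rmorphism R -> S}) (t : R) :
  map_mpoly f (Emac0 alpha beta t) = Emac0 alpha beta (f t).
Proof.
rewrite /Emac0 rmorph_sum; apply: eq_bigr => s _.
rewrite /= map_mpolyZ rmorph_prod; congr (_ *: _); last first.
  by apply: eq_bigr => x _; rewrite /= map_mpolyX.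
rewrite !rmorphM rmorph_nat rmorphXn rmorph_prod; congr (_ * _ * _).
by apply: eq_bigr => c _; case: ifP; rewrite ?rmorphB ?rmorph1.
Qed.

Lemma map_mpoly_inj n (R S : comNzRingType) (f : {rmorphism R -> S}) :
  injective f -> injective (map_mpoly f : {mpoly R[n]} -> {mpoly S[n]}).
Proof.
move=> fI p r e; apply/mpolyP => m; apply: fI.
by rewrite -!mcoeff_map_mpoly e.
Qed.

Lemma tofrac_inj (R : idomainType) : injective (@tofrac R).
Proof. by move=> x y /eqP; rewrite tofrac_eq => /eqP. Qed.

Lemma tT_neq0 : tT != 0.
Proof. by rewrite tofrac_eq0 polyX_eq0. Qed.

Lemma Qt_two : (2%:R : Qt) != 0.
Proof.
have -> : (2%:R : Qt) = tofrac (2%:R : {poly rat}) by rewrite rmorph_nat.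
by rewrite tofrac_eq0 -polyC_natr polyC_eq0.
Qed.

(** The Hecke relations need [t] invertible, so the value 0 is reached through the indeterminate of
    [Q(t)]. *)
Theorem Fmac_q0t0 n (alpha : seq nat) : size alpha = n ->
  Fmac n (0 : rat) 0 alpha = Emac alpha (1%g : 'S_n) (0 : rat) 0.
Proof.
move=> sa; have := Fmac_q0 tT_neq0 Qt_two sa.
rewrite /Fmac !Emac_q0E -!(map_Emac0 _ _ (@tofrac {poly rat})).
move=> /(map_mpoly_inj (@tofrac_inj _)) /(congr1 (map_mpoly (horner_eval (0 : rat)))).
by rewrite !map_Emac0 /= /horner_eval hornerX.
Qed.

Theorem Gmac_q0t0 n (gamma : seq nat) : Gmac n (0 : rat) 0 gamma = QS n gamma.
Proof.
apply: eq_bigr => a _; apply: Fmac_q0t0.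
by rewrite size_map size_enum_ord.
Qed.

(** * Supports and quasisymmetry *)

Lemma mcoeffXM n (R : nzRingType) (p : {mpoly R[n]}) (m k : 'X_{1..n}) :
  ('X_[m] * p)@_k = if (m <= k)%MM then p@_(k - m) else 0.
Proof.
rewrite -commr_mpolyX; case: ifP => [mk|mk]; first by rewrite -{1}(submK mk) addmC mcoeffMX.
rewrite [p]mpolyE mulr_suml raddf_sum big1_seq //= => k' _.
rewrite -scalerAl -mpolyXD mcoeffZ mcoeffX; case: eqP => [e|]; last by rewrite mulr0.
by rewrite -e in mk; case/mnm_lepP: mk => i; rewrite mnmDE leq_addl.
Qed.

Definition mrow n (w : rowt n) : 'X_{1..n} := [multinom (\sum_u (w u == lbl i))%N | i < n].

Lemma xw_mrow n (K : fieldType) (w : rowt n) : xw K w = 'X_[mrow w].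
Proof.
transitivity (\prod_u 'X_[K, [multinom (w u == lbl i : nat) | i < n]]).
  apply: eq_bigr => u _; case: (eqVneq (w u) ord_max) => [->|/lblP [i ->]].
    rewrite Xl_max -mpolyX0; congr 'X_[_]; apply/mnmP => i.
    by rewrite !mnmE eq_sym (negbTE (lbl_max _)).
  rewrite Xl_lbl; congr 'X_[_]; apply/mnmP => k; by rewrite !mnmE.
rewrite mprodXE; congr 'X_[_]; apply/mnmP => i.
by rewrite mnm_sumE mnmE; apply: eq_bigr => u _; rewrite mnmE.
Qed.

Section RowCopy.
Variables (n : nat) (h : 'I_n -> nat).
Hypothesis hs : nondec h.
Implicit Types (w : rowt n) (u v : 'I_n).

(* The columns increase in height, so an entry cannot come from a column to the left of it; if all
   entries of a row come from the row below, they must be copied from right below. *)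
Lemma row_copy r w w' : rowok h r.+1 w' -> compat h r w w' ->
  (forall u, (r < h u)%N -> exists v, w v = w' u) ->
  forall u, (r < h u)%N -> w' u = w u.
Proof.
move=> wok' cww H u; have [m] := ubnP (n - u)%N; elim: m u => // m IH u.
rewrite ltnS => um ru; have [v wv] := H u ru.
case: (ltngtP u v) => [uv|vu|/val_inj e]; last by rewrite -wv e.
- have rv : (r < h v)%N := leq_trans ru (hs (ltnW uv)).
  have vm : (n - v < m)%N by have := ltn_ord v; lia.
  have := IH v vm rv; rewrite wv => e.
  have ne : v != u by rewrite neq_ltn uv orbT.
  by have := row_ne wok' ne rv; rewrite e eqxx.
- by have := cross_ne cww vu ru; rewrite wv eqxx.
Qed.

Lemma row_copy_brow w' beta : rowok h 1 w' -> compat h 0 (brow beta) w' ->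
  forall u, (0 < h u)%N -> w' u = brow beta u.
Proof.
move=> wok' cww; apply: row_copy => // u hu.
have /lblP [i ->] : w' u != ord_max by rewrite (rowok_abs _ wok') -leqNgt.
by exists ((beta^-1)%g i); rewrite ffunE permKV.
Qed.

Lemma Zrow_support (K : fieldType) (q t : K) k (beta : 'S_n) (m : 'X_{1..n}) u :
  (Zrow h q t k 0 (brow beta))@_m != 0 -> (0 < h u <= k)%N -> (0 < m (beta u))%N.
Proof.
case: k => [|k]; first by rewrite leqn0 => _ /andP [/lt0n_neq0 /negbTE ->].
move=> /= mn0 /andP [hu _]; apply: contraNltn mn0; rewrite leqn0 => /eqP m0.
rewrite raddf_sum big1 //= => w' wok'; rewrite mcoeffZ.
case: (boolP (compat h 0 (brow beta) w')) => cww; last by rewrite /Kr (negbTE cww) !mul0r.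
rewrite xw_mrow mcoeffXM; case: ifP => [/mnm_lepP /(_ (beta u))|]; last by rewrite mulr0.
rewrite mnmE m0 leqn0 sum_nat_eq0 => /forallP /(_ u) /=.
by rewrite (row_copy_brow wok' cww hu) ffunE eqxx.
Qed.

End RowCopy.

Section EnumSplit.
Variables (n : nat) (j j' : 'I_n).
Hypothesis jj' : j' = j.+1 :> nat.

Lemma enum_split : exists A B : seq 'I_n, [/\ enum 'I_n = A ++ [:: j, j' & B],
  all (fun i => (i != j) && (i != j')) A & all (fun i => (i != j) && (i != j')) B].
Proof.
exists (take j (enum 'I_n)), (drop j.+2 (enum 'I_n)).
have e : enum 'I_n = take j (enum 'I_n) ++ [:: j, j' & drop j.+2 (enum 'I_n)].
  rewrite -{1}(cat_take_drop j (enum 'I_n)); congr (_ ++ _).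
  rewrite (drop_nth j) ?size_enum_ord // nth_ord_enum; congr (_ :: _).
  by rewrite (drop_nth j) ?size_enum_ord -?jj' // nth_ord_enum.
have := enum_uniq 'I_n; rewrite e cat_uniq => /and3P [_ /norP [nA1 /norP [nA2 _]]].
rewrite -e => /and3P; rewrite /= inE negb_or => -[/andP [_ nB1] nB2 _]; split=> //.
  by apply/allP => i iA; apply/andP; split; apply: contraTneq iA => ->.
by apply/allP => i iB; apply/andP; split; apply: contraTneq iB => ->.
Qed.

Lemma strongpart_swap (f : 'I_n -> nat) : (f j == 0%N) || (f j' == 0%N) ->
  strongpart (sq (f \o tperm j j')) = strongpart (sq f).
Proof.
have [A [B [e AA AB]]] := enum_split; rewrite /strongpart /sq e => z.
rewrite !map_cat !filter_cat /= tpermL tpermR.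
have E s : all (fun i => (i != j) && (i != j')) s ->
    [seq (f \o tperm j j') i | i <- s] = [seq f i | i <- s].
  move=> /allP H; apply/eq_in_map => i /H /andP [i1 i2] /=.
  by rewrite tpermD // eq_sym.
by rewrite !E //; case: eqP z => [->|_]; case: eqP => [->|_].
Qed.

End EnumSplit.

Lemma strongpart_nth (s : seq nat) :
  (forall i, nth 0%N s i = 0%N -> nth 0%N s i.+1 = 0%N) ->
  forall i, nth 0%N (strongpart s) i = nth 0%N s i.
Proof.
elim: s => [//|x s IH] H i /=; case: eqP => [x0|x0] /=; last first.
  by case: i => [//|i] /=; apply: IH => i'; exact: (H i'.+1).
have Z k : nth 0%N (x :: s) k = 0%N by elim: k => // k /H.
rewrite Z; suff -> : strongpart s = [::] by rewrite nth_nil.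
apply/eqP; rewrite -[_ == _]negbK -has_filter; apply/hasPn => y ys.
by rewrite negbK -(nth_index 0%N ys); apply/eqP/(Z (index y s).+1).
Qed.

Lemma mseq_sq n (m : 'X_{1..n}) : (m : seq nat) = sq (fun i => m i).
Proof.
apply: (@eq_from_nth _ 0%N) => [|i im]; first by rewrite size_sq size_tuple.
rewrite size_tuple in im; rewrite (nth_sq _ (Ordinal im)).
by rewrite /fun_of_multinom (tnth_nth 0%N).
Qed.

(** Moving a zero exponent to the right past a nonzero one lowers the sum of the [i * m i]; the
    process ends when all zeros are last, at the packed monomial. *)
Lemma quasisym_adjacent n (R : comNzRingType) (p : {mpoly R[n]}) :
  (forall (j j' : 'I_n) (m : 'X_{1..n}), j' = j.+1 :> nat -> m j = 0%N ->
     p@_m = p@_[multinom m (tperm j j' i) | i < n]) ->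
  quasisymmetric p.
Proof.
move=> H m; have [b] := ubnP (\sum_(i < n) i * m i)%N; elim: b m => // b IH m; rewrite ltnS => mb.
case: (boolP [exists j : 'I_n, exists j' : 'I_n,
   [&& j' == j.+1 :> nat, m j == 0%N & m j' != 0%N]]).
  case/existsP => j /existsP [j' /and3P [/eqP jj' /eqP m0 m1]].
  rewrite (H j j' m jj' m0) IH; last first.
    apply: leq_trans mb; have npp := neq_pp' jj'.
    rewrite (bigD1 j) //= (bigD1 j') 1?eq_sym //= [X in (_ < X)%N](bigD1 j) //=.
    rewrite [X in (_ < _ + X)%N](bigD1 j') 1?eq_sym //= !mnmE tpermL tpermR m0.
    rewrite [X in (_ + (_ + X) < _)%N](eq_bigr (fun i : 'I_n => i * m i)%N); last first.
      by move=> i /andP [i1 i2]; rewrite mnmE tpermD // eq_sym.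
    by rewrite !muln0 !add0n ltn_add2r jj' mulSn -[X in (X < _)%N]add0n ltn_add2r lt0n.
  congr (p@_ _); apply/mnmP => i; rewrite !mnmE; congr (nth _ _ _).
  rewrite !mseq_sq -[RHS](strongpart_swap jj') ?m0 //; congr strongpart.
  by apply: eq_map => k /=; rewrite mnmE.
rewrite negb_exists => /forallP ND; congr (p@_ _); apply/mnmP => i; rewrite mnmE.
rewrite mseq_sq strongpart_nth ?nth_sq // => k.
have [kn|kn] := ltnP k.+1 n; last by move=> _; rewrite nth_default ?size_sq.
rewrite (nth_sq _ (Ordinal (ltnW kn))) (nth_sq _ (Ordinal kn)) => m0.
have := ND (Ordinal (ltnW kn)); rewrite negb_exists => /forallP /(_ (Ordinal kn)).
by rewrite m0 !eqxx /= negbK => /eqP.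
Qed.

Section Quasisymmetry.
Variables (n : nat) (K : fieldType) (q t : K).
Hypothesis t0 : t != 0.
Hypothesis t1 : t != -1.
Hypothesis two0 : (2%:R : K) != 0.
Hypothesis den0 : forall a b : nat, 1 - q ^+ a.+1 * t ^+ b.+1 != 0.
Implicit Types f : 'I_n -> nat.

Local Notation F f := (Fmac n q t (sq f)).

Lemma Fmac_support f (m : 'X_{1..n}) i : (F f)@_m != 0 -> (0 < f i)%N -> (0 < m i)%N.
Proof.
have [beta H] := basement_exists f; rewrite (Fmac_basement t0 two0 den0 H) => mn fi.
have e : f i = hinc f ((beta^-1)%g i) by rewrite -H permKV.
have := Zrow_support (hinc_nondec f) mn (_ : (0 < hinc f ((beta^-1)%g i) <= _)%N).
by rewrite permKV; apply; rewrite hinc_le -e fi.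
Qed.

Lemma Fmac_pair_sym f (j j' : 'I_n) : j' = j.+1 :> nat ->
  msym (tperm j j') (F f + F (f \o tperm j j')) = F f + F (f \o tperm j j').
Proof.
move=> jj'; have jneq : j != j' by rewrite neq_pp'.
case: (ltngtP (f j') (f j)) => [lt|gt|e].
- exact: (Trel_sumP jneq (Fmac_hecke t0 two0 den0 jj' lt)).
- have gt' : ((f \o tperm j j') j' < (f \o tperm j j') j)%N by rewrite /= tpermL tpermR.
  have := Trel_sumP jneq (Fmac_hecke t0 two0 den0 jj' gt').
  have -> : (f \o tperm j j') \o tperm j j' = f.
    by apply: functional_extensionality => i /=; rewrite tpermK.
  by rewrite addrC.
- have -> : f \o tperm j j' = f.
    by apply: functional_extensionality => i /=; case: tpermP => [->|->|].
  by rewrite msymD (Fmac_sym t0 two0 den0 t1 jj' e).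
Qed.

Lemma scale2_inj : injective (fun p : {mpoly K[n]} => p + p).
Proof. by move=> x y /=; rewrite -!mulr2n -!scaler_nat; apply: scalerI. Qed.

(** Doubling the sum avoids choosing representatives for the orbits of [s]. *)
Lemma msym_sum_involution (I : finType) (P : pred I) (s : I -> I) (G : I -> {mpoly K[n]}) (w : 'S_n) :
  involutive s -> (forall a, P (s a) = P a) ->
  (forall a, P a -> msym w (G a + G (s a)) = G a + G (s a)) ->
  msym w (\sum_(a | P a) G a) = \sum_(a | P a) G a.
Proof.
move=> sI Ps H; apply: scale2_inj; rewrite /= -msymD.
have -> : (\sum_(a | P a) G a) + (\sum_(a | P a) G a) = \sum_(a | P a) (G a + G (s a)).
  rewrite {2}(reindex_inj (inv_inj sI)) big_split /=; congr (_ + _).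
  by apply: eq_bigl => a; rewrite Ps.
by rewrite rmorph_sum; apply: eq_bigr => a /H.
Qed.

Theorem Gmac_quasisymmetric (gamma : seq nat) : quasisymmetric (Gmac n q t gamma).
Proof.
apply: quasisym_adjacent => j j' m jj' m0; rewrite /Gmac /sum_over_weak.
set M := (sumn gamma).+1.
pose v (a : {ffun 'I_n -> 'I_M}) (i : 'I_n) := val (a i).
pose z a := (v a j == 0%N) || (v a j' == 0%N).
(* If both parts are positive, the exchange would in general change [gamma]; but then both variables
   divide the term, and each of the two monomials misses one of them. *)
rewrite (bigID z) /= !mcoeffD; congr (_ + _); last first.
  rewrite !raddf_sum !big1 //= => a /andP [_ /norP [aj aj']]; apply: contraTeq isT => an.
    have := Fmac_support (f := v a) (i := j') an; rewrite lt0n aj' => /(_ isT).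
    by rewrite mnmE tpermR m0.
  by have := Fmac_support (f := v a) (i := j) an; rewrite lt0n aj m0 => /(_ isT).
pose sa (a : {ffun 'I_n -> 'I_M}) := [ffun i => a (tperm j j' i)].
have vsa a : v (sa a) = v a \o tperm j j'.
  by apply: functional_extensionality => i; rewrite /v ffunE.
rewrite -mcoeff_sym; congr (mcoeff _ _); apply/esym.
apply: (@msym_sum_involution _ _ sa) => [a|a|a /andP [Pa za]].
- by apply/ffunP => i; rewrite !ffunE tpermK.
- have zs : z (sa a) = z a by rewrite /z vsa /= tpermL tpermR orbC.
  rewrite zs; case: (boolP (z a)) => za; rewrite ?andbF ?andbT //.
  have := strongpart_swap jj' za; rewrite /sq -vsa => e.
  by rewrite -[[seq val _ | _ <- _]]/(sq (v (sa a))) /sq e.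
- have := Fmac_pair_sym (v a) jj'; rewrite -vsa; exact.
Qed.

End Quasisymmetry.

(** * Rotation of the variables *)

Section Rotation.
Variables (n : nat) (K : fieldType) (q t : K) (h : 'I_n.+1 -> nat).
Implicit Types (w : rowt n.+1) (u v : 'I_n.+1).

Definition rotp : 'S_n.+1 := perm (can_inj (@ordSK n.+1)).

Lemma rotE (i : 'I_n.+1) : rotp i = (if i == n :> nat then 0 else i.+1)%N :> nat.
Proof.
rewrite permE /=; have := ltn_ord i; rewrite ltnS leq_eqVlt.
by case: eqP => [->|_] /= H; [rewrite modnn | rewrite modn_small].
Qed.

Definition rotl (a : 'I_n.+2) : 'I_n.+2 :=
  if (insub (a : nat) : option 'I_n.+1) is Some i then lbl (rotp i) else ord_max.

Lemma rotl_lbl i : rotl (lbl i) = lbl (rotp i).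
Proof. by rewrite /rotl lblE valK. Qed.

Lemma rotl_max : rotl ord_max = ord_max.
Proof. by rewrite /rotl insubF //= ltnn. Qed.

Lemma lbl_inj m : injective (@lbl m).
Proof. by move=> a b /(congr1 val) /= /val_inj. Qed.

Lemma rotl_inj : injective rotl.
Proof.
move=> a b; case: (eqVneq a ord_max) => [->|/lblP [i ->]];
case: (eqVneq b ord_max) => [->|/lblP [k ->]]; rewrite ?rotl_max ?rotl_lbl //.
- by move=> e; have := lbl_max (rotp k); rewrite -e eqxx.
- by move=> e; have := lbl_max (rotp i); rewrite e eqxx.
- by move/lbl_inj/perm_inj ->.
Qed.

Definition rotrow w : rowt n.+1 := [ffun u => rotl (w u)].

Lemma rotrow_inj : injective rotrow.
Proof.
by move=> w w' /ffunP e; apply/ffunP => u; have := e u; rewrite !ffunE => /rotl_inj.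
Qed.

Lemma rowok_rot k w : rowok h k (rotrow w) = rowok h k w.
Proof.
rewrite /rowok; congr (_ && _); apply: eq_forallb => u.
  by rewrite ffunE -{1}rotl_max (inj_eq rotl_inj).
by apply: eq_forallb => v; rewrite !ffunE (inj_eq rotl_inj).
Qed.

Definition is_last w u : bool := w u == lbl (@ord_max n).

(** If column [u] holds the last label, this is the number of its cells above row [r]. Rotation
    turns that label into 0; the descents lost or gained make these exponents telescope from row to
    row. *)
Definition rexp r w : nat := (\sum_u is_last w u * (h u - r))%N.

(** [cyc] tests the cyclic orientation of its entries, which a cyclic shift of the labels
    preserves. *)
Lemma cyc_rot (a b c : 'I_n.+1) : cyc (rotp a) (rotp b) (rotp c) = cyc a b c.
Proof.
rewrite /cyc !rotE; have := ltn_ord a; have := ltn_ord b; have := ltn_ord c.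
by do 3!case: eqP; lia.
Qed.

Lemma desc_rot (b c : 'I_n.+1) : b != c :> nat ->
  ((rotp c < rotp b) + (b == n :> nat) = (c < b) + (c == n :> nat))%N.
Proof.
move=> ne; rewrite !rotE; have := ltn_ord b; have := ltn_ord c.
by do 2!case: eqP; lia.
Qed.

Section Step.
Variables (r : nat) (w w' : rowt n.+1).
Hypothesis (wok : rowok h r w) (wok' : rowok h r.+1 w').

Lemma low_lbl u : (r <= h u)%N -> exists i, w u = lbl i.
Proof. by move=> ru; apply: lblP; rewrite (rowok_abs _ wok) -leqNgt. Qed.

Lemma up_lbl u : (r < h u)%N -> exists i, w' u = lbl i.
Proof. by move=> ru; apply: lblP; rewrite (rowok_abs _ wok') -leqNgt. Qed.

Lemma compat_rot : compat h r (rotrow w) (rotrow w') = compat h r w w'.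
Proof.
by do 2![apply: eq_forallb => ?]; rewrite !ffunE (inj_eq rotl_inj).
Qed.

Lemma coinvr_rot : coinvr h r (rotrow w) (rotrow w') = coinvr h r w w'.
Proof.
apply: eq_bigr => u _; apply: eq_bigr => v _; rewrite !ffunE; congr (_ + _)%N.
  case: (boolP (armA h r u v)) => //= /and3P [_ hvu rv].
  have ru := leq_trans rv hvu.
  have [a ->] := up_lbl rv; have [b ->] := up_lbl ru; have [c ->] := low_lbl (ltnW ru).
  by rewrite !rotl_lbl !lblE cyc_rot.
case: (boolP (armB h r u v)) => //= /and3P [_ hvu rv].
have ru := leq_ltn_trans rv hvu.
have [a ->] := low_lbl rv; have [b ->] := up_lbl ru; have [c ->] := low_lbl (ltnW ru).
by rewrite !rotl_lbl !lblE cyc_rot.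
Qed.

Lemma cellw_rot u : (r < h u)%N ->
  cellw h r q t (rotrow w) (rotrow w') u * q ^+ (is_last w' u * (h u - r))
  = cellw h r q t w w' u * q ^+ (is_last w u * (h u - r)).
Proof.
move=> ru; rewrite /cellw !ffunE (inj_eq rotl_inj) /is_last.
case: eqP => [->|/eqP ne] //.
have [b eb] := up_lbl ru; have [c ec] := low_lbl (ltnW ru).
rewrite eb ec in ne *; rewrite !rotl_lbl !lblE !(inj_eq (@lbl_inj _)).
rewrite -![_ * q ^+ _ * q ^+ _]mulrA -!exprD -!mulnDl; congr (_ * _ ^+ (_ * _)).
by apply: desc_rot; apply: contraNneq ne => /val_inj ->.
Qed.

Lemma rexpE x k : rowok h k x -> (k == r) || (k == r.+1) ->
  rexp r x = (\sum_(u | (r < h u)%N) is_last x u * (h u - r))%N.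
Proof.
move=> _ _; rewrite /rexp [RHS]big_mkcond /=; apply: eq_bigr => u _.
by case: ltnP => //; rewrite -subn_eq0 => /eqP ->; rewrite muln0.
Qed.

Lemma Kr_rot : Kr h r q t (rotrow w) (rotrow w') * q ^+ rexp r w'
  = Kr h r q t w w' * q ^+ rexp r w.
Proof.
rewrite /Kr compat_rot coinvr_rot (rexpE wok') ?eqxx ?orbT // (rexpE wok) ?eqxx //.
rewrite !(big_morph (fun x => q ^+ x) (exprD q) (expr0 q)).
have P : \prod_(u | (r < h u)%N) cellw h r q t (rotrow w) (rotrow w') u
    * \prod_(u | (r < h u)%N) q ^+ (is_last w' u * (h u - r))
  = \prod_(u | (r < h u)%N) cellw h r q t w w' u
    * \prod_(u | (r < h u)%N) q ^+ (is_last w u * (h u - r)).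
  by rewrite -!big_split /=; apply: eq_bigr => u; exact: cellw_rot.
by rewrite ![_ * t ^+ _ * _]mulrAC -![_ * _ * \prod_(_ | _) q ^+ _]mulrA P.
Qed.

End Step.

(** [x_(i+1)] becomes [x_i], and [x_0] becomes [q] times the last variable: a cyclic relabelling
    combined with the [q]-shift of the last variable. *)
Definition rotsub : n.+1.-tuple {mpoly K[n.+1]} :=
  [tuple q ^+ ((rotp^-1)%g i == ord_max) *: 'X_((rotp^-1)%g i) | i < n.+1].

Local Notation phi p := (p \mPo rotsub).

Lemma rotsub_X i : phi ('X_(rotp i)) = q ^+ (i == ord_max) *: 'X_i.
Proof. by rewrite comp_mpolyXU nth_mktuple permK. Qed.

Lemma rotsub_xw w : phi (xw K (rotrow w)) = q ^+ (\sum_u is_last w u)%N *: xw K w.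
Proof.
rewrite /xw rmorph_prod (big_morph (fun x => q ^+ x) (exprD q) (expr0 q)) -scaler_prod.
apply: eq_bigr => u _; rewrite ffunE /is_last.
case: (eqVneq (w u) ord_max) => [->|/lblP [i ->]].
  by rewrite rotl_max Xl_max /= comp_mpoly1 eq_sym (negbTE (lbl_max _)) expr0 scale1r.
by rewrite rotl_lbl !Xl_lbl /= rotsub_X (inj_eq (@lbl_inj _)).
Qed.

(** The exponent [rexp r w'] left over by [Kr_rot] splits into the [q] from the substituted monomial
    of row [r + 1] and the exponent for the rows above it. *)
Theorem Zrow_rot k r w : rowok h r w -> (forall u, h u <= r + k)%N ->
  phi (Zrow h q t k r (rotrow w)) = q ^+ rexp r w *: Zrow h q t k r w.
Proof.
elim: k r w => [|k IH] r w wok hr /=.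
  rewrite comp_mpoly1 /rexp big1 ?expr0 ?scale1r // => u _.
  by have := hr u; rewrite addn0 -subn_eq0 => /eqP ->; rewrite muln0.
rewrite (reindex_inj rotrow_inj) raddf_sum scaler_sumr /=.
apply: eq_big => w'; rewrite rowok_rot // => wok'.
rewrite comp_mpolyZ rmorphM /= rotsub_xw IH //; last by move=> u; rewrite addSnnS.
rewrite -scalerAl -scalerAr !scalerA.
congr (_ *: _); rewrite [RHS]mulrC -(Kr_rot wok wok') -[LHS]mulrA -exprD; congr (_ * q ^+ _).
rewrite /rexp -big_split /=; apply: eq_bigr => u _; rewrite /is_last.
case: eqP => [e|_]; last by rewrite !mul0n.
have : (w' u != ord_max) by rewrite e lbl_max.
by rewrite (rowok_abs _ wok') -leqNgt => ru; rewrite !mul1n add1n subnSK.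
Qed.

End Rotation.

Theorem Fmac_rot n (K : fieldType) (q t : K) (f : 'I_n.+1 -> nat) :
  t != 0 -> (2%:R : K) != 0 -> (forall a b : nat, 1 - q ^+ a.+1 * t ^+ b.+1 != 0) ->
  Fmac n.+1 q t (sq (f \o (rotp n)^-1%g)) \mPo rotsub n q
  = q ^+ f ord_max *: Fmac n.+1 q t (sq f).
Proof.
move=> t0 two0 den0; have [beta H] := basement_exists f.
have H' i : (f \o (rotp n)^-1%g) ((beta * rotp n)%g i) = hinc (f \o (rotp n)^-1%g) i.
  by rewrite hinc_perm /= permM permK H.
rewrite (Fmac_basement t0 two0 den0 H) (Fmac_basement t0 two0 den0 H') hinc_perm sumn_perm.
have -> : brow (beta * rotp n)%g = rotrow (brow beta).
  by apply/ffunP => u; rewrite !ffunE rotl_lbl permM.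
rewrite Zrow_rot ?rowok_brow //; last by move=> u; rewrite add0n hinc_le.
congr (q ^+ _ *: _); rewrite /rexp (bigD1 ((beta^-1)%g ord_max)) //= big1 => [|u ub].
  by rewrite /is_last ffunE permKV eqxx mul1n subn0 -H permKV addn0.
rewrite /is_last ffunE (inj_eq (@lbl_inj _)).
by rewrite -(inj_eq (@perm_inj _ (beta^-1)%g)) permK (negbTE ub).
Qed.

(** * Leading monomials and dominance *)

Section Leading.
Variables (n : nat) (K : fieldType) (q t : K) (h : 'I_n -> nat).
Hypothesis hs : nondec h.
Implicit Types (w : rowt n) (u v i : 'I_n).

Definition hrev i : nat := h (rev_ord i).

Lemma lam_anti i i' : (i <= i')%N -> (hrev i' <= hrev i)%N.
Proof. by move=> ii; apply: hs => /=; rewrite leq_sub2l. Qed.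

Definition haslab w i : bool := [exists u, w u == lbl i].

Lemma mrowE k w i : rowok h k w -> mrow w i = haslab w i :> nat.
Proof.
move=> wok; rewrite mnmE; case: (boolP (haslab w i)) => [/existsP [u /eqP wu]|].
  rewrite (bigD1 u) //= wu eqxx big1 // => v vu; apply/eqP; rewrite eqb0.
  apply: contraNneq vu => wv; apply/eqP; apply: (rowok_inj wok); first by rewrite wu.
  by rewrite wv lbl_max.
rewrite negb_exists => /forallP H; rewrite big1 // => u _.
by rewrite (negbTE (H u)).
Qed.

Lemma card_lam r : (\sum_i (r < hrev i : nat) = \sum_u (r < h u : nat))%N.
Proof. by rewrite [RHS](reindex_inj rev_ord_inj). Qed.

Lemma sum_mrow k w : rowok h k w -> (\sum_i mrow w i = \sum_u (k <= h u))%N.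
Proof.
move=> wok; under eq_bigr do rewrite mnmE.
rewrite exchange_big /=; apply: eq_bigr => u _.
case: (leqP k (h u)) => ku.
  have /lblP [i ->] : w u != ord_max by rewrite (rowok_abs _ wok) -leqNgt.
  rewrite (bigD1 i) //= eqxx big1 // => i' i'i; apply/eqP; rewrite eqb0.
  by apply: contraNneq i'i => /(congr1 val) /= /val_inj ->.
have /eqP -> : w u == ord_max by rewrite (rowok_abs _ wok).
by rewrite big1 // => i _; rewrite eq_sym (negbTE (lbl_max _)).
Qed.

(** Row [r + 1] carries as many labels as columns reach it, which is the number of parts exceeding
    [r]; so the inclusion of label sets is an equality. *)
Lemma haslab_full r w : rowok h r.+1 w -> (forall i, haslab w i -> (r < hrev i)%N) ->
  forall i, haslab w i = (r < hrev i)%N.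
Proof.
move=> wok sub i.
have E : (\sum_i ((r < hrev i) - haslab w i) = 0)%N.
  rewrite sumnB => [|k _]; last by case: (boolP (haslab w k)) => // /sub ->.
  rewrite card_lam; under [X in (_ - X)%N]eq_bigr do rewrite -(mrowE _ wok).
  by rewrite (sum_mrow wok) subnn.
move/eqP: E; rewrite sum_nat_eq0 => /forallP /(_ i) /=.
by case: (boolP (haslab w i)) => [/sub ->|] //=; case: (r < hrev i)%N.
Qed.

Definition mres r : 'X_{1..n} := [multinom (hrev i - r)%N | i < n].

Definition good w : bool := [forall u, forall i, (w u == lbl i) ==> (hrev i == h u)].

Definition rcopy r w : rowt n := [ffun u => if (r < h u)%N then w u else ord_max].

Section Step.
Variables (r : nat) (w : rowt n).
Hypothesis wok : rowok h r w.

Lemma rcopy_ok : rowok h r.+1 (rcopy r w).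
Proof.
apply/andP; split; apply/forallP => u.
  rewrite ffunE ltnS; case: (ltnP r (h u)) => ru; last by rewrite eqxx.
  by rewrite (rowok_abs _ wok) ltnNge (ltnW ru).
apply/forallP => v; rewrite !ffunE ltnS; apply/implyP => /andP [uv].
case: (ltnP r (h u)) => // ru; have nm : w u != ord_max.
  by rewrite (rowok_abs _ wok) -leqNgt ltnW.
case: ifP => _ /eqP e; last by rewrite e eqxx in nm.
by rewrite (rowok_inj wok e nm) eqxx in uv.
Qed.

Lemma rcopy_compat : compat h r w (rcopy r w).
Proof.
apply/forallP => u; apply/forallP => v; apply/implyP => /andP [uv rv].
rewrite ffunE rv; have ne : v != u by rewrite neq_ltn uv orbT.
exact: (low_ne wok ne (ltnW rv)).
Qed.

Lemma cyc_diag (a c : nat) : cyc a c c = false.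
Proof. by rewrite /cyc; lia. Qed.

Lemma rcopy_Kr : Kr h r q t w (rcopy r w) = 1.
Proof.
rewrite /Kr rcopy_compat mul1r big1 => [|u ru]; last by rewrite /cellw ffunE ru eqxx.
rewrite mul1r /coinvr big1 // => u _; rewrite big1 // => v _; rewrite ffunE.
have -> : rcopy r w u = if (r < h u)%N then w u else ord_max by rewrite ffunE.
case: (boolP (armA h r u v)) => [/and3P [_ vu rv]|_] /=.
  rewrite (leq_trans rv vu) cyc_diag /=; case: (boolP (armB h r u v)) => //= _.
  by rewrite cyc_diag.
case: (boolP (armB h r u v)) => [/and3P [_ vu rv]|_] //=.
by rewrite (leq_ltn_trans rv vu) cyc_diag.
Qed.

Hypothesis wlab : forall i, haslab w i = (r <= hrev i)%N.

Lemma rcopy_unique w' : rowok h r.+1 w' -> compat h r w w' -> (mrow w' <= mres r)%MM ->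
  w' = rcopy r w.
Proof.
move=> wok' cww /mnm_lepP le.
have lab i : haslab w' i = (r < hrev i)%N.
  apply: (haslab_full wok') => k kl; have := le k.
  by rewrite (mrowE _ wok') kl mnmE subn_gt0.
have C := row_copy hs wok' cww; apply/ffunP => u; rewrite ffunE.
case: (ltnP r (h u)) => ru; last by apply/eqP; rewrite (rowok_abs _ wok') ltnS.
apply: C => // v rv.
have /lblP [i ei] : w' v != ord_max by rewrite (rowok_abs _ wok') -leqNgt.
have : haslab w i.
  by rewrite wlab ltnW // -lab; apply/existsP; exists v; rewrite ei.
by case/existsP => x /eqP wx; exists x; rewrite wx ei.
Qed.

(** A label whose column ends at row [r] is missing from the copy. Once the copy is known to carry
    exactly the labels with part above [r], the part of the missing label must be [r]. *)
Lemma good_rcopy : (mrow (rcopy r w) <= mres r)%MM && good (rcopy r w) = good w.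
Proof.
apply/andP/idP => [[/mnm_lepP le /forallP g]|/forallP g]; last first.
  split; last first.
    apply/forallP => u; apply/forallP => i; rewrite ffunE.
    case: ifP => _; last by rewrite eq_sym (negbTE (lbl_max _)).
    exact: (forallP (g u) i).
  apply/mnm_lepP => i; rewrite (mrowE _ rcopy_ok) mnmE.
  case: (boolP (haslab _ i)) => // /existsP [u]; rewrite ffunE.
  case: ifP => [ru e|_]; last by rewrite eq_sym (negbTE (lbl_max _)).
  by have := forallP (g u) i; rewrite e /= => /eqP ->; rewrite subn_gt0.
have lab i : haslab (rcopy r w) i = (r < hrev i)%N.
  apply: (haslab_full rcopy_ok) => k kl; have := le k.
  by rewrite (mrowE _ rcopy_ok) kl mnmE subn_gt0.
apply/forallP => u; apply/forallP => i; apply/implyP => /eqP wu.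
have [ru|ur] := ltnP r (h u).
  by have := forallP (g u) i; rewrite ffunE ru wu eqxx.
have ru : (r <= h u)%N by rewrite leqNgt -(rowok_abs _ wok) wu lbl_max.
have -> : h u = r by apply/eqP; rewrite eqn_leq ur.
have ri : (r <= hrev i)%N by rewrite -wlab; apply/existsP; exists u; rewrite wu.
rewrite eqn_leq ri andbT leqNgt -lab; apply/existsP => -[v]; rewrite ffunE.
case: ifP => [rv /eqP wv|_]; last by rewrite eq_sym (negbTE (lbl_max _)).
have e : v = u by apply: (rowok_inj wok); rewrite wv ?wu ?lbl_max.
by rewrite e ltnNge ur in rv.
Qed.

End Step.

(** At the leading exponent every row must use all labels whose part reaches it; then only the copy
    of the row below is possible, with weight 1. The chain of copies has the right monomial exactly
    when each label stands in a column as high as its part. *)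
Theorem Zrow_lead k r w : rowok h r w -> (forall u, h u <= r + k)%N ->
  (forall i, haslab w i = (r <= hrev i)%N) ->
  (Zrow h q t k r w)@_(mres r) = (good w)%:R.
Proof.
elim: k r w => [|k IH] r w wok hr wlab /=.
  have hr0 u : (h u <= r)%N by have := hr u; rewrite addn0.
  have -> : mres r = 0%MM.
    by apply/mnmP => i; rewrite !mnmE; apply/eqP; rewrite subn_eq0; exact: hr0.
  rewrite mcoeff1 eqxx; suff -> : good w by [].
  apply/forallP => u; apply/forallP => i; apply/implyP => /eqP wu.
  have ru : (r <= h u)%N by rewrite leqNgt -(rowok_abs _ wok) wu lbl_max.
  have ri : (r <= hrev i)%N by rewrite -wlab; apply/existsP; exists u; rewrite wu.
  by rewrite eqn_leq (leq_trans (hr0 _) ru) (leq_trans (hr0 _) ri).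
have ok1 := rcopy_ok wok.
rewrite (bigD1 (rcopy r w)) //= mcoeffD raddf_sum big1 => [|w' /andP [wok' ne]]; last first.
  rewrite /= mcoeffZ xw_mrow mcoeffXM.
  case: ifP => le; last by rewrite mulr0.
  case: (boolP (compat h r w w')) => cww; last by rewrite /Kr (negbTE cww) !mul0r.
  by rewrite (rcopy_unique wlab wok' cww le) eqxx in ne.
rewrite addr0 mcoeffZ rcopy_Kr // mul1r xw_mrow mcoeffXM -(good_rcopy wok wlab).
case: ifP => [le|_] //=.
have lab i : haslab (rcopy r w) i = (r < hrev i)%N.
  apply: (haslab_full ok1) => j jl; have := mnm_lepP le j.
  by rewrite (mrowE _ ok1) jl mnmE subn_gt0.
have -> : (mres r - mrow (rcopy r w))%MM = mres r.+1.
  apply/mnmP => i; rewrite mnmBE (mrowE _ ok1) lab !mnmE.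
  by case: ltnP => ri; lia.
by apply: IH => // u; rewrite addSnnS.
Qed.

(** Dominance for a single row: either the first [#|I|] parts all exceed [r], and the bound is
    [#|I|], or all parts exceeding [r] are among them, and the bound is the size of the row. *)
Lemma sum_prefix r (I : {set 'I_n}) (b : 'I_n -> bool) :
  (\sum_i b i <= \sum_i (r < hrev i : nat))%N ->
  (\sum_(i in I) b i <= \sum_(i < n | (i < #|I|)%N) (r < hrev i : nat))%N.
Proof.
move=> bl; case: (boolP [forall i : 'I_n, (i < #|I|)%N ==> (r < hrev i)%N]) => [/forallP H|].
  rewrite [X in (_ <= X)%N](eq_bigr (fun _ => 1%N)); last by move=> i /(implyP (H i)) ->.
  have In : (#|I| <= n)%N by rewrite -[X in (_ <= X)%N]card_ord; exact: max_card.
  rewrite -(big_ord_widen n (fun => 1%N) In) sum_nat_const card_ord muln1 -sum1_card.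
  by apply: leq_sum => i _; case: (b i).
rewrite negb_forall => /existsP [i0]; rewrite negb_imply -leqNgt => /andP [i0I li0].
apply: (@leq_trans (\sum_i b i)); first by rewrite big_mkcond; apply: leq_sum => i _; case: ifP.
apply: (leq_trans bl); rewrite [X in (_ <= X)%N]big_mkcond /=.
apply: leq_sum => i _; case: ifP => // /negbT; rewrite -leqNgt => Ii.
by rewrite ltnNge (leq_trans (lam_anti (leq_trans (ltnW i0I) Ii)) li0).
Qed.

Theorem Zrow_dom k r w (m : 'X_{1..n}) : (forall u, h u <= r + k)%N ->
  (Zrow h q t k r w)@_m != 0 ->
  (\sum_i m i = \sum_i (hrev i - r))%N /\
  forall I : {set 'I_n}, (\sum_(i in I) m i <= \sum_(i < n | (i < #|I|)%N) (hrev i - r))%N.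
Proof.
elim: k r w m => [|k IH] r w m hr /=.
  rewrite mcoeff1; case: (eqVneq m 0%MM) => [->|_]; last by rewrite eqxx.
  move=> _; split; last by move=> I; rewrite big1 // => i _; rewrite mnmE.
  rewrite big1 => [|i _]; last by rewrite mnmE.
  rewrite big1 // => i _; apply/eqP; rewrite subn_eq0.
  by have := hr (rev_ord i); rewrite addn0.
rewrite raddf_sum => nz.
have [w' wok' ] : exists2 w', rowok h r.+1 w' &
    (mrow w' <= m)%MM && ((Zrow h q t k r.+1 w')@_(m - mrow w') != 0).
  move: nz; case: (boolP [exists w', rowok h r.+1 w' &&
    ((mrow w' <= m)%MM && ((Zrow h q t k r.+1 w')@_(m - mrow w') != 0))]).
    by case/existsP => w' /andP [a b] _; exists w'.
  rewrite negb_exists => /forallP H; rewrite big1 ?eqxx // => w' wok'.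
  have := H w'; rewrite wok' /= mcoeffZ xw_mrow mcoeffXM; case: ifP => _ /=.
    by rewrite negbK => /eqP ->; rewrite mulr0.
  by rewrite mulr0.
case/andP => /mnm_lepP le nz'; have [] := IH r.+1 w' _ _ nz'.
  by move=> u; rewrite addSnnS.
move=> E1 E2.
have me i : m i = (mrow w' i + (m - mrow w')%MM i)%N by rewrite mnmBE subnKC.
have le' i : (hrev i - r = (r < hrev i) + (hrev i - r.+1))%N by case: ltnP; lia.
have tot : (\sum_i haslab w' i = \sum_i (r < hrev i : nat))%N.
  by rewrite card_lam -(sum_mrow wok'); apply: eq_bigr => i _; rewrite (mrowE _ wok').
split.
  rewrite (eq_bigr _ (fun i _ => me i)) [RHS](eq_bigr _ (fun i _ => le' i)) !big_split /=.
  rewrite E1; congr (_ + _)%N; rewrite -tot.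
  by apply: eq_bigr => i _; rewrite (mrowE _ wok').
move=> I; rewrite (eq_bigr _ (fun i _ => me i)) [X in (_ <= X)%N](eq_bigr _ (fun i _ => le' i)).
rewrite !big_split /=; apply: leq_add; last exact: E2.
under eq_bigr do rewrite (mrowE _ wok').
by apply: sum_prefix; rewrite tot.
Qed.

End Leading.

(** * Antisymmetrization and the operator D^1 *)

Section Shift.
Variables (n : nat) (K : fieldType).
Implicit Types (p : {mpoly K[n]}) (i : 'I_n) (c : K) (w : 'S_n).

Lemma mcoeff_Tshift c i p m : (Tshift c i p)@_m = p@_m * c ^+ m i.
Proof.
rewrite /Tshift raddf_sum /=.
under eq_bigr do rewrite mcoeffZ mcoeffX.
case: (boolP (m \in msupp p)) => mp.
  rewrite (bigD1_seq m) ?msupp_uniq //= eqxx mulr1 big1 ?addr0 // => k /negbTE ->.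
  by rewrite mulr0.
rewrite (memN_msupp_eq0 mp) mul0r big1_seq // => k /= kp.
by case: eqP => [e|]; [rewrite -e kp in mp | rewrite mulr0].
Qed.

Definition Tsub c i : n.-tuple {mpoly K[n]} := [tuple c ^+ (k == i) *: 'X_k | k < n].

Lemma TshiftE c i p : Tshift c i p = p \mPo Tsub c i.
Proof.
rewrite comp_mpolyE /Tshift; apply: eq_bigr => m _; rewrite -scalerA; congr (_ *: _).
rewrite (bigD1 i) //= tnth_mktuple eqxx expr1 exprZn -scalerAl; congr (_ *: _).
rewrite mpolyXE_id (bigD1 i) //=; congr (_ * _); apply: eq_bigr => k /negbTE ki.
by rewrite tnth_mktuple ki expr0 scale1r.
Qed.

Lemma msym_Tshift c i p w : msym w (Tshift c i p) = Tshift c (w i) (msym w p).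
Proof.
apply/mpolyP => m; rewrite mcoeff_sym !mcoeff_Tshift mcoeff_sym; congr (_ * c ^+ _).
by rewrite mnmE.
Qed.

Lemma TshiftM c i p r : Tshift c i (p * r) = Tshift c i p * Tshift c i r.
Proof. by rewrite !TshiftE rmorphM. Qed.

Lemma TshiftX c i k : Tshift c i ('X_k) = c ^+ (k == i) *: ('X_k : {mpoly K[n]}).
Proof. by rewrite TshiftE comp_mpolyXU nth_mktuple. Qed.

Definition mdelta : 'X_{1..n} := [multinom (n.-1 - i)%N | i < n].

Lemma adelta_msym : adelta n K = \sum_(w : 'S_n) (-1) ^+ odd_perm w *: msym w 'X_[mdelta].
Proof.
apply: eq_bigr => w _; congr (_ *: _); rewrite mpolyXE_id rmorph_prod.
by apply: eq_bigr => i _; rewrite rmorphXn /= msymXU mnmE.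
Qed.

Lemma msym_alt_sum (G : {group 'S_n}) w p : w \in G ->
  msym w (\sum_(v in G) (-1) ^+ odd_perm v *: msym v p)
  = (-1) ^+ odd_perm w *: \sum_(v in G) (-1) ^+ odd_perm v *: msym v p.
Proof.
move=> wG; rewrite raddf_sum scaler_sumr /= [RHS](reindex_inj (mulIg w)) /=.
apply: eq_big => v; first by rewrite groupMr.
move=> _; rewrite msymZ -msymMm scalerA odd_permM addbC signr_addb mulrA.
by rewrite -signr_addb addbb mul1r.
Qed.

Lemma msym_adelta w : msym w (adelta n K) = (-1) ^+ odd_perm w *: adelta n K.
Proof.
rewrite adelta_msym -(eq_bigl _ _ (fun v => in_setT v)).
exact: (msym_alt_sum (G := [set: 'S_n]%G) _ (in_setT w)).
Qed.

Lemma adelta_support m : (adelta n K)@_m != 0 -> exists w : 'S_n, forall i, m i = mdelta (w i).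
Proof.
rewrite adelta_msym raddf_sum /= => nz.
have [w] : exists w : 'S_n, (msym w ('X_[mdelta] : {mpoly K[n]}))@_m != 0.
  apply/existsP; apply: contraR nz; rewrite negb_exists => /forallP H.
  rewrite big1 ?eqxx // => w _; rewrite mcoeffZ.
  by have /negPn/eqP e := H w; rewrite e mulr0.
rewrite msymX mcoeffX; case: (_ =P m) => [<-|_]; last by rewrite eqxx.
by move=> _; exists (w^-1)%g => i; rewrite mnmE.
Qed.

(** Every monomial of [adelta] has the exponents [0, ..., n - 1] in some order, so all are
    eigenvectors with the same eigenvalue. *)
Lemma sum_Tshift_adelta c :
  \sum_(i < n) Tshift c i (adelta n K) = (\sum_(i < n) c ^+ i) *: adelta n K.
Proof.
apply/mpolyP => m; rewrite raddf_sum mcoeffZ /=.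
under eq_bigr do rewrite mcoeff_Tshift.
rewrite -mulr_sumr mulrC; case: (eqVneq ((adelta n K)@_m) 0) => [->|/adelta_support [w H]].
  by rewrite !mulr0.
congr (_ * _).
rewrite (eq_bigr (fun i => c ^+ mdelta (w i))); last by move=> i _; rewrite H.
rewrite [LHS](reindex_inj (@perm_inj _ (w^-1)%g)) [RHS](reindex_inj rev_ord_inj) /=.
apply: eq_bigr => i _; rewrite permKV mnmE /=; congr (c ^+ _).
by case: n i => [[]|k] i //=; rewrite subSS.
Qed.

Definition Vdm : {mpoly K[n]} := \prod_(j < n) \prod_(i < n | (i < j)%N) ('X_j - 'X_i).

Lemma adelta_Vdm : exists b : bool, adelta n K = (-1) ^+ b *: Vdm.
Proof.
pose A : 'M[{mpoly K[n]}]_n := Vandermonde n (\row_j 'X_j).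
pose s : 'S_n := perm rev_ord_inj.
exists (odd_perm s).
have -> : Vdm = \det A.
  rewrite det_Vandermonde /Vdm (exchange_big_dep xpredT) //=.
  by apply: eq_bigr => i _; apply: eq_bigr => j _; rewrite !mxE.
have -> : (-1) ^+ odd_perm s *: \det A = \det (row_perm s A).
  by rewrite row_permE det_mulmx det_perm -mul_mpolyC rmorphXn rmorphN rmorph1.
rewrite /determinant /adelta; apply: eq_bigr => w _.
rewrite -mul_mpolyC rmorphXn rmorphN rmorph1; congr (_ * _).
apply: eq_bigr => i _; rewrite !mxE permE /=; congr (_ ^+ _).
by case: n i => [[]|k] i //=; rewrite subSS.
Qed.

End Shift.

Lemma sum_lt N j : (j <= N)%N -> (\sum_(k < N | (k < j)%N) 1)%N = j.
Proof. by move=> jN; rewrite -(big_ord_widen N (fun => 1%N) jN) sum_nat_const card_ord muln1. Qed.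

Section Symmetrizer.
Variables (n : nat) (K : fieldType) (t : K).
Hypothesis t0 : t != 0.
Hypothesis two0 : (2%:R : K) != 0.
Hypothesis tpow : forall k, t ^+ k.+1 != 1.
Implicit Types (p g f : {mpoly K[n.+1]}) (i j : 'I_n.+1) (v w : 'S_n.+1) (m : 'X_{1..n.+1}).

Local Notation last := (@ord_max n).
Local Notation S' := 'C[last | 'P]%g.

Lemma stab_last v : (v \in S') = (v last == last).
Proof. by apply/astab1P/eqP. Qed.

(** At [c = t] the product [Ck] is the kernel of the functional, at [c = 1] the Vandermonde product.
    The factors with the last variable are kept apart in [Bk], which the stabilizer of that variable
    fixes. *)
Definition ker1 (c : K) i j : {mpoly K[n.+1]} := c *: 'X_j - 'X_i.
Definition Ck c := \prod_(j < n.+1) \prod_(i < n.+1 | (i < j)%N) ker1 c i j.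
Definition Ckp c := \prod_(j < n.+1 | j != last) \prod_(i < n.+1 | (i < j)%N) ker1 c i j.
Definition Bk c := \prod_(i < n.+1 | i != last) ker1 c i last.

Lemma Ck_split c : Ck c = Bk c * Ckp c.
Proof.
rewrite /Ck (bigD1 last) //=; congr (_ * _); apply: eq_bigl => i.
by rewrite -val_eqE /= ltn_neqAle -ltnS ltn_ord andbT.
Qed.

Lemma msym_ker1 w c i j : msym w (ker1 c i j) = ker1 c (w i) (w j).
Proof. by rewrite /ker1 msymB msymZ !msymXU. Qed.

Lemma msym_Bk v c : v \in S' -> msym v (Bk c) = Bk c.
Proof.
rewrite stab_last => /eqP vl; rewrite rmorph_prod [RHS](reindex_inj (@perm_inj _ v)) /=.
apply: eq_big => i; first by rewrite -{2}vl (inj_eq perm_inj).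
by rewrite msym_ker1 vl.
Qed.

Lemma ker1_neq0 c i j : i != j -> c != 0 -> ker1 c i j != 0.
Proof.
move=> ij c0; apply/eqP => /(congr1 (fun p => p@_(U_(j)))) /eqP.
rewrite /ker1 mcoeffB mcoeffZ !mcoeffXU eqxx (negbTE ij) mcoeff0 subr0 mulr1.
by rewrite (negbTE c0).
Qed.

Lemma Vdm_Ck : Vdm n.+1 K = Ck 1.
Proof. by apply: eq_bigr => j _; apply: eq_bigr => i _; rewrite /ker1 scale1r. Qed.

Lemma msym_Vdm w : msym w (Ck 1) = (-1) ^+ odd_perm w *: Ck 1.
Proof.
have [b e] := adelta_Vdm n.+1 K; have := msym_adelta K w.
rewrite e msymZ Vdm_Ck scalerA mulrC -scalerA => /scalerI -> //.
by rewrite expf_neq0 // oppr_eq0 oner_neq0.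
Qed.

Lemma Bk1_neq0 : Bk 1 != 0.
Proof.
rewrite /Bk prodf_seq_neq0; apply/allP => i _; apply/implyP => il.
by rewrite ker1_neq0 ?oner_neq0.
Qed.

Lemma Ckp1_neq0 : Ckp 1 != 0.
Proof.
rewrite /Ckp prodf_seq_neq0; apply/allP => j _; apply/implyP => _.
rewrite prodf_seq_neq0; apply/allP => i _; apply/implyP => ij.
by rewrite ker1_neq0 ?oner_neq0 // neq_ltn ij.
Qed.

Lemma msym_Ckp1 v : v \in S' -> msym v (Ckp 1) = (-1) ^+ odd_perm v *: Ckp 1.
Proof.
move=> vS; apply: (mulfI Bk1_neq0); rewrite -{1}(msym_Bk 1 vS) -msymM -scalerAr.
by rewrite -Ck_split msym_Vdm.
Qed.

Definition degle (d : 'I_n.+1 -> nat) p := forall m, p@_m != 0 -> forall i, (m i <= d i)%N.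

Lemma degleM d1 d2 p1 p2 : degle d1 p1 -> degle d2 p2 ->
  degle (fun i => d1 i + d2 i)%N (p1 * p2).
Proof.
move=> D1 D2 m; rewrite -mcoeff_msupp => /msuppM_le /allpairsP [[m1 m2] /= [s1 s2 ->]] i.
by rewrite mnmDE leq_add ?D1 ?D2 // -mcoeff_msupp.
Qed.

Lemma degle_prod (I : Type) (r : seq I) (P : pred I) (d : I -> 'I_n.+1 -> nat)
    (F : I -> {mpoly K[n.+1]}) : (forall k, P k -> degle (d k) (F k)) ->
  degle (fun i => \sum_(k <- r | P k) d k i)%N (\prod_(k <- r | P k) F k).
Proof.
move=> H; elim: r => [|k r IH].
  rewrite big_nil => m; rewrite mcoeff1; case: (m =P 0%MM) => [-> _ i|]; last by rewrite eqxx.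
  by rewrite mnmE.
rewrite big_cons; case: ifP => Pk; last first.
  by move=> m mn i; rewrite big_cons Pk; exact: IH.
move=> m mn i; rewrite big_cons Pk; exact: (degleM (H k Pk) IH mn).
Qed.

Lemma degle_ker1 c i j : degle (fun k => (k == i) + (k == j))%N (ker1 c i j).
Proof.
move=> m; rewrite /ker1 mcoeffB mcoeffZ !mcoeffX => nz k.
have : (U_(j)%MM == m) || (U_(i)%MM == m).
  by move: nz; case: (_ == m); case: (_ == m); rewrite //= !mulr0 subrr eqxx.
case/orP => /eqP <-; rewrite mnmE eq_sym; first exact: leq_addl.
exact: leq_addr.
Qed.

Lemma degle_Ckp c : degle (fun i => if i == last then 0 else n.-1)%N (Ckp c).
Proof.
move=> m mn i; have D : degle (fun i => \sum_(j < n.+1 | j != last) \sum_(k < n.+1 | (k < j)%N)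
    ((i == k) + (i == j)))%N (Ckp c).
  by apply: degle_prod => j _; apply: degle_prod => k _; exact: degle_ker1.
apply: leq_trans (D m mn i) _; case: eqP => [->|/eqP il].
  rewrite big1 // => j jl; rewrite big1 // => k kj.
  rewrite eq_sym [last == j]eq_sym (negbTE jl); apply/eqP; rewrite addn0 eqb0.
  by rewrite -val_eqE /= neq_ltn (leq_trans kj) // -ltnS.
have lastlt (j k : 'I_n.+1) : (j < k)%N -> j != last.
  move=> jk; have kn : (k <= n)%N by rewrite -ltnS.
  by rewrite -val_eqE /= neq_ltn (leq_trans jk kn).
have E : (\sum_(j < n.+1 | j != last) \sum_(k < n.+1 | (k < j)%N) ((i == k) + (i == j))
    = \sum_(j < n.+1 | j != last) ((i < j) + (j < i)))%N.
  transitivity (\sum_(j < n.+1 | j != last) ((i < j) + (j == i) * i))%N.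
    apply: eq_bigr => j jl; rewrite big_split /= ; congr (_ + _)%N.
      rewrite big_mkcond (bigD1 i) //= eqxx big1 ?addn0; first by case: (i < j)%N.
      by move=> k /negbTE ki; rewrite eq_sym ki if_same.
    rewrite (eq_bigr (fun _ => (i == j) * 1)%N) -?big_distrr /= ?sum_lt ?(ltnW (ltn_ord j)) //.
      by rewrite eq_sym; case: eqP => [->|].
    by move=> k _; rewrite muln1.
  rewrite !big_split /=; congr (_ + _)%N.
  rewrite (bigD1 i) //= eqxx mul1n big1 ?addn0 => [|j /andP [_ /negbTE ->]] //.
  rewrite -[LHS](@sum_lt n.+1) ?(ltnW (ltn_ord i)) // big_mkcond [RHS]big_mkcond /=.
  apply: eq_bigr => j _; case: (boolP (j < i)%N) => ji; last by rewrite if_same.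
  by rewrite (lastlt _ _ ji).
rewrite E; apply: (@leq_trans (\sum_(j < n.+1 | (j != last) && (j != i)) 1)%N).
  rewrite big_mkcond [X in (_ <= X)%N]big_mkcond /=; apply: leq_sum => j _.
  case: (j != last) => //=; case: (ltngtP i j) => [ij|ji|/val_inj ->]; last by rewrite eqxx.
    by rewrite -val_eqE /= neq_ltn ij orbT.
  by rewrite -val_eqE /= neq_ltn ji.
rewrite sum1_card (@eq_card _ _ [predC pred2 last i]) => [|j]; last first.
  by rewrite !inE negb_or.
have := cardC (pred2 last i); rewrite card2 eq_sym il card_ord /= add2n => -[e].
by rewrite -[X in (_ <= X.-1)%N]e.
Qed.

End Symmetrizer.

Section Alternating.
Variables (n : nat) (K : fieldType).
Hypothesis two0 : (2%:R : K) != 0.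
Implicit Types (p g f A B : {mpoly K[n.+1]}) (i j : 'I_n.+1) (v w : 'S_n.+1) (m : 'X_{1..n.+1}).

Local Notation last := (@ord_max n).
Local Notation S' := 'C[last | 'P]%g.
Local Notation dd := (fun i : 'I_n.+1 => if i == last then 0 else n.-1)%N.

Definition altern A := forall v, v \in S' -> msym v A = (-1) ^+ odd_perm v *: A.

Lemma degle_msym (d : 'I_n.+1 -> nat) p v : (forall i, d (v i) = d i) -> degle d p -> degle d (msym v p).
Proof.
move=> dv D m; rewrite mcoeff_sym => /D H i; have := H ((v^-1)%g i).
by rewrite mnmE permKV -dv permKV.
Qed.

Definition dlt : 'X_{1..n.+1} := [multinom (if i == last then 0 else i)%N | i < n.+1].

(** Alternation makes the exponents of the first [n] variables distinct, and the degree bound puts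
    them below [n], so they are [0, ..., n - 1] in some order. Such polynomials therefore form a
    space of dimension at most one. *)
Lemma altern_support A m : altern A -> degle dd A -> A@_m != 0 ->
  exists2 v, v \in S' & m = [multinom dlt (v i) | i < n.+1].
Proof.
move=> alt D nz; have le := D m nz.
have inj i k : i != last -> k != last -> m i = m k -> i = k.
  move=> il kl e; apply/eqP; apply: contraNT nz => ik.
  have tS : tperm i k \in S' by rewrite stab_last tpermD.
  have := congr1 (mcoeff m) (alt _ tS); rewrite mcoeff_sym mcoeffZ odd_tperm ik expr1 mulN1r.
  have -> : [multinom m (tperm i k l) | l < n.+1] = m.
    by apply/mnmP => l; rewrite mnmE; case: tpermP => [->|->|].
  move/eqP; rewrite -subr_eq0 opprK -mulr2n -mulr_natl mulf_eq0 (negbTE two0) /=.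
  by [].
have lt i : i != last -> (m i < n)%N.
  move=> il; have := le i; rewrite (negbTE il) => mi.
  have n0 : (0 < n)%N.
    move: il; rewrite -val_eqE /= => il; have := ltn_ord i.
    by rewrite ltnS leq_eqVlt (negbTE il) /=; exact: leq_trans.
  by rewrite (leq_ltn_trans mi) // prednK.
pose fv i : 'I_n.+1 := if i == last then last else inord (m i).
have fv_last i : (fv i == last) = (i == last).
  rewrite /fv; case: ifP => [_|/negbT il]; first by rewrite eqxx.
  by rewrite -val_eqE /= inordK ?ltnS ?(ltnW (lt i il)) // ltn_eqF // lt.
have fvI : injective fv.
  move=> i k e; have := fv_last i; rewrite e fv_last => ik.
  case: (eqVneq i last) ik => [->|il] ik; first by apply/esym/eqP; rewrite ik.
  have kl : k != last by rewrite ik.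
  move: e; rewrite /fv (negbTE il) (negbTE kl) => /(congr1 val) /=.
  by rewrite !inordK ?ltnS ?(ltnW (lt _ _)) //; exact: inj.
exists (perm fvI); first by rewrite stab_last permE fv_last.
apply/mnmP => i; rewrite !mnmE permE fv_last; case: ifP => [/eqP ->|/negbT il].
  by apply/eqP; rewrite -leqn0; have := le last; rewrite eqxx.
by rewrite /fv (negbTE il) inordK // ltnS ltnW // lt.
Qed.

Lemma altern_coef A v : altern A -> v \in S' ->
  A@_[multinom dlt (v i) | i < n.+1] = (-1) ^+ odd_perm v * A@_dlt.
Proof. by move=> alt vS; rewrite -mcoeff_sym alt // mcoeffZ. Qed.

Lemma altern_prop A B : altern A -> altern B -> degle dd A -> degle dd B ->
  B@_dlt *: A = A@_dlt *: B.
Proof.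
move=> aA aB dA dB; apply/mpolyP => m; rewrite !mcoeffZ.
have E v : v \in S' -> m = [multinom dlt (v i) | i < n.+1] ->
    B@_dlt * A@_m = A@_dlt * B@_m.
  by move=> vS ->; rewrite !altern_coef // mulrCA [RHS]mulrCA [B@_dlt * _]mulrC.
case: (eqVneq A@_m 0) => [A0|/(altern_support aA dA) [v]]; last exact: E.
case: (eqVneq B@_m 0) => [B0|/(altern_support aB dB) [v]]; last exact: E.
by rewrite A0 B0 !mulr0.
Qed.

Lemma altern_neq0 A : altern A -> degle dd A -> A != 0 -> A@_dlt != 0.
Proof.
move=> aA dA; apply: contraNneq => A0; apply/eqP/mpolyP => m; rewrite mcoeff0.
case: (eqVneq A@_m 0) => // /(altern_support aA dA) [v vS e].
by rewrite e altern_coef // A0 mulr0.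
Qed.

Variable t : K.
Hypothesis t0 : t != 0.
Hypothesis tpow : forall k, t ^+ k.+1 != 1.

Definition Aalt := \sum_(v in S') (-1) ^+ odd_perm v *: msym v (Ckp n t).

Lemma msym_Ckp v (c : K) : msym v (Ckp n c) =
  \prod_(j < n.+1 | j != last) \prod_(i < n.+1 | (i < j)%N) ker1 c (v i) (v j).
Proof.
rewrite rmorph_prod; apply: eq_bigr => j _; rewrite /= rmorph_prod.
by apply: eq_bigr => i _; rewrite /= msym_ker1.
Qed.

(* At [x_a = t^a] the factor [t x_(v j) - x_(v i)] vanishes if [v i = v j + 1]; only the summand of
   the identity survives. *)
Lemma Aalt_neq0 : Aalt != 0.
Proof.
apply/eqP => /(congr1 (meval (fun a : 'I_n.+1 => t ^+ a))) /eqP.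
have K1 i j : (ker1 t i j).@[fun a : 'I_n.+1 => t ^+ a] = t ^+ j.+1 - t ^+ i.
  by rewrite /ker1 mevalB mevalZ !mevalXU exprS.
rewrite meval0 /Aalt raddf_sum (bigD1 1%g) ?group1 //= big1 => [|v /andP [vS v1]].
  rewrite odd_perm1 expr0 scale1r msym1m addr0 rmorph_prod /=.
  rewrite prodf_seq_eq0 => /hasP [j _ /andP [_]]; rewrite rmorph_prod prodf_seq_eq0.
  case/hasP => i _ /= /andP [ij]; rewrite K1 subr_eq0 => /eqP e.
  have := tpow (j - i); rewrite -(inj_eq (mulIf (expf_neq0 i t0))) -exprD mul1r.
  by rewrite addSn subnK ?(ltnW ij) // e eqxx.
rewrite mevalZ msym_Ckp; apply/eqP; rewrite mulf_eq0; apply/orP; right.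
have [j [j' [jj' d]]] : exists j j' : 'I_n.+1, j' = j.+1 :> nat /\ ((v^-1)%g j' < (v^-1)%g j)%N.
  case: (boolP [exists j : 'I_n.+1, exists j' : 'I_n.+1,
      (j' == j.+1 :> nat) && ((v^-1)%g j' < (v^-1)%g j)%N]).
    by case/existsP => j /existsP [j' /andP [/eqP a b]]; exists j, j'.
  rewrite negb_exists => /forallP H; case/eqP: v1; apply: invg_inj; rewrite invg1.
  apply: perm_nodesc => j j' jj'; have := H j; rewrite negb_exists => /forallP /(_ j').
  rewrite jj' eqxx /= -leqNgt leq_eqVlt => /orP [/eqP /val_inj /perm_inj e|//].
  by move: jj'; rewrite e => /n_Sn.
rewrite rmorph_prod prodf_seq_eq0; apply/hasP; exists ((v^-1)%g j); rewrite ?mem_index_enum //.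
apply/andP; split.
  rewrite -(inj_eq (@perm_inj _ v)) permKV; move: vS; rewrite stab_last => /eqP ->.
  by rewrite -val_eqE /= neq_ltn; have := ltn_ord j'; rewrite jj' ltnS => ->.
rewrite rmorph_prod prodf_seq_eq0; apply/hasP; exists ((v^-1)%g j'); rewrite ?mem_index_enum //.
by rewrite d /= !permKV K1 jj' subrr.
Qed.

Lemma degle_sum (I : Type) (r : seq I) (P : pred I) (F : I -> {mpoly K[n.+1]}) (d : 'I_n.+1 -> nat) :
  (forall k, P k -> degle d (F k)) -> degle d (\sum_(k <- r | P k) F k).
Proof.
move=> H; elim/big_rec: _ => [|k p Pk D] m; first by rewrite mcoeff0 eqxx.
rewrite mcoeffD => nz; case: (eqVneq (F k)@_m 0) => [e|ne]; last exact: H ne.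
by apply: D; rewrite e add0r in nz.
Qed.

Lemma Aalt_Ckp : exists2 c : K, c != 0 & Aalt = c *: Ckp n 1.
Proof.
have aA : altern Aalt.
  by move=> v vS; exact: (msym_alt_sum (G := 'C[last | 'P]%G) (Ckp n t) vS).
have dA : degle dd Aalt.
  apply: degle_sum => v vS m; rewrite mcoeffZ mulf_eq0 negb_or => /andP [_].
  have vd i : dd (v i) = dd i.
    by move: vS; rewrite stab_last => /eqP vl; rewrite -{1}vl (inj_eq perm_inj).
  exact: (degle_msym vd (@degle_Ckp n K t)).
have aB : altern (Ckp n 1) by move=> v vS; apply: msym_Ckp1.
have dB : degle dd (Ckp n 1) := @degle_Ckp n K 1.
have c1 := altern_neq0 aA dA Aalt_neq0.
have c2 := altern_neq0 aB dB (Ckp1_neq0 n K).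
exists (((Ckp n 1)@_dlt)^-1 * Aalt@_dlt); first by rewrite mulf_neq0 ?invr_eq0.
by rewrite -scalerA -(altern_prop aA aB dA dB) scalerK.
Qed.

End Alternating.

(** * The functional [J] *)

Section Functional.
Variables (n : nat) (K : fieldType) (t : K).
Hypothesis two0 : (2%:R : K) != 0.
Hypothesis t0 : t != 0.
Hypothesis tpow : forall k, t ^+ k.+1 != 1.
Implicit Types (p g h : {mpoly K[n.+1]}) (i j : 'I_n.+1) (v w : 'S_n.+1).

Local Notation last := (@ord_max n).
Local Notation S' := 'C[last | 'P]%g.

Definition alt_sum p := \sum_(w : 'S_n.+1) (-1) ^+ odd_perm w *: msym w p.
Definition Jfun g := alt_sum (g * Ck n t).

Lemma alt_sumZ c p : alt_sum (c *: p) = c *: alt_sum p.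
Proof.
by rewrite /alt_sum scaler_sumr; apply: eq_bigr => w _; rewrite msymZ !scalerA mulrC.
Qed.

Lemma alt_sum_sum (I : Type) (r : seq I) (P : pred I) (G : I -> {mpoly K[n.+1]}) :
  alt_sum (\sum_(k <- r | P k) G k) = \sum_(k <- r | P k) alt_sum (G k).
Proof.
rewrite /alt_sum [RHS]exchange_big /=; apply: eq_bigr => w _.
by rewrite rmorph_sum scaler_sumr.
Qed.

Lemma alt_sum_perm v p : alt_sum (msym v p) = (-1) ^+ odd_perm v *: alt_sum p.
Proof.
rewrite /alt_sum scaler_sumr [RHS](reindex_inj (mulgI v)) /=; apply: eq_bigr => w _.
by rewrite -msymMm scalerA odd_permM signr_addb mulrA -signr_addb addbb mul1r.
Qed.

Lemma alt_sum_sym p g : p \is symmetric -> alt_sum (p * g) = p * alt_sum g.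
Proof.
move=> /issymP ps; rewrite /alt_sum mulr_sumr; apply: eq_bigr => w _.
by rewrite msymM ps scalerAr.
Qed.

Lemma alt_sum_eq0 p (j j' : 'I_n.+1) : j != j' -> msym (tperm j j') p = p -> alt_sum p = 0.
Proof.
move=> jj' e; have := alt_sum_perm (tperm j j') p; rewrite e odd_tperm jj' expr1 scaleN1r.
move/eqP; rewrite -subr_eq0 opprK -mulr2n -scaler_nat scaler_eq0 (negbTE two0) /=.
by move/eqP.
Qed.

Definition Crest (j j' : 'I_n.+1) := \prod_(x : 'I_n.+1 * 'I_n.+1 | (x.2 < x.1)%N && (x != (j', j)))
  ker1 t x.2 x.1.

Lemma Ck_rest (j j' : 'I_n.+1) : (j < j')%N -> Ck n t = ker1 t j j' * Crest j j'.
Proof. by move=> jj'; rewrite /Ck pair_big_dep (bigD1 (j', j)). Qed.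

(** An adjacent transposition permutes the pairs of increasing indices other than [(j, j')]. *)
Lemma msym_Crest (j j' : 'I_n.+1) : j' = j.+1 :> nat -> msym (tperm j j') (Crest j j') = Crest j j'.
Proof.
move=> jj'; have jneq : j != j' by rewrite neq_pp'.
pose s (x : 'I_n.+1 * 'I_n.+1) := (tperm j j' x.1, tperm j j' x.2).
have sK : involutive s by case=> a b; rewrite /s /= !tpermK.
rewrite /Crest rmorph_prod [RHS](reindex_inj (inv_inj sK)) /=.
apply: eq_big => [[a b]|[a b] _]; last by rewrite /= msym_ker1.
have T1 x : (tperm j j' x == j') = (x == j) by rewrite -{2}(tpermL j j') (inj_eq perm_inj).
have T2 x : (tperm j j' x == j) = (x == j') by rewrite -{2}(tpermR j j') (inj_eq perm_inj).
rewrite /s /= !xpair_eqE T1 T2.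
case: (boolP ((b == j') && (a == j))) => [/andP [/eqP -> /eqP ->]|n1].
  by rewrite tpermL tpermR !eqxx andbF (ltnNge _ j) ltnW // jj'.
case: (boolP ((b == j) && (a == j'))) => [/andP [/eqP -> /eqP ->]|n2].
  by rewrite tpermL tpermR !eqxx andbF (ltnNge j') ltnW // jj'.
by rewrite (tau_lt jj' n2 n1) [(a == j) && _]andbC n1 [(a == j') && _]andbC n2.
Qed.

(* [(t g - h) * Ck t] is fixed by the transposition. *)
Lemma Jfun_hecke (j j' : 'I_n.+1) g h : j' = j.+1 :> nat -> Trel t j j' g h ->
  Jfun h = t *: Jfun g.
Proof.
move=> jj' E; have jneq : j != j' by rewrite neq_pp'.
apply/eqP; rewrite eq_sym -subr_eq0; apply/eqP.
rewrite /Jfun -alt_sumZ -scaleN1r -alt_sumZ scalerAl scalerAl scaleN1r.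
have -> : alt_sum (t *: g * Ck n t) + alt_sum (- h * Ck n t) = alt_sum ((t *: g - h) * Ck n t).
  rewrite /alt_sum -big_split /=; apply: eq_bigr => w _.
  by rewrite -scalerDr -msymD mulrDl.
apply: (alt_sum_eq0 jneq); apply: (mulIf (subX_neq0 K jneq)).
have lt : (j < j')%N by rewrite jj'.
have E' := congr1 (msym (tperm j j')) E.
move: E'; rewrite (Ck_rest lt) !msymM (msym_Crest jj') msym_ker1 tpermL tpermR.
rewrite !(msymD, msymN, msymZ) !msymXU tpermL tpermR -msymMm tperm2 msym1m.
move: E; rewrite /Trel /ker1 -!mul_mpolyC; set sg := msym _ g; set sh := msym _ h.
move: (Crest _ _) => R E E'; apply/eqP; rewrite -subr_eq0; apply/eqP.
transitivity (- ((t%:MP * sg - sh) * ('X_j' - 'X_j)) * ((t%:MP * 'X_j - 'X_j') * R)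
   - ((t%:MP * g - h) * ('X_j - 'X_j')) * ((t%:MP * 'X_j' - 'X_j) * R)); first by ring.
rewrite E E'; ring.
Qed.

(* At [T_{q,n} P], with [P] symmetric, this is a multiple of [aD1 q t P]. *)
Definition Lfun g := \sum_(w : 'S_n.+1) Tshift t (w last) (adelta n.+1 K) * msym w g.

(** The shift affects only the factors with the last variable and turns those of the Vandermonde
    product into those of [Ck n t]. *)
Lemma Tshift_Ck : Tshift t last (Ck n 1) = Bk n t * Ckp n 1.
Proof.
have H i j : i != last -> Tshift t last (ker1 1 i j : {mpoly K[n.+1]})
    = t ^+ (j == last) *: 'X_j - 'X_i.
  move=> /negbTE il; rewrite TshiftE rmorphB /= -!TshiftE scale1r !TshiftX il.
  by rewrite expr0 scale1r.
have lt (i j : 'I_n.+1) : (i < j)%N -> i != last.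
  by move=> ij; rewrite -val_eqE /= neq_ltn (leq_trans ij) // -ltnS.
rewrite Ck_split TshiftM; congr (_ * _).
  rewrite TshiftE rmorph_prod /=; apply: eq_bigr => i il.
  by rewrite -TshiftE H // eqxx expr1.
rewrite TshiftE rmorph_prod /=; apply: eq_bigr => j jl.
rewrite rmorph_prod /=; apply: eq_bigr => i /lt il.
by rewrite -TshiftE H // (negbTE jl) expr0 /ker1.
Qed.

(** The stabilizer fixes [g] and [Bk], so replacing [Ckp] by a signed image leaves the alternating
    sum unchanged; adding over the stabilizer costs its order. *)
Lemma Jfun_alt g : (forall v, v \in S' -> msym v g = g) ->
  #|S'|%:R *: Jfun g = alt_sum (g * (Bk n t * Aalt n t)).
Proof.
move=> gS; rewrite /Aalt !mulr_sumr alt_sum_sum scaler_nat -sumr_const /=.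
apply: eq_bigr => v vS; rewrite -!scalerAr alt_sumZ; apply/esym.
rewrite -{1}(gS v vS) -(msym_Bk t vS) -!msymM alt_sum_perm scalerA.
by rewrite -signr_addb addbb scale1r -Ck_split.
Qed.

Lemma Jfun_Lfun : exists2 c, c != 0 &
  forall g, (forall v, v \in S' -> msym v g = g) -> #|S'|%:R *: Jfun g = c *: Lfun g.
Proof.
have [c c0 e] := Aalt_Ckp n two0 t0 tpow; have [b eV] := adelta_Vdm n.+1 K.
exists (c * (-1) ^+ b) => [|g gS].
  by rewrite mulf_neq0 // expf_neq0 // oppr_eq0 oner_neq0.
rewrite (Jfun_alt gS) e -!scalerAr -Tshift_Ck alt_sumZ -scalerA; congr (_ *: _).
have eC : Ck n 1 = (-1) ^+ b *: adelta n.+1 K.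
  by rewrite eV scalerA -signr_addb addbb scale1r Vdm_Ck.
rewrite eC TshiftE comp_mpolyZ -TshiftE -scalerAr alt_sumZ; congr (_ *: _).
apply: eq_bigr => w _; rewrite msymM msym_Tshift msym_adelta.
rewrite TshiftE comp_mpolyZ -TshiftE -scalerAr scalerA -signr_addb addbb scale1r mulrC.
by [].
Qed.

End Functional.

(** * Sums over the orbit of a partition *)

Section Inversions.
Variable n : nat.
Implicit Types (i j k : 'I_n) (s w : 'S_n) (f : 'I_n -> nat).

Lemma sum_delta2 (a b : 'I_n) : (\sum_(i < n) \sum_(k < n) ((i == a) && (k == b)) = 1)%N.
Proof.
rewrite (bigD1 a) //= [X in (_ + X)%N]big1 => [|i /negbTE ia]; last by rewrite big1 // => k _; rewrite ia.
by rewrite (bigD1 b) //= !eqxx big1 // => k /negbTE ->; rewrite andbF.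
Qed.

Definition asc f := (\sum_(i < n) \sum_(k < n) ((i < k) && (f i < f k)))%N.
Definition ninv s := (\sum_(i < n) \sum_(k < n) ((i < k) && (s k < s i)))%N.
(* The weight [t ^ ties] counts all members of an orbit equally (see [kap_inorb]) and completes [asc] to
   the number of inversions. *)
Definition ties f s :=
  (\sum_(i < n) \sum_(k < n) [&& i < k, s k < s i & f (s i) == f (s k)])%N.

(** As [f] is nonincreasing, the parts at an inversion of [s] are either equal or strictly
    ascending. *)
Lemma inv_ties f s : (forall i i', (i <= i')%N -> (f i' <= f i)%N) ->
  ninv s = (ties f s + asc (f \o s))%N.
Proof.
move=> fA; rewrite /ninv /ties /asc -big_split /=; apply: eq_bigr => i _.
rewrite -big_split /=; apply: eq_bigr => k _.
case: (i < k)%N => //=; case: ltnP => ski /=; last by rewrite ltnNge fA.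
by rewrite ltn_neqAle fA ?(ltnW ski) // andbT; case: eqP.
Qed.

Lemma ties_swap f s (j j' : 'I_n) : j' = j.+1 :> nat -> f (s j) != f (s j') ->
  ties f (tperm j j' * s)%g = ties f s.
Proof.
move=> jj' /negbTE ne; rewrite /ties (reindex_inj (@perm_inj _ (tperm j j'))) /=.
apply: eq_bigr => i _; rewrite (reindex_inj (@perm_inj _ (tperm j j'))) /=.
apply: eq_bigr => k _; rewrite !permM !tpermK.
case: (boolP ((i == j) && (k == j'))) => [/andP [/eqP -> /eqP ->]|n1]; first by rewrite ne !andbF.
case: (boolP ((i == j') && (k == j))) => [/andP [/eqP -> /eqP ->]|n2].
  by rewrite eq_sym ne !andbF.
by rewrite (tau_lt jj' n1 n2).
Qed.

Lemma asc_swap f (j j' : 'I_n) : j' = j.+1 :> nat -> (f j' < f j)%N ->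
  asc (f \o tperm j j') = (asc f).+1.
Proof.
move=> jj' ff; rewrite -addn1 -(sum_delta2 j' j) /asc (reindex_inj (@perm_inj _ (tperm j j'))) /=.
rewrite -big_split /=; apply: eq_bigr => i _; rewrite (reindex_inj (@perm_inj _ (tperm j j'))) /=.
rewrite -big_split /=; apply: eq_bigr => k _; rewrite !tpermK.
case: (boolP ((i == j') && (k == j))) => [/andP [/eqP -> /eqP ->]|n2].
  by rewrite tpermL tpermR jj' ltnSn ff ltnNge leqnSn.
rewrite addn0; case: (boolP ((i == j) && (k == j'))) => [/andP [/eqP -> /eqP ->]|n1].
  by rewrite [(f j < _)%N]ltnNge (ltnW ff) !andbF.
by rewrite (tau_lt jj' n1 n2).
Qed.

Lemma inv_swap s (l j j' : 'I_n) : j' = j.+1 :> nat -> (forall i, (i <= l)%N) -> s l = j ->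
  ninv s = (ninv (s * tperm j j')%g).+1.
Proof.
move=> jj' lmax sl; rewrite -addn1 -(sum_delta2 ((s^-1)%g j') l) /ninv.
have jneq : j != j' by rewrite neq_pp'.
rewrite -big_split /=; apply: eq_bigr => i _; rewrite -big_split /=; apply: eq_bigr => k _.
have Ei : (i == (s^-1)%g j') = (s i == j') by rewrite -[in RHS](permKV s j') (inj_eq perm_inj).
have Ek : (k == l) = (s k == j) by rewrite -sl (inj_eq perm_inj).
rewrite Ei Ek !permM; case: (boolP ((s i == j') && (s k == j))) => [/andP [/eqP si /eqP sk]|n2].
  have kl : k = l by apply: (@perm_inj _ s); rewrite sk sl.
  have ik : (i < k)%N.
    rewrite ltn_neqAle kl lmax andbT -kl; apply: contraNneq jneq => /val_inj e.
    by rewrite -si -sk e.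
  by rewrite ik si sk tpermL tpermR jj' ltnSn [(j.+1 < _)%N]ltnNge leqnSn.
rewrite addn0; case: (boolP ((s i == j) && (s k == j'))) => [/andP [/eqP si /eqP sk]|n1].
  have il : i = l by apply: (@perm_inj _ s); rewrite si sl.
  by rewrite il ltnNge lmax.
by rewrite [in RHS](tau_lt jj') 1?andbC // andbC.
Qed.

End Inversions.

Section Orbit.
Variables (n M : nat) (K : fieldType) (t : K) (lamF : {ffun 'I_n -> 'I_M}).
Implicit Types (a : {ffun 'I_n -> 'I_M}) (s : 'S_n).

Definition pact a s : {ffun 'I_n -> 'I_M} := [ffun i => a (s i)].
Definition inorb a := [exists s, a == pact lamF s].
Definition lamv i : nat := lamF i.

Lemma pactM a s1 s2 : pact (pact a s1) s2 = pact a (s2 * s1).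
Proof. by apply/ffunP => i; rewrite !ffunE permM. Qed.

Lemma pact1 a : pact a 1 = a.
Proof. by apply/ffunP => i; rewrite !ffunE perm1. Qed.

Lemma pact_tperm a (j j' : 'I_n) : a j = a j' -> pact a (tperm j j') = a.
Proof. by move=> e; apply/ffunP => i; rewrite ffunE; case: tpermP => [->|->|]. Qed.

Lemma pact_inj s : injective (pact^~ s).
Proof. by move=> a b /(congr1 (pact^~ (s^-1)%g)); rewrite !pactM mulVg !pact1. Qed.

Lemma inorb_pact a s : inorb (pact a s) = inorb a.
Proof.
apply/existsP/existsP => -[w /eqP e].
  by exists ((s^-1)%g * w)%g; rewrite -(inj_eq (@pact_inj s)) e pactM mulKVg.
by exists (s * w)%g; rewrite e pactM.
Qed.

Definition kap a := \sum_(s | pact lamF s == a) t ^+ ties lamv s.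

(** An adjacent exchange of different parts does not change the ties, and an exchange of equal parts
    does not change the composition. *)
Lemma kap_inorb a : inorb a -> kap a = kap lamF.
Proof.
case/existsP => s0 /eqP ->; elim/perm_desc_ind: s0 => [|s p p' pp' _ <-]; first by rewrite pact1.
rewrite -pactM; set b := pact lamF s; case: (eqVneq (b p) (b p')) => [e|ne].
  by rewrite pact_tperm.
rewrite /kap [RHS](reindex_inj (mulgI (tperm p p'))) /=; apply: eq_big => w.
  by rewrite -pactM (inj_eq (@pact_inj _)).
move/eqP => wb; rewrite ties_swap // /lamv.
by move: ne; rewrite -wb !ffunE.
Qed.

(** Lifts sums over the orbit to the symmetric group, where [ties] and [asc] add up to the
    inversions. *)
Lemma sum_ties (V : lmodType K) (X : {ffun 'I_n -> 'I_M} -> V) :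
  \sum_s t ^+ ties lamv s *: X (pact lamF s) = kap lamF *: \sum_(a | inorb a) X a.
Proof.
rewrite scaler_sumr (partition_big (pact lamF) inorb) => [|s _]; last first.
  by apply/existsP; exists s.
apply: eq_bigr => a oa; rewrite -(kap_inorb oa) /kap scaler_suml.
by apply: eq_bigr => s /eqP <-.
Qed.

End Orbit.

Lemma scale_swap (R : comNzRingType) (V : lmodType R) (a b : R) (v : V) :
  a *: (b *: v) = b *: (a *: v).
Proof. by rewrite !scalerA mulrC. Qed.

Section OrbitSum.
Variables (n M : nat) (K : fieldType) (q t : K) (lamF : {ffun 'I_n -> 'I_M}).
Hypothesis t0 : t != 0.
Hypothesis t1 : t != -1.
Hypothesis two0 : (2%:R : K) != 0.
Hypothesis den0 : forall a b : nat, 1 - q ^+ a.+1 * t ^+ b.+1 != 0.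
Implicit Types (a : {ffun 'I_n -> 'I_M}).

Lemma msym_adjacent (p : {mpoly K[n]}) :
  (forall j j' : 'I_n, j' = j.+1 :> nat -> msym (tperm j j') p = p) -> p \is symmetric.
Proof.
move=> H; apply/issymP; elim/perm_desc_ind => [|s j j' jj' _ IH]; first exact: msym1m.
by rewrite -[s](mulKg (tperm j j')) tpermV msymMm H.
Qed.

Definition Fv a := Fmac n q t (sq (lamv a)).
Definition Porb := \sum_(a | inorb lamF a) Fv a.

Lemma lamv_pact a s : lamv (pact a s) = lamv a \o s.
Proof. by apply: functional_extensionality => i; rewrite /lamv ffunE. Qed.

Lemma Porb_sym : Porb \is symmetric.
Proof.
apply: msym_adjacent => j j' jj'.
apply: (msym_sum_involution two0 (s := fun a => pact a (tperm j j'))) => [a|a|a _].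
- by rewrite pactM tperm2 pact1.
- exact: inorb_pact.
- by have := Fmac_pair_sym t0 t1 two0 den0 (lamv a) jj'; rewrite -lamv_pact.
Qed.

End OrbitSum.

Section Eigen.
Variables (n M : nat) (K : fieldType) (q t : K) (lamF : {ffun 'I_n.+1 -> 'I_M}).
Hypothesis t0 : t != 0.
Hypothesis two0 : (2%:R : K) != 0.
Hypothesis den0 : forall a b : nat, 1 - q ^+ a.+1 * t ^+ b.+1 != 0.
Hypothesis tpow : forall k, t ^+ k.+1 != 1.
Hypothesis tpos : forall (I : finType) (P : pred I) (e : I -> nat),
  (exists i, P i) -> \sum_(i | P i) t ^+ e i != 0.
Hypothesis lamA : forall i i' : 'I_n.+1, (i <= i')%N -> (lamF i' <= lamF i)%N.
Implicit Types (a : {ffun 'I_n.+1 -> 'I_M}) (s : 'S_n.+1).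

Local Notation last := (@ord_max n).
Local Notation S' := 'C[last | 'P]%g.
Local Notation F a := (Fv q t a).
Local Notation P := (Porb q t lamF).
Local Notation kp := (kap t lamF lamF).

Lemma Jfun_act s : Jfun t (F (pact lamF s)) = t ^+ asc (lamv lamF \o s) *: Jfun t (F lamF).
Proof.
elim/perm_desc_ind: s => [|s p p' pp' d IH].
  have -> : lamv lamF \o (1%g : 'S_n.+1) = lamv lamF.
    by apply: functional_extensionality => i; rewrite /= perm1.
  rewrite pact1 /asc big1 ?expr0 ?scale1r // => i _; rewrite big1 // => k _.
  case: (boolP (i < k)%N) => //= ik; apply/eqP; rewrite eqb0 -leqNgt; apply: lamA; exact: ltnW.
have -> : s = (tperm p p' * (tperm p p' * s))%g by rewrite mulgA tperm2 mul1g.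
set w := (tperm p p' * s)%g in IH *; rewrite -pactM.
have wp : w p = s p' by rewrite permM tpermL.
have wp' : w p' = s p by rewrite permM tpermR.
have -> : lamv lamF \o (tperm p p' * w)%g = lamv (pact lamF w) \o tperm p p'.
  by apply: functional_extensionality => i; rewrite /= permM /lamv ffunE.
rewrite -lamv_pact in IH.
have : (lamv (pact lamF w) p' <= lamv (pact lamF w) p)%N.
  by rewrite !lamv_pact /= wp wp'; apply: lamA; exact: ltnW.
rewrite leq_eqVlt => /orP [/eqP e|lt].
  have -> : lamv (pact lamF w) \o tperm p p' = lamv (pact lamF w).
    by apply: functional_extensionality => i /=; case: tpermP => [->|->|].
  by rewrite pact_tperm; [exact: IH | apply/esym/val_inj].
rewrite (asc_swap pp' lt) exprS -scalerA -IH; apply: (Jfun_hecke two0 pp').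
rewrite /Fv [lamv (pact (pact _ _) _)]lamv_pact; exact: (Fmac_hecke t0 two0 den0 pp' lt).
Qed.

Definition Inum : K := \sum_(s : 'S_n.+1 | s last == last) t ^+ ninv s.

(** If the last value is [m], exchanging the values [m] and [m + 1] removes exactly one
    inversion. *)
Lemma sum_inv_last (m : 'I_n.+1) :
  \sum_(s : 'S_n.+1 | s last == m) t ^+ ninv s = t ^+ (n - m) * Inum.
Proof.
have [k e] : exists k, (m + k = n)%N by exists (n - m)%N; rewrite subnKC // -ltnS.
elim: k m e => [|k IH] m e.
  have -> : m = last by apply: val_inj; rewrite addn0 in e.
  by rewrite subnn mul1r.
have m'n : (m.+1 < n.+1)%N by lia.
pose m' := Ordinal m'n; have mm' : m' = m.+1 :> nat by [].
have -> : (n - m)%N = (n - m').+1 by rewrite /=; lia.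
have em : (m' + k)%N = n by rewrite mm' addSnnS.
rewrite exprS -mulrA -(IH m' em) mulr_sumr.
rewrite (reindex_inj (mulIg (tperm m m'))) /=; apply: eq_big => s.
  by rewrite permM -{2}(tpermR m m') (inj_eq perm_inj).
move=> /eqP sl; rewrite -exprS (inv_swap (l := last) mm') //.
- by rewrite -mulgA tperm2 mulg1.
- by move=> i; rewrite -ltnS.
Qed.

Lemma Jfun_sum (I : Type) (r : seq I) (Q : pred I) (c : I -> K) (G : I -> {mpoly K[n.+1]}) :
  Jfun t (\sum_(k <- r | Q k) c k *: G k) = \sum_(k <- r | Q k) c k *: Jfun t (G k).
Proof.
rewrite /Jfun mulr_suml alt_sum_sum; apply: eq_bigr => k _.
by rewrite -scalerAl alt_sumZ.
Qed.

(** Applied to powers of [q], which give the shifted orbit sum, and to the constant 1, which gives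
    the orbit sum itself; comparing the two yields the eigenvalue. *)
Lemma Jfun_orbit (c : 'I_M -> K) :
  kp *: Jfun t (\sum_(a | inorb lamF a) c (a last) *: F a)
  = ((\sum_(m < n.+1) c (lamF m) * t ^+ (n - m)) * Inum) *: Jfun t (F lamF).
Proof.
rewrite Jfun_sum -(sum_ties t lamF (fun a => c (a last) *: Jfun t (F a))).
rewrite mulr_suml scaler_suml (partition_big (fun s : 'S_n.+1 => s last) xpredT) //=.
apply: eq_bigr => m _; rewrite -mulrA -sum_inv_last mulr_sumr scaler_suml.
apply: eq_bigr => s /eqP sl; rewrite Jfun_act !scalerA ffunE sl mulrCA -exprD.
by rewrite -(inv_ties (f := lamv lamF)).
Qed.

(** On a symmetric [P] the relabelling inside [rotsub] has no effect, so only the [q]-shift remains;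
    on the other side, rotation permutes the orbit. *)
Lemma Tshift_Porb : P \is symmetric ->
  Tshift q last P = \sum_(a | inorb lamF a) q ^+ a last *: F a.
Proof.
move=> /issymP Ps; transitivity (P \mPo rotsub n q).
  rewrite -[in RHS](Ps (rotp n)) msym_mPo TshiftE; congr (_ \mPo _).
  apply: eq_from_tnth => i; rewrite !tnth_mktuple permK; congr (_ ^+ _ *: _).
rewrite /Porb (reindex_inj (@pact_inj _ _ (rotp n)^-1%g)) rmorph_sum /=.
apply: eq_big => a; first exact: inorb_pact.
by move=> _; rewrite /Fv lamv_pact; exact: (Fmac_rot (lamv a) t0 two0 den0).
Qed.

Lemma sum_perm_last (V : zmodType) (G : 'I_n.+1 -> V) :
  \sum_(s : 'S_n.+1) G (s last) = (\sum_i G i) *+ #|S'|.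
Proof.
rewrite (partition_big (fun s : 'S_n.+1 => s last) xpredT) //= -sumrMnl.
apply: eq_bigr => i _; rewrite (eq_bigr (fun=> G i)) => [|s /eqP -> //].
rewrite (reindex_inj (mulIg (tperm last i))) -sumr_const /=; apply: eq_bigl => s.
by rewrite permM -{2}(tpermL last i) (inj_eq perm_inj) stab_last.
Qed.

Theorem aD1_Porb : aD1 q t P
  = (\sum_(i < n.+1) q ^+ lamF i * t ^+ (n - i)) *: (adelta n.+1 K * P).
Proof.
have t1 : t != -1 by apply: contraNneq (tpow 1) => ->; rewrite sqrrN expr1n.
have Ps := Porb_sym lamF t0 t1 two0 den0; have /issymP Ps' := Ps.
(* [E] and [N] are the weighted sums of [Jfun_orbit] for powers of [q] and for 1. [N] occurs again
   in [Lfun t 1] and cancels, leaving the eigenvalue [E]. *)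
set E := \sum_(i < n.+1) _; set N := \sum_(i < n.+1) t ^+ i.
have N0 : N != 0 by apply: (tpos (P := xpredT)); exists last.
have eN : N = \sum_(i < n.+1) 1 * t ^+ (n - i).
  rewrite /N (reindex_inj rev_ord_inj) /=; apply: eq_bigr => i _.
  by rewrite mul1r subSS.
have k0 : kp != 0 by apply: tpos; exists 1%g; rewrite pact1.
have S0 : (#|S'|%:R : K) != 0.
  have := @tpos 'S_n.+1 (mem S') (fun=> 0%N); rewrite expr0 sumr_const; apply.
  by exists 1%g; rewrite inE group1.
have E1 : N *: Jfun t (Tshift q last P) = E *: (P * Jfun t 1).
  have -> : P * Jfun t 1 = Jfun t P by rewrite /Jfun mul1r alt_sum_sym.
  apply: (scalerI k0); rewrite [LHS](scale_swap kp N) [RHS](scale_swap kp E).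
  rewrite (Tshift_Porb Ps) (Jfun_orbit (fun b => q ^+ b)) -/E.
  have -> : P = \sum_(a | inorb lamF a) 1 *: F a by apply: eq_bigr => a _; rewrite scale1r.
  rewrite (Jfun_orbit (fun=> 1)) -eN !scalerA; congr (_ *: _); ring.
have [c c0 JL] := Jfun_Lfun n two0 t0 tpow.
have JT := JL (Tshift q last P); have J1 := JL 1.
have E2 : N *: Lfun t (Tshift q last P) = E *: (P * Lfun t 1).
  apply: (scalerI c0); rewrite [LHS](scale_swap c N) [RHS](scale_swap c E) scalerAr -J1 => [|v _]; last exact: msym1.
  rewrite -JT => [|v]; last first.
    by rewrite stab_last => /eqP vl; rewrite msym_Tshift vl Ps'.
  by rewrite scale_swap E1 -scalerAr [RHS]scale_swap.
have L1 : Lfun t 1 = (#|S'|%:R * N) *: adelta n.+1 K.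
  rewrite -scalerA -sum_Tshift_adelta scaler_nat -sum_perm_last.
  by apply: eq_bigr => w _; rewrite msym1 mulr1.
have LT : Lfun t (Tshift q last P) = #|S'|%:R *: aD1 q t P.
  rewrite scaler_nat /aD1 -(sum_perm_last (fun i => Tshift t i (adelta n.+1 K) * Tshift q i P)).
  by apply: eq_bigr => w _; rewrite msym_Tshift Ps'.
move: E2; rewrite L1 LT -scalerAr -!scalerA scale_swap [RHS]scale_swap => /(scalerI S0).
rewrite [RHS]scale_swap => /(scalerI N0) ->; congr (_ *: _); by rewrite mulrC.
Qed.

End Eigen.

(** * The orbit sum of a partition and its monomials *)

Lemma perm_sqP n (f g : 'I_n -> nat) :
  reflect (exists s : 'S_n, forall i, f i = g (s i)) (perm_eq (sq f) (sq g)).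
Proof.
apply: (iffP idP) => [|[s e]]; last first.
  have -> : f = g \o s by apply: functional_extensionality.
  exact: perm_sq.
have sf : size (sq f) == n by rewrite size_sq.
have sg : size (sq g) == n by rewrite size_sq.
rewrite -[sq f]/(val (Tuple sf)) -[sq g]/(val (Tuple sg)) => /tuple_permP [s es].
exists s => i; have := congr1 (fun x : seq nat => nth 0%N x i) es.
rewrite /= nth_sq => ->.
by rewrite -[LHS]/(nth 0%N [tuple _ | _ < n] i) nth_mktuple (tnth_nth 0%N) /= nth_sq.
Qed.

Lemma inorbE n M (l a : {ffun 'I_n -> 'I_M}) : inorb l a = perm_eq (sq (lamv a)) (sq (lamv l)).
Proof.
apply/existsP/perm_sqP => -[s e]; exists s.
  by move=> i; rewrite /lamv (eqP e) ffunE.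
by apply/eqP/ffunP => i; rewrite ffunE; apply: val_inj; exact: e.
Qed.

Lemma perm_strongpart (s1 s2 : seq nat) : size s1 = size s2 ->
  perm_eq (strongpart s1) (strongpart s2) = perm_eq s1 s2.
Proof.
have H s : perm_eq s (strongpart s ++ nseq (size s - size (strongpart s)) 0%N).
  have -> : nseq (size s - size (strongpart s)) 0%N = [seq x <- s | predC (fun x => x != 0%N) x].
    have -> : (size s - size (strongpart s))%N = size [seq x <- s | predC (fun x => x != 0%N) x].
      by rewrite !size_filter -{1}(count_predC (fun x => x != 0%N) s) addKn.
    by apply/esym/all_pred1P/allP => x; rewrite mem_filter /= negbK => /andP [].
  by rewrite perm_sym; apply: permEl; exact: perm_filterC.
move=> ss; apply/idP/idP => [p|]; last exact: perm_filter.
rewrite (permPl (H s1)) perm_sym (permPl (H s2)) perm_sym ss (perm_size p).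
by rewrite perm_cat2r.
Qed.

Lemma geq_trans : transitive geq.
Proof. by move=> y x z xy yz; exact: leq_trans yz xy. Qed.

Section Partition.
Variables (n : nat) (K : fieldType) (q t : K) (la : seq nat).
Hypothesis laP : is_partition la.
Hypothesis lan : (size la <= n)%N.

Local Notation M := (sumn la).+1.
Definition lamn := la ++ nseq (n - size la) 0%N.
Definition lamF : {ffun 'I_n -> 'I_(sumn la).+1} := [ffun i : 'I_n => inord (nth 0%N la i)].

Lemma lamvE : lamv lamF = fun i : 'I_n => nth 0%N la i.
Proof.
apply: functional_extensionality => i; rewrite /lamv ffunE inordK // ltnS.
exact: acol_le.
Qed.

Lemma nth_lamn i : nth 0%N lamn i = nth 0%N la i.
Proof.
rewrite nth_cat; case: ltnP => // li; rewrite nth_nseq if_same nth_default //.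
Qed.

Lemma sq_lamF : sq (lamv lamF) = lamn.
Proof.
rewrite lamvE [RHS](@sq_nth n); last by rewrite size_cat size_nseq subnKC.
by apply: eq_map => i; rewrite nth_lamn.
Qed.

Lemma sorted_lamn : sorted geq lamn.
Proof.
case/andP: laP => sl _; rewrite /lamn sorted_pairwise; last exact: geq_trans.
rewrite pairwise_cat -!sorted_pairwise; try exact: geq_trans.
rewrite sl /=; apply/andP; split; first by apply/allrelP => x y _ /nseqP [->].
by elim: (n - size la)%N => [//|[//|k] IH] /=; exact: IH.
Qed.

Lemma lamF_anti (i i' : 'I_n) : (i <= i')%N -> (lamF i' <= lamF i)%N.
Proof.
move=> ii'; rewrite -[X in (X <= _)%N]/(lamv lamF i') -[X in (_ <= X)%N]/(lamv lamF i).
rewrite lamvE -!nth_lamn.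
have sz : size lamn = n by rewrite size_cat size_nseq subnKC.
by apply: (sorted_leq_nth geq_trans leqnn 0%N sorted_lamn) => //; rewrite inE sz.
Qed.

(** The index type in [Gmac] depends on [sumn gamma]; naming this sum gives all rearrangements of a
    partition a common index type. *)
Lemma GmacE N gamma : sumn gamma = N -> Gmac n q t gamma =
  \sum_(a : {ffun 'I_n -> 'I_N.+1} | strongpart (sq (lamv a)) == gamma) Fv q t a.
Proof. by move=> <-. Qed.

Lemma sum_Gmac : \sum_(gamma <- permutations la) Gmac n q t gamma = Porb q t lamF.
Proof.
transitivity (\sum_(gamma <- permutations la)
    \sum_(a : {ffun 'I_n -> 'I_M} | strongpart (sq (lamv a)) == gamma) Fv q t a).
  rewrite !big_seq; apply: eq_bigr => gamma; rewrite mem_permutations => p.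
  by apply: GmacE; exact: perm_sumn.
under eq_bigr do rewrite big_mkcond.
rewrite exchange_big /= /Porb [RHS]big_mkcond /=; apply: eq_bigr => a _.
have -> : inorb lamF a = (strongpart (sq (lamv a)) \in permutations la).
  rewrite inorbE mem_permutations -perm_strongpart ?size_sq // sq_lamF; congr perm_eq.
  rewrite /strongpart filter_cat; case/andP: laP => _ /allP pos.
  rewrite (_ : [seq x <- nseq _ _ | _] = [::]) ?cats0.
    by apply/all_filterP/allP => x /pos; rewrite lt0n.
  by apply/eqP; rewrite -[_ == _]negbK -has_filter; apply/hasPn => x /nseqP [->].
case: ifP => [ap|ap].
  rewrite (bigD1_seq (strongpart (sq (lamv a)))) ?permutations_uniq //= eqxx.
  by rewrite big1 ?addr0 // => g; rewrite eq_sym => /negbTE ->.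
rewrite big1_seq // => g /= gp; case: eqP => // e; by rewrite e gp in ap.
Qed.

End Partition.

Lemma sumn_take_sq n (g : 'I_n -> nat) k : (k <= n)%N ->
  sumn (take k (sq g)) = (\sum_(i < n | (i < k)%N) g i)%N.
Proof.
move=> kn; rewrite sumnE (big_nth 0%N) big_mkord size_take size_sq.
have -> : (if (k < n)%N then k else n) = k by case: ltngtP kn.
rewrite (eq_bigr (fun i : 'I_k => nth 0%N (sq g) i)) => [|i _]; last by rewrite nth_take.
rewrite (big_ord_widen n (fun i => nth 0%N (sq g) i) kn).
by apply: eq_bigr => i _; rewrite nth_sq.
Qed.

Section MonomialExpansion.
Variables (n : nat) (K : fieldType) (q t : K) (la : seq nat).
Hypothesis t0 : t != 0.
Hypothesis two0 : (2%:R : K) != 0.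
Hypothesis den0 : forall a b : nat, 1 - q ^+ a.+1 * t ^+ b.+1 != 0.
Hypothesis laP : is_partition la.
Hypothesis lan : (size la <= n)%N.

Local Notation lF := (lamF n la).
Local Notation h := (hinc (lamv lF)).
Implicit Types (a : {ffun 'I_n -> 'I_(sumn la).+1}) (m : 'X_{1..n}).

Lemma hrev_lamF (i : 'I_n) : hrev h i = nth 0%N la i.
Proof.
rewrite /hrev /hinc /acol sq_lamF //.
have -> : inc (lamn n la) = rev (lamn n la).
  apply: (sorted_eq leq_trans anti_leq); first exact: sort_sorted leq_total _.
    by rewrite rev_sorted; exact: sorted_lamn.
  by rewrite perm_sort perm_sym perm_rev.
have sz : size (lamn n la) = n by rewrite size_cat size_nseq subnKC.
have e : (n - (rev_ord i).+1)%N = i by rewrite /=; have := ltn_ord i; lia.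
by rewrite nth_rev sz ?e ?nth_lamn.
Qed.

Lemma Fv_Zrow a : inorb lF a -> exists2 beta : 'S_n, (forall i, lamv a (beta i) = h i) &
  Fv q t a = Zrow h q t (sumn (sq (lamv lF))) 0 (brow beta).
Proof.
case/existsP => s /eqP ->; rewrite /Fv lamv_pact.
have [beta H] := basement_exists (lamv lF \o s).
exists beta; first by move=> i; rewrite H hinc_perm.
by rewrite (Fmac_basement t0 two0 den0 H) hinc_perm sumn_perm.
Qed.

Lemma Fv_lead a : inorb lF a -> (Fv q t a)@_[multinom nth 0%N la i | i < n] = (a == lF)%:R.
Proof.
move=> oa; have [beta H ->] := Fv_Zrow oa.
have -> : [multinom nth 0%N la i | i < n] = mres h 0.
  by apply/mnmP => i; rewrite !mnmE hrev_lamF subn0.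
have lab i : haslab (brow beta) i = (0 <= hrev h i)%N.
  by rewrite leq0n; apply/existsP; exists ((beta^-1)%g i); rewrite ffunE permKV.
rewrite (Zrow_lead q t (hinc_nondec _) (rowok_brow _ _) (hinc_le _) lab).
congr (nat_of_bool _)%:R; apply/forallP/eqP => [G|e u].
  apply/ffunP => i; apply: val_inj; have := forallP (G ((beta^-1)%g i)) i.
  rewrite ffunE permKV eqxx -H permKV hrev_lamF => /eqP e.
  by rewrite -[RHS]/(lamv lF i) lamvE e.
apply/forallP => i; apply/implyP; rewrite ffunE => /eqP /lbl_inj <-.
by rewrite hrev_lamF -H e lamvE.
Qed.

Lemma Porb_lead : (Porb q t lF)@_[multinom nth 0%N la i | i < n] = 1.
Proof.
have oF : inorb lF lF by rewrite inorbE.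
rewrite raddf_sum (bigD1 lF) //= Fv_lead // eqxx big1 ?addr0 // => a /andP [oa /negbTE ne].
by rewrite Fv_lead // ne.
Qed.

Lemma Porb_dominated m : (Porb q t lF)@_m != 0 -> dominated (sort geq (m : seq nat)) (lamn n la).
Proof.
move=> nz; have [a oa] : exists2 a, inorb lF a & (Fv q t a)@_m != 0.
  move: nz; case: (boolP [exists a, inorb lF a && ((Fv q t a)@_m != 0)]).
    by case/existsP => a /andP [x y] _; exists a.
  rewrite negb_exists => /forallP H; rewrite raddf_sum big1 ?eqxx // => a oa.
  by have := H a; rewrite oa /= negbK => /eqP.
have [beta _ ->] := Fv_Zrow oa.
case/(Zrow_dom (r := 0) (hinc_nondec _) (hinc_le _)) => E1 E2.
have lamnE : lamn n la = sq (hrev h).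
  by rewrite -sq_lamF //; apply: eq_map => i; rewrite hrev_lamF lamvE.
have sM : sumn (sq (fun i => m i)) = (\sum_i m i)%N.
  by rewrite -[sq _](take_size) size_sq sumn_take_sq //; apply: eq_bigl => i; rewrite ltn_ord.
have sL : sumn (lamn n la) = (\sum_i hrev h i)%N.
  rewrite lamnE -[sq _](take_size) size_sq sumn_take_sq //.
  by apply: eq_bigl => i; rewrite ltn_ord.
have [p em] : exists p : 'S_n, sort geq (m : seq nat) = sq ((fun i => m i) \o p).
  have sz : size (sort geq (m : seq nat)) = n by rewrite size_sort size_tuple.
  rewrite (sq_nth sz); set g := (fun i : 'I_n => _).
  have : perm_eq (sq g) (sq (fun i => m i)) by rewrite -sq_nth // -mseq_sq perm_sort.
  by case/perm_sqP => p e; exists p; apply: eq_map => i; exact: e.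
apply/andP; split.
  rewrite em sumn_perm sM sL E1; apply/eqP; apply: eq_bigr => i _; exact: subn0.
have sz : size (lamn n la) = n by rewrite size_cat size_nseq subnKC.
apply/allP => k; rewrite mem_iota add0n sz ltnS => /andP [_ kn].
rewrite em lamnE !sumn_take_sq //.
(* [p] sorts [m], so the [k] largest exponents sit at these indices. *)
have := E2 [set p i | i in [set i : 'I_n | (i < k)%N]].
rewrite card_imset; last exact: perm_inj.
rewrite big_imset /=; last by move=> x y _ _; exact: perm_inj.
have -> : #|[set i : 'I_n | (i < k)%N]| = k.
  by rewrite cardsE -sum1_card -(big_ord_widen n (fun=> 1%N) kn) sum1_card card_ord.
rewrite (eq_bigl (fun i : 'I_n => (i < k)%N)) => [H|i]; last by rewrite inE.
by apply: leq_trans H _; apply: leq_sum => i _; rewrite subn0.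
Qed.

End MonomialExpansion.

(** * The parameters [q] and [t] as indeterminates *)

Lemma tQ_pos (I : finType) (P : pred I) (e : I -> nat) :
  (exists i, P i) -> \sum_(i | P i) tQ ^+ e i != 0.
Proof.
case=> i0 Pi0; have -> : \sum_(i | P i) tQ ^+ e i = tofrac (\sum_(i | P i) 'X^(e i)).
  by rewrite rmorph_sum; apply: eq_bigr => i _; rewrite /= rmorphXn.
(* At [t = 1] the sum becomes the number of its terms, nonzero in characteristic 0. *)
rewrite tofrac_eq0; apply/eqP => /(congr1 (horner^~ 1)) /eqP.
rewrite horner_sum horner0 (eq_bigr (fun=> 1)) => [|i _]; last by rewrite hornerXn expr1n.
rewrite sumr_const -polyC_natr polyC_eq0 Num.Theory.pnatr_eq0; apply/negP; rewrite -lt0n.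
by apply/card_gt0P; exists i0.
Qed.

Lemma tQ_neq0 : tQ != 0.
Proof. by rewrite tofrac_eq0 polyX_eq0. Qed.

Lemma tQ_pow k : tQ ^+ k.+1 != 1.
Proof.
have -> : tQ ^+ k.+1 = tofrac ('X^(k.+1)) by rewrite rmorphXn.
rewrite -(rmorph1 (@tofrac _)) tofrac_eq; apply/eqP => /(congr1 (fun p => size (polyseq p))).
by rewrite size_polyXn size_poly1.
Qed.

Lemma Qqt_two : (2%:R : Qqt) != 0.
Proof.
have := @tQ_pos bool xpredT (fun=> 0%N); rewrite expr0 sumr_const card_bool; apply.
by exists true.
Qed.

Lemma Qqt_den (a b : nat) : 1 - qQ ^+ a.+1 * tQ ^+ b.+1 != 0.
Proof.
have -> : 1 - qQ ^+ a.+1 * tQ ^+ b.+1 = tofrac (1 - (('X : {poly rat})%:P) ^+ a.+1 * 'X^(b.+1)).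
  by rewrite rmorphB rmorph1 rmorphM !rmorphXn.
rewrite tofrac_eq0; apply/eqP => /(congr1 (fun p : {poly {poly rat}} => p`_0)) /eqP.
by rewrite coefB coef1 coefMXn /= subr0 coef0 oner_eq0.
Qed.

Theorem mainTheorem13 (n : nat) :
  (* (A) *)
  (forall lam : seq nat, is_partition lam -> (size lam <= n)%N ->
     is_macdonaldP qQ tQ lam
       (\sum_(gamma <- permutations lam) Gmac n qQ tQ gamma))
  (* (B) *)
  /\ (forall gamma : seq nat, strong_composition gamma -> (size gamma <= n)%N ->
     quasisymmetric (Gmac n qQ tQ gamma))
  (* (C') *)
  /\ (forall alpha : seq nat, size alpha = n ->
     Fmac n (0 : Qt) tT alpha = Emac alpha (1%g : 'S_n) (0 : Qt) tT)
  (* (C) *)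
  /\ (forall gamma : seq nat, strong_composition gamma -> (size gamma <= n)%N ->
     Gmac n (0 : rat) 0 gamma = QS n gamma).
Proof.
have t1 : tQ != -1 by apply: contraNneq (tQ_pow 1) => ->; rewrite sqrrN expr1n.
split; [|split; [|split]].
- move=> lam lamP lamn; rewrite sum_Gmac //; split.
  + exact: Porb_sym tQ_neq0 t1 Qqt_two Qqt_den.
  + exact: Porb_lead tQ_neq0 Qqt_two Qqt_den lamP lamn.
  + move=> m; exact: Porb_dominated tQ_neq0 Qqt_two Qqt_den lamP lamn m.
  + case: n lamn => [|n] lamn; first by rewrite /aD1 !big_ord0 scale0r.
    rewrite (aD1_Porb tQ_neq0 Qqt_two Qqt_den tQ_pow tQ_pos (lamF_anti lamP lamn)).
    congr (_ *: _); apply: eq_bigr => i _; congr (_ ^+ _ * _).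
    by rewrite -[LHS]/(lamv (lamF n.+1 lam) i) lamvE.
- by move=> gamma _ _; exact: Gmac_quasisymmetric tQ_neq0 t1 Qqt_two Qqt_den gamma.
- by move=> alpha; exact: Fmac_q0 tT_neq0 Qt_two.
- by move=> gamma _ _; exact: Gmac_q0t0.
Qed.
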